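(* Let $P^{00}$ be the law on $\mathscr{U}$ of the bridge, from and to $0$ on $[0,1]$, of the continuous-time random walk on $\mathbb{Z}$ with unit jump rates up and down. Let $\mathbf{P}^{00}$ be the law on $\mathscr{U}$ of the bridge, from and to $0$ on $[0,1]$, of the continuous-time random walk on $\mathbb{Z}$ which jumps from $j$ to $j+1$ at rate $a(j)$ and from $j$ to $j-1$ at rate $b(j)$, where $a,b:\mathbb{Z}\to(0,+\infty)$. Set $$M(X):=\exp\left(-\int_0^1\big(a(X_{t-})+b(X_{t-})\big)\,dt\right)\prod_{t\in\mathbb{U}(X)^+}a(X_{t-})\prod_{s\in\mathbb{U}(X)^-}b(X_{s-})$$ and $$\nabla_{u,v}\log M(U):=\frac{M(\mathbb{X}(\Psi_{u,v}U))-M(\mathbb{X}(U))}{M(\mathbb{X}(U))}.$$ Then $$d_{W,1}(\mathbf{P}^{00},P^{00})\le9\,E_{\mathbf{P}^{00}}\left[\sup_{(u,v)\in(0,1)^2\setminus\Delta}\big|\nabla_{u,v}\log M(U)\big|\right].$$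
   Context: The rates $a,b$ are such that the walk with generator $\mathcal{G}f(j)=a(j)(f(j+1)-f(j))+b(j)(f(j-1)-f(j))$ defines a law $\mathbf{P}$ on $\mathbb{D}([0,1];\mathbb{Z})$; its bridge is $\mathbf{P}(\cdot\mid X_0=0,X_1=0)$. $\Delta$ is the diagonal. $\mathscr{U}$ is the set of pairs $U=(U^+,U^-)$ of finite disjoint subsets of $(0,1)$ with $|U^+|=|U^-|$. Piecewise constant càdlàg paths $X$ on $[0,1]$ from $0$ to $0$ with jumps $\pm1$ are in bijection with $\mathscr{U}$ via $\mathbb{U}(X)=(\mathbb{U}(X)^+,\mathbb{U}(X)^-)$, the sets of times of $+1$ jumps and of $-1$ jumps; $\mathbb{X}=\mathbb{U}^{-1}$. $\mathscr{U}$ carries the transported $\sigma$-algebra, and bridge laws are identified with their push-forward to $\mathscr{U}$. For $(r,s)\in(0,1)^2\setminus\Delta$ define $\Psi_{r,s}U=(U^+\cup\{r\},U^-\cup\{s\})$ if $r\notin U^+$, $s\notin U^-$; $\Psi_{r,s}U=(U^+\setminus\{r\},U^-\setminus\{s\})$ if $r\in U^+$, $s\in U^-$; and $\Psi_{r,s}U=U$ otherwise (also $\Psi_{r,s}U=U$ if the first rule would give a pair not in $\mathscr{U}$; for each $U$ this concerns only a Lebesgue-null set of $(r,s)$). $d$ is the graph distance on $\mathscr{U}$ with $U\ne V$ neighbours iff $U=\Psi_{r,s}V$ for some $(r,s)$. $\mathrm{Lip}_1(\mathscr{U})$ is the set of measurable $f:\mathscr{U}\to\mathbb{R}$ with $|f(U)-f(V)|\le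 d(U,V)$, and $d_{W,1}(\mu,\nu)=\sup\{|\int f\,d\mu-\int f\,d\nu|:f\in\mathrm{Lip}_1(\mathscr{U}),\ f\ \mu\text{- and }\nu\text{-integrable}\}$. *)

(* Defs.v *)
From HB Require Import structures.
From mathcomp Require Import all_boot all_order all_algebra finmap.
From mathcomp Require Import all_classical all_reals all_analysis.

Set Implicit Arguments.
Unset Strict Implicit.
Unset Printing Implicit Defensive.

Import Order.TTheory GRing.Theory Num.Theory.
Import numFieldNormedType.Exports.

Local Open Scope classical_set_scope.
Local Open Scope ring_scope.

(** * The path space D([0,1]; Z) *)

(* Convergence in the discrete space Z is eventual equality. A path is a
   function on the whole line, frozen outside [0,1], so that two paths are equal
   as soon as they agree on [0,1]. *)
Definition is_cadlag (R : realType) (w : R -> int) : Prop :=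
  [/\ forall t, 0 <= t < 1 -> \forall s \near t^'+, w s = w t,
      forall t, 0 < t <= 1 -> exists k, \forall s \near t^'-, w s = k,
      forall t, t < 0 -> w t = w 0
    & forall t, 1 < t -> w t = w 1].

Record skorokhod (R : realType) :=
  Skorokhod { path_fun :> R -> int; path_cadlag : is_cadlag path_fun }.

Lemma skorokhod_eq (R : realType) (w w' : skorokhod R) : w =1 w' -> w = w'.
Proof.
case: w w' => [w cw] [w' cw'] /= /funext e.
by case: _ / e cw' => cw'; congr Skorokhod; exact: Prop_irrelevance.
Qed.

Lemma cadlag_cst0 (R : realType) : is_cadlag (fun _ : R => 0%Z).
Proof. by split=> // t _; [near=> s | exists 0; near=> s]. Unshelve. all: by end_near. Qed.

HB.instance Definition _ (R : realType) := gen_eqMixin (skorokhod R).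
HB.instance Definition _ (R : realType) := gen_choiceMixin (skorokhod R).
HB.instance Definition _ (R : realType) :=
  isPointed.Build (skorokhod R) (Skorokhod (cadlag_cst0 R)).

(* [history t] is the sigma-algebra generated by the coordinates up to time t;
   the sigma-algebra of the path space is [history 1]. *)
Definition cylinders (R : realType) (t : R) : set (set (skorokhod R)) :=
  [set A | exists r k, 0 <= r <= t /\ A = [set w : skorokhod R | w r = k]].

Definition history (R : realType) (t : R) : set (set (skorokhod R)) :=
  <<s cylinders t >>.

Definition skorokhod_display : measure_display.
Proof. by constructor. Qed.

HB.instance Definition _ (R : realType) :=
  @isMeasurable.Build skorokhod_display (skorokhod R) (history 1)
    (@sigma_algebra0 _ setT (cylinders 1))
    (@sigma_algebraC _ (cylinders 1))
    (@sigma_algebra_bigcup _ setT (cylinders 1)).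

(* X_{t-}; the default value 0 of [xget] is never used for 0 < t. *)
Definition left_value (R : realType) (w : skorokhod R) (t : R) : int :=
  xget 0 [set k | \forall s \near t^'-, w s = k].

Definition jump_times (R : realType) (e : int) (w : skorokhod R) : set R :=
  [set t | 0 < t < 1 /\ w t = left_value w t + e].

Lemma left_valueE (R : realType) (w : skorokhod R) (t : R) (k : int) :
  (\forall s \near t^'-, w s = k) -> left_value w t = k.
Proof.
move=> wk; rewrite /left_value; apply: xget_unique => // l wl.
have : \forall s \near t^'-, l = k by apply: filterS2 wk wl => s -> ->.
by move=> /filter_ex[].
Qed.

(** * The law of the walk *)

Definition walk_generator (R : realType) (a b : int -> R) (f : int -> R)
    (j : int) : R :=
  a j * (f (j + 1) - f j) + b j * (f (j - 1) - f j).

(* P is the law of a Markov jump process with generator [walk_generator a b],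
   in the sense of the martingale problem: for every finitely supported f,
   f(X_t) - \int_0^t (G f)(X_r) dr is a martingale. The initial law is free.
   Finitely supported f keep G f bounded when the rates are not; since paths in
   the Skorokhod space do not explode, these f determine P from the initial
   law. *)
Definition has_generator (R : realType) (a b : int -> R)
    (P : probability (skorokhod R) R) : Prop :=
  forall f : int -> R, finite_set [set j | f j != 0] ->
  forall s t : R, 0 <= s -> s <= t -> t <= 1 ->
  forall A : set (skorokhod R), history s A ->
  (\int[P]_(w in A) (f (w t) - f (w s) -
     \int[lebesgue_measure]_(r in `[s, t]) walk_generator a b f (w r))%:E
   = 0)%E.

(** * The space of pairs of jump sets *)

Definition is_jump_pair (R : realType) (p : set R * set R) : Prop :=
  [/\ finite_set p.1 /\ finite_set p.2,
      p.1 `<=` [set t | 0 < t < 1] /\ p.2 `<=` [set t | 0 < t < 1],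
      p.1 `&` p.2 = set0
    & (p.1 #= p.2)%card].

Definition jump_pair (R : realType) : Type :=
  {p : set R * set R | `[< is_jump_pair p >]}.

HB.instance Definition _ (R : realType) := SubType.on (jump_pair R).

Definition ups (R : realType) (U : jump_pair R) : set R := (val U).1.
Definition downs (R : realType) (U : jump_pair R) : set R := (val U).2.

Lemma jump_pairP (R : realType) (U : jump_pair R) :
  is_jump_pair (ups U, downs U).
Proof. by case: U => -[p q] /= h; apply/asboolP. Qed.

Lemma is_jump_pair0 (R : realType) : `[< is_jump_pair (set0 : set R, set0 : set R) >].
Proof. by apply/asboolP; split; rewrite /= ?setI0 ?card_eqxx//; split. Qed.

HB.instance Definition _ (R : realType) := gen_eqMixin (jump_pair R).
HB.instance Definition _ (R : realType) := gen_choiceMixin (jump_pair R).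
HB.instance Definition _ (R : realType) :=
  isPointed.Build (jump_pair R) (exist _ (set0, set0) (is_jump_pair0 R)).

Definition count_le (R : realType) (F : set R) (t : R) : nat :=
  #|` fset_set (F `&` [set r | r <= t])|.

Definition count_lt (R : realType) (F : set R) (t : R) : nat :=
  #|` fset_set (F `&` [set r | r < t])|.

Lemma near_finite (T : Type) (I : choiceType) (F : set I) (G : set_system T)
    (Q : I -> T -> Prop) : Filter G -> finite_set F ->
  (forall i, F i -> \forall x \near G, Q i x) ->
  \forall x \near G, forall i, F i -> Q i x.
Proof.
move=> FG finF FQ.
have : G (\bigcap_(i in [set` fset_set F]) Q i).
  by apply: filter_bigI => i; rewrite in_fset_set// inE => /FQ.
apply: filterS => x h i Fi; apply: h.
by rewrite /= in_fset_set// inE.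
Qed.

Lemma count_le_right (R : realType) (F : set R) (t : R) : finite_set F ->
  \forall s \near t^'+, count_le F s = count_le F t.
Proof.
move=> finF.
have : \forall s \near t^'+, forall r, F r -> (r <= s) = (r <= t).
  apply: near_finite => // r _; case: (leP r t) => rt.
    by apply: filterS (nbhs_right_ge t) => s; exact: le_trans.
  by apply: filterS (nbhs_right_lt rt) => s; rewrite ltNge => /negbTE.
apply: filterS => s h; rewrite /count_le; congr (#|` fset_set _|).
by apply/seteqP; split=> r [Fr] /=; rewrite h.
Qed.

Lemma count_le_left (R : realType) (F : set R) (t : R) : finite_set F ->
  \forall s \near t^'-, count_le F s = count_lt F t.
Proof.
move=> finF.
have : \forall s \near t^'-, forall r, F r -> (r <= s) = (r < t).
  apply: near_finite => // r _; case: (ltP r t) => rt.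
    exact: nbhs_left_ge.
  apply: filterS (nbhs_left_lt t) => s st.
  by apply/negbTE; rewrite -ltNge (lt_le_trans st rt).
apply: filterS => s h; rewrite /count_le; congr (#|` fset_set _|).
by apply/seteqP; split=> r [Fr] /=; rewrite h.
Qed.

Lemma count_leS (R : realType) (F : set R) (t : R) : finite_set F ->
  count_le F t = (count_lt F t + `[< F t >])%N.
Proof.
move=> finF; rewrite /count_le /count_lt.
have fin (B : set R) : finite_set (F `&` B) by exact: finite_setIl.
case: asboolP => Ft.
  rewrite (_ : F `&` [set r | r <= t] = t |` (F `&` [set r | r < t])).
    rewrite fset_setU1// cardfsU1 addnC in_fset_set//; congr (_ + nat_of_bool _)%N.
    by apply/negP; rewrite inE /= ltxx => -[].
  apply/seteqP; split=> r /=.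
    by rewrite le_eqVlt => -[Fr /orP[/eqP|]]; [left|right].
  by move=> [->//|[Fr /ltW]].
rewrite addn0; congr (#|` fset_set _|); apply/seteqP; split=> r [Fr] /=.
  by rewrite le_eqVlt => /orP[/eqP rt|//]; rewrite rt in Fr.
by move=> /ltW.
Qed.

Definition jump_path_fun (R : realType) (U : jump_pair R) (t : R) : int :=
  (count_le (ups U) t)%:Z - (count_le (downs U) t)%:Z.

Lemma jump_path_fun_out (R : realType) (U : jump_pair R) (t : R) :
  t <= 0 \/ 1 <= t -> jump_path_fun U t = 0.
Proof.
have [/= [fu fd] [su sd] _ ud] := jump_pairP U.
rewrite /jump_path_fun /count_le => -[t0|t1].
  have e (F : set R) : F `<=` [set t | 0 < t < 1] ->
      F `&` [set r | r <= t] = set0.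
    move=> sF; apply/seteqP; split=> // r [/sF /= /andP[r0 _]] rt.
    by move: (lt_le_trans r0 (le_trans rt t0)); rewrite ltxx.
  by rewrite !e// subrr.
have e (F : set R) : F `<=` [set t | 0 < t < 1] ->
    F `&` [set r | r <= t] = F.
  move=> sF; apply/seteqP; split=> [r []//|r Fr]; split=> //=.
  by move: (sF _ Fr) => /andP[_ /ltW r1]; exact: le_trans r1 t1.
rewrite !e//.
have /fcard_eq -> // := ud.
by rewrite subrr.
Qed.

Lemma jump_path_left (R : realType) (U : jump_pair R) (t : R) :
  \forall s \near t^'-, jump_path_fun U s =
    (count_lt (ups U) t)%:Z - (count_lt (downs U) t)%:Z.
Proof.
have [/= [fu fd] _ _ _] := jump_pairP U.
apply: filterS2 (count_le_left t fu) (count_le_left t fd) => s.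
by rewrite /jump_path_fun => -> ->.
Qed.

Lemma jump_path_cadlag (R : realType) (U : jump_pair R) :
  is_cadlag (jump_path_fun U).
Proof.
have [/= [fu fd] _ _ _] := jump_pairP U; split=> t.
- move=> _; apply: filterS2 (count_le_right t fu) (count_le_right t fd) => s.
  by rewrite /jump_path_fun => -> ->.
- by move=> _; eexists; exact: jump_path_left.
- by move=> t0; rewrite !jump_path_fun_out//; left=> //; exact: ltW.
- by move=> t1; rewrite !jump_path_fun_out//; right=> //; exact: ltW.
Qed.

(* The path with jump sets U, i.e. the inverse of the map sending a path to its
   sets of upward and downward jump times. *)
Definition jump_path (R : realType) (U : jump_pair R) : skorokhod R :=
  Skorokhod (jump_path_cadlag U).

Lemma jump_path0 (R : realType) (U : jump_pair R) : jump_path U 0 = 0.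
Proof. by apply: jump_path_fun_out; left. Qed.

Lemma jump_path1 (R : realType) (U : jump_pair R) : jump_path U 1 = 0.
Proof. by apply: jump_path_fun_out; right. Qed.

Lemma jump_path_jump (R : realType) (U : jump_pair R) (t : R) :
  jump_path U t = left_value (jump_path U) t +
    (nat_of_bool `[< ups U t >])%:Z - (nat_of_bool `[< downs U t >])%:Z.
Proof.
have [/= [fu fd] _ _ _] := jump_pairP U.
rewrite (@left_valueE _ (jump_path U) t _ (jump_path_left U t)) /= /jump_path_fun !count_leS//.
by rewrite !PoszD opprD addrACA addrA.
Qed.

Lemma jump_times_up (R : realType) (U : jump_pair R) :
  jump_times 1 (jump_path U) = ups U.
Proof.
have [/= _ [su sd] ud0 _] := jump_pairP U.
apply/seteqP; split=> t /=.
  move=> [_]; rewrite jump_path_jump -addrA => /addrI.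
  by case: asboolP => //; case: asboolP.
move=> Ut; split; first exact: su.
rewrite jump_path_jump; case: asboolP => // _; case: asboolP => [Dt|_].
  by have : (ups U `&` downs U) t by []; rewrite ud0.
by rewrite subr0.
Qed.

Lemma jump_times_down (R : realType) (U : jump_pair R) :
  jump_times (-1) (jump_path U) = downs U.
Proof.
have [/= _ [su sd] ud0 _] := jump_pairP U.
apply/seteqP; split=> t /=.
  move=> [_]; rewrite jump_path_jump -addrA => /addrI.
  by case: asboolP => //; case: asboolP.
move=> Dt; split; first exact: sd.
rewrite jump_path_jump; case: asboolP => [Ut|_].
  by have : (ups U `&` downs U) t by []; rewrite ud0.
by case: asboolP => // _; rewrite addr0.
Qed.

(* The sigma-algebra transported from the path space. *)
Definition jump_pair_display : measure_display.
Proof. by constructor. Qed.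

HB.instance Definition _ (R : realType) :=
  @isMeasurable.Build jump_pair_display (jump_pair R)
    (g_sigma_algebra_preimage (@jump_path R))
    (@measurable0 _ (g_sigma_algebra_preimageType (@jump_path R)))
    (@measurableC _ (g_sigma_algebra_preimageType (@jump_path R)))
    (@bigcupT_measurable _ (g_sigma_algebra_preimageType (@jump_path R))).

Definition pinned (R : realType) : set (skorokhod R) :=
  [set w | w 0 = 0 /\ w 1 = 0].
Arguments pinned : clear implicits.

(* The bridge P( . | X_0 = 0, X_1 = 0), pushed forward to pairs of jump sets:
   the set A of pairs corresponds to the set of paths [jump_path @` A]. *)
Definition bridge_law (R : realType) (P : probability (skorokhod R) R)
    (A : set (jump_pair R)) : \bar R :=
  (P (pinned R `&` @jump_path R @` A) * ((fine (P (pinned R)))^-1)%:E)%E.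

(** * The graph structure *)

(* [insubd U p] is the pair p if it is an admissible pair of jump sets, and U
   otherwise. *)
Definition Psi (R : realType) (r s : R) (U : jump_pair R) : jump_pair R :=
  if `[< ~ ups U r /\ ~ downs U s >] then
    insubd U (ups U `|` [set r], downs U `|` [set s])
  else if `[< ups U r /\ downs U s >] then
    insubd U (ups U `\ r, downs U `\ s)
  else U.

Definition off_diagonal (R : realType) : set (R * R) :=
  [set rs | [/\ 0 < rs.1 < 1, 0 < rs.2 < 1 & rs.1 <> rs.2]].
Arguments off_diagonal : clear implicits.

Definition neighbours (R : realType) (U V : jump_pair R) : Prop :=
  U <> V /\ exists2 rs, off_diagonal R rs & U = Psi rs.1 rs.2 V.

Definition graph_dist (R : realType) (U V : jump_pair R) : \bar R :=
  ereal_inf [set (n%:R)%:E | n in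
    [set n : nat | exists p : nat -> jump_pair R,
       [/\ p 0%N = U, p n = V &
           forall i, (i < n)%N -> neighbours (p i) (p i.+1)]]].

Definition Lip1 (R : realType) : set (jump_pair R -> R) :=
  [set f : jump_pair R -> R | measurable_fun setT f /\
     forall U V, (`|f U - f V|%:E <= graph_dist U V)%E].

Definition dW1 (R : realType) (mu nu : set (jump_pair R) -> \bar R) : \bar R :=
  ereal_sup [set (`| \int[mu]_U (f U)%:E - \int[nu]_U (f U)%:E |)%E | f in
    [set f : jump_pair R -> R | [/\ Lip1 f, mu.-integrable setT (EFin \o f)
               & nu.-integrable setT (EFin \o f)]]].

(** * The density of the bridge *)

Definition M (R : realType) (a b : int -> R) (w : skorokhod R) : R :=
  expR (- \int[lebesgue_measure]_(t in `[0, 1])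
            (a (left_value w t) + b (left_value w t))) *
  (\big[*%R/1]_(t \in jump_times 1 w) a (left_value w t)) *
  (\big[*%R/1]_(s \in jump_times (-1) w) b (left_value w s)).

Definition grad_log_M (R : realType) (a b : int -> R) (u v : R)
    (U : jump_pair R) : R :=
  (M a b (jump_path (Psi u v U)) - M a b (jump_path U)) / M a b (jump_path U).

(* Main.v *)
Require Import Defs.
From HB Require Import structures.
From mathcomp Require Import all_boot all_order all_algebra finmap.
From mathcomp Require Import all_classical all_reals all_analysis.
From mathcomp Require Import measurable_realfun ring lra zify.

Set Implicit Arguments.
Unset Strict Implicit.
Unset Printing Implicit Defensive.

Import Order.TTheory GRing.Theory Num.Theory.
Import numFieldNormedType.Exports.

Local Open Scope classical_set_scope.
Local Open Scope ring_scope.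

(** Let pi be the bridge law of the walk with unit rates, mu that of the walk
with rates a and b, n(U) the number of pairs of jumps of U, and write o for the
pair of empty sets.

Both laws are compared on dyadic boxes: a box of level m consists of the paths
with a prescribed dyadic skeleton and at most one jump in each cell of length
h = 2^-m. The martingale problem, tested with indicators of single states, gives
the probability of crossing one cell up to an error of order h^2 ([increment_bound],
[transition_bound]); multiplying over the cells, the box around U has probability
P(X_0 = 0) M(U) h^(2 n(U)) exp(O(h)), where the constant in O(h) depends on n(U)
only ([key_estimate]). On the other hand a measure on jump pairs is determined by
its values on boxes up to such factors exp(O(h)) ([box_unique]), because the sets
that depend on the skeleton at all fine levels generate the sigma-algebra and
split into boxes. This has two consequences.

- Girsanov formula: mu = rho pi with rho proportional to M ([bridge_mass_density]).

- Mecke formula ([mecke]): the integral of F(U) n(U)^2 under pi is the integral of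
  F(V + (r, s)) under pi(dV) dr ds. Removing a pair of jumps from a box divides its
  probability by h^2, which is the measure of the set of pairs (r, s) that restore
  it, and there are n^2 pairs to remove.

The comparison goes as follows. Let u = |rho - rho(o)|. A
1-Lipschitz f satisfies |f(U) - f(o)| <= n(U), because U is reduced to o by n(U)
removals; since E_pi[n] <= E_pi[n^2] <= 1, it follows that the difference of the
integrals of f under mu and pi is at most E_pi[(n + 1) u] ([lipschitz_gap]). Mecke's
formula turns 2 E_pi[(n + 1) u] into the mean of w(n(V)) u(V + (r, s)) with the weight
w(k) = 2 (k + 2) / (k + 1)^2. Here u(V + (r, s)) is at most u(V) plus the variation
|rho(V + (r, s)) - rho(V)|, while w <= 4, and w(k) <= k + 1 unless k = 0, in which
case u(V) = 0. Hence
  2 E_pi[(n + 1) u] <= E_pi[(n + 1) u] + 4 E_pi[mean variation],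
and E_pi[(n + 1) u] <= 4 E_pi[mean variation] ([weighted_gap_le]). Dividing the
variation by rho(V) changes pi into mu and the variation into a discrete gradient of
log M, which is at most its supremum ([insertion_variation_le]). This gives the claim,
with 4 in place of 9. *)

(** * Short-time bounds from the martingale problem *)

(** The integral is a difference of two suprema over simple functions, each of
which is monotone in the integrand, whatever the integrand. This covers
integrands such as the compensator as a function of the path, or a supremum over
an uncountable family. *)
Lemma le_integral_any d (T : measurableType d) (R : realType)
    (mu : {measure set T -> \bar R}) (D : set T) (f g : T -> \bar R) :
  (forall x, D x -> (f x <= g x)%E) ->
  (\int[mu]_(x in D) f x <= \int[mu]_(x in D) g x)%E.
Proof.
move=> fg; have fgD x : ((f \_ D) x <= (g \_ D) x)%E.
  by rewrite !patchE; case: ifPn => //; rewrite inE => /fg.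
rewrite /integral; apply: leeB; apply: le_ereal_sup => _ [h /= hf <-];
  exists h => //= x; apply: (le_trans (hf x)).
- by rewrite !funeposE le_max2.
- by rewrite !funenegE le_max2 ?leeN2.
Qed.

(** A common bound for the total rate out of j and for the generator applied to
the indicator of j. *)
Definition gen_bound (R : realType) (a b : int -> R) (j : int) : R :=
  a (j - 1) + a j + b j + b (j + 1).

Definition indic1 (R : realType) (j i : int) : R := (i == j)%:R.

Lemma gen_indic (R : realType) (a b : int -> R) (j x : int) :
  walk_generator a b (indic1 R j) x =
   (x == j - 1)%:R * a x + (x == j + 1)%:R * b x - (x == j)%:R * (a x + b x).
Proof.
rewrite /walk_generator /indic1.
rewrite -[x + 1 == j](inj_eq (addIr (-1 : int))) addrK.
rewrite -[x - 1 == j](inj_eq (addIr (1 : int))) subrK.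
ring.
Qed.

Lemma gen_indic_bound (R : realType) (a b : int -> R) (j x : int) :
  (forall k, 0 < a k) -> (forall k, 0 < b k) ->
  `|walk_generator a b (indic1 R j) x| <= gen_bound a b j.
Proof.
move=> a0 b0; rewrite gen_indic /gen_bound.
have := a0 (j - 1); have := a0 j; have := b0 j; have := b0 (j + 1).
case: (x =P j - 1) => [->|_].
  rewrite (_ : (j - 1 == j + 1) = false); last first.
    by apply/negbTE; rewrite -subr_eq0 opprD addrACA subrr add0r.
  rewrite (_ : (j - 1 == j) = false); last first.
    by apply/negbTE; rewrite -subr_eq0 addrAC subrr add0r.
  rewrite !mul0r mul1r addr0 subr0 => *; rewrite gtr0_norm//; lra.
case: (x =P j + 1) => [->|_].
  rewrite (_ : (j + 1 == j) = false); last first.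
    by apply/negbTE; rewrite -subr_eq0 addrAC subrr add0r.
  rewrite !mul0r mul1r add0r subr0 => *; rewrite gtr0_norm//; lra.
case: eqP => [->|_]; rewrite !mul0r !add0r ?mul1r => *.
  by rewrite normrN gtr0_norm; lra.
by rewrite oppr0 normr0; lra.
Qed.

Section shorttime.
Variable R : realType.
Variables a b : int -> R.
Hypothesis a0 : forall j, 0 < a j.
Hypothesis b0 : forall j, 0 < b j.
Variable P : probability (skorokhod R) R.
Hypothesis PG : has_generator a b P.

Local Notation T := (skorokhod R).
Local Notation K := (gen_bound a b).
Local Notation p A := (fine (P A)).

Lemma K_gt0 j : 0 < K j.
Proof. by rewrite /gen_bound; do !apply: addr_gt0. Qed.

Lemma pE (A : set T) : measurable A -> P A = (p A)%:E.
Proof. by move=> mA; rewrite fineK// fin_num_measure. Qed.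

Lemma history_measurable (t : R) : t <= 1 -> history t `<=` @measurable _ T.
Proof.
move=> t1; apply: sub_sigma_algebra2 => A [r [k [/andP[r0 rt] ->]]].
by exists r, k; rewrite r0 (le_trans rt).
Qed.

Lemma history_le (s t : R) : s <= t -> @history R s `<=` history t.
Proof.
move=> st; apply: sub_sigma_algebra2 => A [r [k [/andP[r0 rt] ->]]].
by exists r, k; rewrite r0 (le_trans rt).
Qed.

Lemma history_coord (r t : R) (k : int) : 0 <= r <= t ->
  history t [set w : T | w r = k].
Proof. by move=> rt; apply: sub_sigma_algebra; exists r, k. Qed.

Lemma measurable_coord (r : R) (k : int) : 0 <= r <= 1 ->
  measurable [set w : T | w r = k].
Proof. exact: history_coord. Qed.

Lemma historyI (t : R) (A B : set T) : history t A -> history t B ->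
  history t (A `&` B).
Proof.
by move=> hA hB; exact: (@measurableI _ (g_sigma_algebraType (cylinders t))).
Qed.

(** The martingale identity for the indicator of j expresses the probability of
A and w t = j through the mean over A of the compensator. Here A belongs to the
past of s and fixes w s = k; x is the expected value of the compensator, y an
error valid everywhere and z an additional error on an exceptional event N. *)
Lemma increment_bound (s t : R) (A N : set T) (j k : int) (x y z : R) :
  0 <= s -> s <= t -> t <= 1 -> history s A -> A `<=` [set w | w s = k] ->
  measurable N ->
  (forall w : T, A w -> `| \int[lebesgue_measure]_(r in `[s, t])
       walk_generator a b (indic1 R j) (w r) - x | <= y + z * \1_N w) ->
  `|p (A `&` [set w | w t = j]) - ((k == j)%:R + x) * p A|
     <= y * p A + z * p (A `&` N).
Proof.
move=> s0 st t1 hA Ak mN I.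
have mA : measurable A by apply: history_measurable hA; exact: le_trans t1.
have mj : measurable [set w : T | w t = j].
  by apply: measurable_coord; rewrite (le_trans s0 st).
have fin : finite_set [set i | indic1 R j i != 0].
  apply: (sub_finite_set _ (finite_set1 j)) => i /=; rewrite /indic1.
  by case: (i =P j) => // _; rewrite eqxx.
pose Y (w : T) := indic1 R j (w t) - indic1 R j (w s) -
   \int[lebesgue_measure]_(r in `[s, t]) walk_generator a b (indic1 R j) (w r).
have YE : (\int[P]_(w in A) (Y w)%:E)%E = 0 := PG fin s0 st t1 hA.
have key (e : R) :
   (\int[P]_(w in A) ((\1_[set w : T | w t = j] w - (k == j)%:R - x
       + e * (y + z * \1_N w))%:E) =
   (p (A `&` [set w | w t = j]) - ((k == j)%:R + x) * p A
     + e * (y * p A + z * p (A `&` N)))%:E)%E.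
  transitivity (\int[P]_(w in A) ((\1_[set w : T | w t = j] w)%:E
      + ((e * y - (k == j)%:R - x)%:E + (e * z)%:E * (\1_N w)%:E)))%E.
    apply: eq_integral => w _; rewrite -EFinM -!EFinD; congr EFin; ring.
  have int1 (B : set T) (c : R) : measurable B ->
      P.-integrable A (fun w => c%:E * (\1_B w)%:E)%E.
    move=> mB; apply: integrableZl => //.
    by apply: (integrableS measurableT) => //; exact: integrable_indic.
  have intc (c : R) : P.-integrable A (fun w => c%:E).
    exact: finite_measure_integrable_cst.
  have int2 (B : set T) : measurable B -> P.-integrable A (fun w => (\1_B w)%:E).
    by move=> mB; apply: (integrableS measurableT) => //; exact: integrable_indic.
  rewrite integralD//=; last 2 first.
  - exact: int2.
  - by apply: integrableD => //; exact: int1.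
  rewrite integralD//; last exact: int1.
  rewrite integralZl//; last exact: int2.
  have iE B : measurable B -> (\int[P]_(w in A) (\1_B w)%:E = (p (A `&` B))%:E)%E.
    move=> mB; rewrite (integral_indic P mA mB) setIC.
    exact: (pE (measurableI _ _ mA mB)).
  have cE c : (\int[P]_(w in A) c%:E = (c * p A)%:E)%E.
    by rewrite (integral_cst P mA c%:E) EFinM; congr (_ * _)%E; exact: pE.
  rewrite (iE _ mj) (iE _ mN) (cE (e * y - (k == j)%:R - x)).
  by rewrite -!EFinM -!EFinD; congr EFin; ring.
have bnd w : A w -> `|Y w - (\1_[set w : T | w t = j] w - (k == j)%:R - x)|
    <= y + z * \1_N w.
  move=> Aw; have := I w Aw; rewrite /Y -normrN; congr (`|_| <= _).
  rewrite /indic1 (Ak w Aw) indicE.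
  have -> : (w \in [set w : T | w t = j]) = (w t == j).
    by apply/idP/eqP => [|?]; rewrite inE.
  by ring.
have l1 : (\int[P]_(w in A) ((\1_[set w : T | w t = j] w - (k == j)%:R - x
       + (-1) * (y + z * \1_N w))%:E) <= 0)%E.
  rewrite -YE; apply: le_integral_any => w Aw; rewrite lee_fin.
  by have := bnd w Aw; rewrite ler_norml => /andP[]; lra.
have l2 : (0 <= \int[P]_(w in A) ((\1_[set w : T | w t = j] w - (k == j)%:R - x
       + 1 * (y + z * \1_N w))%:E))%E.
  rewrite -YE; apply: le_integral_any => w Aw; rewrite lee_fin.
  by have := bnd w Aw; rewrite ler_norml => /andP[]; lra.
move: l1 l2; rewrite !key.
rewrite !lee_fin ler_norml => *; apply/andP; split; lra.
Qed.

Lemma compensator_bound (s t : R) (j : int) (w : T) : s <= t ->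
  `| \int[lebesgue_measure]_(r in `[s, t]) walk_generator a b (indic1 R j) (w r) |
   <= K j * (t - s).
Proof.
move=> st; set g := fun r => walk_generator a b (indic1 R j) (w r).
have gK r : `|g r| <= K j by exact: gen_indic_bound.
have cst c : (\int[lebesgue_measure]_(r in `[s, t]) (c%:E) = (c * (t - s))%:E :> \bar R)%E.
  rewrite (integral_cst lebesgue_measure)//= lebesgue_measure_itv/= lte_fin.
  have [_|ts] := ltP s t; first by rewrite EFinM.
  by rewrite mule0 (le_anti (introT andP (conj st ts))) subrr mulr0.
have h1 : (\int[lebesgue_measure]_(r in `[s, t]) (g r)%:E <= (K j * (t - s))%:E)%E.
  rewrite -cst; apply: le_integral_any => r _; rewrite lee_fin.
  by have := gK r; rewrite ler_norml => /andP[].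
have h2 : ((- K j * (t - s))%:E <= \int[lebesgue_measure]_(r in `[s, t]) (g r)%:E)%E.
  rewrite -cst; apply: le_integral_any => r _; rewrite lee_fin.
  by have := gK r; rewrite ler_norml => /andP[].
rewrite /Rintegral; move: h1 h2; rewrite -/g; case: (integral _ _ _) => // v.
by rewrite !lee_fin /= => h1 h2; rewrite ler_norml h1 -mulNr h2.
Qed.

Lemma compensator_cst (s t : R) (j k : int) (w : T) : s <= t ->
  (forall r, s <= r <= t -> w r = k) ->
  \int[lebesgue_measure]_(r in `[s, t]) walk_generator a b (indic1 R j) (w r)
  = walk_generator a b (indic1 R j) k * (t - s).
Proof.
move=> st wk; rewrite /Rintegral.
under eq_integral.
  by move=> r; rewrite inE /= in_itv /= => h; rewrite wk//; over.
rewrite (integral_cst lebesgue_measure)//= lebesgue_measure_itv/= lte_fin.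
have [_|ts] := ltP s t; first by rewrite -EFinB.
by rewrite mule0 (le_anti (introT andP (conj st ts))) subrr mulr0.
Qed.

(** The compensator of the indicator of k is at most K k (t - s) in absolute
value, and so is the probability of having moved. *)
Lemma stay_point (s t : R) (A : set T) (k : int) :
  0 <= s -> s <= t -> t <= 1 -> history s A -> A `<=` [set w | w s = k] ->
  p A * (1 - K k * (t - s)) <= p (A `&` [set w | w t = k]).
Proof.
move=> s0 st t1 hA Ak.
have := @increment_bound s t A set0 k k 0 (K k * (t - s)) 0 s0 st t1 hA Ak.
move=> /(_ measurable0) h.
have {}h := h (fun w _ => _); move: h.
move=> h; have := h _; rewrite eqxx setI0 measure0 => {}h.
have : `|p (A `&` [set w | w t = k]) - (1 + 0) * p A| <= K k * (t - s) * p A + 0 * 0.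
  by apply: h => w; rewrite subr0 mul0r addr0; exact: compensator_bound.
by rewrite ler_norml => /andP[]; lra.
Qed.

End shorttime.

(** * Dyadic skeletons of cadlag paths *)

Section grid.
Variable R : realType.

Definition pt (m i : nat) : R := i%:R / 2 ^+ m.

Lemma pt0 m : pt m 0 = 0. Proof. by rewrite /pt mul0r. Qed.

Lemma pt1 m : pt m (2 ^ m) = 1.
Proof. by rewrite /pt natrX divff// expf_neq0. Qed.

Lemma pow2_gt0 m : 0 < 2 ^+ m :> R. Proof. by rewrite exprn_gt0. Qed.

Lemma ler_pt m i j : (pt m i <= pt m j) = (i <= j)%N.
Proof. by rewrite /pt ler_pM2r ?invr_gt0 ?pow2_gt0// ler_nat. Qed.

Lemma ltr_pt m i j : (pt m i < pt m j) = (i < j)%N.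
Proof. by rewrite /pt ltr_pM2r ?invr_gt0 ?pow2_gt0// ltr_nat. Qed.

Lemma pt_ge0 m i : 0 <= pt m i.
Proof. by rewrite /pt divr_ge0// exprn_ge0. Qed.

Lemma pt_le1 m i : (i <= 2 ^ m)%N -> pt m i <= 1.
Proof. by rewrite -(pt1 m) ler_pt. Qed.

Lemma ptS m i : pt m i.+1 = pt m i + (2 ^+ m)^-1.
Proof. by rewrite /pt -natr1 mulrDl mul1r. Qed.

Lemma ptD m l i : pt (m + l) (i * 2 ^ l) = pt m i.
Proof. by rewrite /pt natrM natrX exprD -mulf_div divff ?mulr1// expf_neq0. Qed.

Lemma grid_cellP m (x : R) : 0 < x <= 1 ->
  exists2 i, (i < 2 ^ m)%N & pt m i < x <= pt m i.+1.
Proof.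
move=> /andP[x0 x1].
have ex : exists i, x <= pt m i by exists (2 ^ m)%N; rewrite pt1.
have [[|i] xi imin] := find_ex_minn ex.
  by move: (lt_le_trans x0 xi); rewrite pt0 ltxx.
exists i; last by rewrite xi ltNge; apply/andP; split=> //; apply/negP => /imin; rewrite ltnn.
by apply: imin; rewrite pt1.
Qed.

Lemma grid_cell_left m (x : R) : 0 <= x < 1 ->
  exists2 i, (i < 2 ^ m)%N & pt m i <= x < pt m i.+1.
Proof.
move=> /andP[x0 x1].
have ex : exists i, x < pt m i by exists (2 ^ m)%N; rewrite pt1.
have [[|i] xi imin] := find_ex_minn ex.
  by rewrite pt0 ltNge x0 in xi.
exists i; last by rewrite xi andbT leNgt; apply/negP => /imin; rewrite ltnn.
by apply: imin; rewrite pt1.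
Qed.

Lemma subgrid_cellP m l i (x : R) : pt m i < x <= pt m i.+1 ->
  exists2 r, (r < 2 ^ l)%N &
     pt (m + l) (i * 2 ^ l + r) < x <= pt (m + l) (i * 2 ^ l + r).+1.
Proof.
move=> /andP[x0 x1].
have e : (i * 2 ^ l + 2 ^ l = i.+1 * 2 ^ l)%N by rewrite mulSn addnC.
have ex : exists r, x <= pt (m + l) (i * 2 ^ l + r).
  by exists (2 ^ l)%N; rewrite e// ptD.
have [[|r] xi imin] := find_ex_minn ex.
  by move: (lt_le_trans x0 xi); rewrite addn0 ptD ltxx.
exists r; last first.
  by rewrite -addnS xi ltNge; apply/andP; split=> //; apply/negP => /imin; rewrite ltnn.
by apply: imin; rewrite e// ptD.
Qed.

(** When w s = w t the time u is arbitrary and the path is constant, so that an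
interval without jump is included. *)
Definition single_jump (w : R -> int) (s t : R) : Prop :=
  exists2 u, s < u <= t & (forall r, s <= r < u -> w r = w s) /\
                          (forall r, u <= r <= t -> w r = w t).

Lemma nbhs_rightP (x : R) (Q : R -> Prop) : (\forall s \near x^'+, Q s) ->
  exists2 d : R, 0 < d & forall y : R, x < y < x + d -> Q y.
Proof.
rewrite near_withinE near_nbhs => /nbhs_ballP[d /= d0 h]; exists d => // y /andP[xy yd].
by apply: h => //; rewrite /ball /= ltr_norml; apply/andP; split; lra.
Qed.

Lemma nbhs_leftP (x : R) (Q : R -> Prop) : (\forall s \near x^'-, Q s) ->
  exists2 d : R, 0 < d & forall y : R, x - d < y < x -> Q y.
Proof.
rewrite near_withinE near_nbhs => /nbhs_ballP[d /= d0 h]; exists d => // y /andP[xy yd].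
by apply: h => //; rewrite /ball /= ltr_norml; apply/andP; split; lra.
Qed.

Lemma cadlag_local (w : R -> int) (x : R) : is_cadlag w -> 0 <= x <= 1 ->
  exists (d : R) (k : int), [/\ 0 < d, forall y : R, x - d < y < x -> w y = k
                & forall y : R, x <= y < x + d -> w y = w x].
Proof.
move=> [wr wl w0 w1] /andP[x0 x1].
have [d1 d10 h1] : exists2 d : R, 0 < d & forall y : R, x <= y < x + d -> w y = w x.
  have [x1'|] := ltP x 1.
    have /wr/nbhs_rightP[d d0 h] : 0 <= x < 1 by rewrite x0.
    exists d => // y /andP[]; rewrite le_eqVlt => /orP[/eqP->//|xy] yd.
    by apply: h; rewrite xy.
  move=> x1'; have -> : x = 1 by apply/le_anti; rewrite x1.
  exists 1 => // y /andP[]; rewrite le_eqVlt => /orP[/eqP->//|xy] yd.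
  by rewrite (w1 y).
have [d2 [k [d20 h2]]] : exists (d : R) (k : int), 0 < d /\ forall y : R, x - d < y < x -> w y = k.
  move: x0; rewrite le_eqVlt => /orP[/eqP<-|x0'].
    by exists 1, (w 0); split=> // y /andP[_ /w0].
  have /wl[k /nbhs_leftP[d d0 h]] : 0 < x <= 1 by rewrite x0'.
  by exists d, k.
exists (Num.min d1 d2), k; split.
- by rewrite lt_min d10.
- move=> y /andP[yx ?]; apply: h2; apply/andP; split=> //.
  by apply: le_lt_trans yx; rewrite lerD2l lerN2 ge_min lexx orbT.
- move=> y /andP[xy yx]; apply: h1; rewrite xy /=.
  by apply: lt_le_trans yx _; rewrite lerD2l ge_min lexx.
Qed.

Lemma near_pow2 (e : R) : 0 < e -> \forall m \near \oo, (2 ^+ m)^-1 < e.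
Proof.
move=> e0; have /cvgr0Pnorm_lt/(_ e e0) : (fun n => (2^-1 : R) ^+ n) @ \oo --> (0 : R).
  by apply: cvg_expr; rewrite ger0_norm; lra.
by apply: filterS => m; rewrite ger0_norm ?exprVn// invr_ge0 exprn_ge0.
Qed.

(** Around each point a cadlag path takes one value on the left and one on the
right, so that short intervals nearby contain at most one jump; compactness of
the unit interval makes the length uniform. *)
Lemma cadlag_single_jumps (w : R -> int) : is_cadlag w ->
  \forall m \near \oo, forall i, (i < 2 ^ m)%N -> single_jump w (pt m i) (pt m i.+1).
Proof.
move=> cw.
have /compact_near_coveringP/(_ nat \oo (fun m x => forall i, (i < 2 ^ m)%N ->
  pt m i <= x <= pt m i.+1 -> single_jump w (pt m i) (pt m i.+1)) _) :=
  @segment_compact R 0 1.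
move=> H; have {H} : \forall m \near \oo, `[0, 1] `<=` (fun x => forall i, (i < 2 ^ m)%N ->
  pt m i <= x <= pt m i.+1 -> single_jump w (pt m i) (pt m i.+1)).
  apply: H => x /=; rewrite in_itv /= => x01.
  have [d [k [d0 hl hr]]] := cadlag_local cw x01.
  exists (ball x (d / 2), [set m | (2 ^+ m)^-1 < d / 2]).
    split; first by apply: nbhsx_ballx; lra.
    by apply: near_pow2; lra.
  move=> [y m] [/= yx md] i im; rewrite ptS.
  have m0 : 0 < (2 ^+ m)^-1 :> R by rewrite invr_gt0 pow2_gt0.
  move: yx; rewrite /ball /= ltr_norml => /andP[yx1 yx2] /andP[y1 y2].
  set u := pt m i in y1 y2 *; set h := (2 ^+ m)^-1 in md y2 m0 *.
  have [xu|ux] := leP x u.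
    exists (u + h); first by apply/andP; split; lra.
    split=> r /andP[r1 r2].
      by rewrite !hr//; apply/andP; split; lra.
    by congr w; apply/le_anti; rewrite r1 r2.
  have [xv|vx] := leP x (u + h).
    exists x; first by rewrite ux.
    split=> r /andP[r1 r2].
      by rewrite !hl//; apply/andP; split; lra.
    by rewrite !hr//; apply/andP; split; lra.
  exists (u + h); first by apply/andP; split; lra.
  split=> r /andP[r1 r2]; first by rewrite !hl//; apply/andP; split; lra.
  by rewrite !hl//; apply/andP; split; lra.
apply: filterS => m H i im; apply: (H (pt m i)) => //=.
  by rewrite in_itv /= pt_ge0 pt_le1// ltnW.
by rewrite lexx ler_pt leqnSn.
Qed.

(** The trace of [single_jump] on the subgrid of level m + l. It only involves
finitely many coordinates, which is what one-step bounds can handle. *)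
Definition skeleton_jump (w : R -> int) (m i l : nat) (k j : int) : Prop :=
  exists2 q, (q < 2 ^ l)%N & forall r, (r <= 2 ^ l)%N ->
    w (pt (m + l) (i * 2 ^ l + r)) = if (r <= q)%N then k else j.

Lemma single_jump_skeleton (w : R -> int) m i l :
  single_jump w (pt m i) (pt m i.+1) ->
  skeleton_jump w m i l (w (pt m i)) (w (pt m i.+1)).
Proof.
move=> [u uI [h1 h2]]; have [q q2 /andP[qu uq]] := subgrid_cellP l uI.
exists q => // r r2.
have e : (i * 2 ^ l + 2 ^ l = i.+1 * 2 ^ l)%N by rewrite mulSn addnC.
have b1 : pt m i <= pt (m + l) (i * 2 ^ l + r) by rewrite -(ptD m l) ler_pt leq_addr.
have b2 : pt (m + l) (i * 2 ^ l + r) <= pt m i.+1.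
  by rewrite -(ptD m l) ler_pt -e leq_add2l.
case: leqP => rq.
  by apply: h1; rewrite b1 (le_lt_trans _ qu)// ler_pt leq_add2l.
by apply: h2; rewrite b2 andbT (le_trans uq)// ler_pt -addnS leq_add2l.
Qed.

(** At a level where every cell has at most one jump, the cells other than the
q-th have equal end values and are thus constant. *)
Lemma skeleton_single_jump (w : R -> int) m i k j : is_cadlag w -> (i < 2 ^ m)%N ->
  (forall l, skeleton_jump w m i l k j) ->
  single_jump w (pt m i) (pt m i.+1).
Proof.
move=> cw im S; have [M _ HM] := cadlag_single_jumps cw.
have {HM} := HM (m + M)%N (leq_addl _ _) => H.
have [q q2 Hq] := S M.
have e : (i * 2 ^ M + 2 ^ M = i.+1 * 2 ^ M)%N by rewrite mulSn addnC.
have cell r : (r < 2 ^ M)%N -> (i * 2 ^ M + r < 2 ^ (m + M))%N.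
  by move=> r2; rewrite expnD (@leq_trans (i.+1 * 2 ^ M))// ?leq_mul2r ?im ?orbT// -e ltn_add2l.
have [u /andP[u1 u2] [h1 h2]] := H _ (cell q q2).
have wk : w (pt m i) = k by rewrite -(ptD m M) -[X in pt _ X]addn0 Hq.
have wj : w (pt m i.+1) = j by rewrite -(ptD m M) -e Hq// leqNgt q2.
have wr r (r2 : (r < 2 ^ M)%N) := Hq r (ltnW r2).
have wr1 r (r2 : (r < 2 ^ M)%N) := Hq r.+1 r2.
have b1 r : pt m i <= pt (m + M) (i * 2 ^ M + r) by rewrite -(ptD m M) ler_pt leq_addr.
have b2 r : (r <= 2 ^ M)%N -> pt (m + M) (i * 2 ^ M + r) <= pt m i.+1.
  by move=> r2; rewrite -(ptD m M) ler_pt -e leq_add2l.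
exists u.
  by rewrite (le_lt_trans (b1 q) u1) (le_trans u2)// -addnS b2.
split=> x /andP[x1 x2].
- have [|] := eqVneq x (pt m i) => [-> //|xne].
  have /(subgrid_cellP M)[r r2 /andP[xr1 xr2]] : pt m i < x <= pt m i.+1.
    rewrite lt_neqAle eq_sym xne x1 (le_trans (ltW x2))// (le_trans u2)// -addnS.
    exact: b2.
  have rq : (r <= q)%N.
    rewrite leqNgt; apply/negP => qr.
    have : x < x by rewrite (lt_le_trans x2)// (le_trans u2)// ltW// (le_lt_trans _ xr1)// ler_pt -addnS leq_add2l.
    by rewrite ltxx.
  rewrite wk; move: rq; rewrite leq_eqVlt => /orP[/eqP rq|rq].
    by rewrite rq in xr1 xr2; rewrite h1 ?(ltW xr1)//= wr// leqnn.
  have [v /andP[v1 v2] [g1 g2]] := H _ (cell r r2).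
  have [xv|vx] := ltP x v; first by rewrite g1 ?(ltW xr1)//= wr// (ltnW rq).
  by rewrite g2 ?vx//= -addnS wr1// rq.
- have /(subgrid_cellP M)[r r2 /andP[xr1 xr2]] : pt m i < x <= pt m i.+1.
    by rewrite x2 (lt_le_trans _ x1)// (le_lt_trans _ u1).
  have qr : (q <= r)%N.
    rewrite leqNgt; apply/negP => rq.
    have : x < x by rewrite (le_lt_trans xr2)// (lt_le_trans _ x1)// (le_lt_trans _ u1)// ler_pt -addnS leq_add2l.
    by rewrite ltxx.
  rewrite wj; move: qr; rewrite leq_eqVlt => /orP[/eqP rq|rq].
    by rewrite -rq in xr1 xr2; rewrite h2 ?x1//= -addnS wr1// ltnn.
  have [v /andP[v1 v2] [g1 g2]] := H _ (cell r r2).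
  have [xv|vx] := ltP x v; first by rewrite g1 ?(ltW xr1)//= wr// leqNgt rq.
  by rewrite g2 ?vx//= -addnS wr1// leqNgt ltnS (ltnW rq).
Qed.

End grid.

(** * Iterating one-step bounds along a subgrid *)

Section skeleton_events.
Variable R : realType.
Local Notation T := (skorokhod R).
Local Notation pt := (@pt R).

Definition sub_jump (m i l : nat) (k j : int) : set T :=
  [set w | skeleton_jump w m i l k j].

Definition cell_event (m i : nat) (k j : int) : set T :=
  [set w | [/\ w (pt m i) = k, w (pt m i.+1) = j
            & single_jump w (pt m i) (pt m i.+1)]].

Lemma sub_jump_last m i l k j (w : T) : sub_jump m i l k j w -> w (pt m i.+1) = j.
Proof.
move=> [q q2 h]; have := h _ (leqnn _); rewrite leqNgt q2/= => <-.
have -> : (i * 2 ^ l + 2 ^ l = i.+1 * 2 ^ l)%N by rewrite mulSn addnC.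
by rewrite ptD.
Qed.

Lemma sub_jump_first m i l k j (w : T) : sub_jump m i l k j w -> w (pt m i) = k.
Proof. by move=> [q q2 h]; have := h _ (leq0n _); rewrite addn0 ptD. Qed.

(** An intersection which decreases in l ([sub_jumpS]), so that lower bounds for
the probabilities of the skeleton events pass to the limit. *)
Lemma cell_eventE m i k j : (i < 2 ^ m)%N ->
  cell_event m i k j = \bigcap_l sub_jump m i l k j.
Proof.
move=> im; apply/seteqP; split=> [w [<- <-] h l _|w h].
  exact: single_jump_skeleton.
have h' l := h l I; split; [exact: sub_jump_first (h' 0%N)|exact: sub_jump_last (h' 0%N)|].
exact: (skeleton_single_jump (path_cadlag w) im h').
Qed.

Lemma sub_jump_history m i l k j : (i < 2 ^ m)%N ->
  history (pt m i.+1) (sub_jump m i l k j).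
Proof.
move=> im.
have -> : sub_jump m i l k j = \bigcup_(q in `I_(2 ^ l)) \bigcap_(r in `I_((2 ^ l).+1))
   [set w : T | w (pt (m + l) (i * 2 ^ l + r)) = if (r <= q)%N then k else j].
  apply/seteqP; split=> [w [q q2 h]|w [q q2 h]]; exists q => //.
have e : (i * 2 ^ l + 2 ^ l = i.+1 * 2 ^ l)%N by rewrite mulSn addnC.
apply: (@fin_bigcup_measurable _ (g_sigma_algebraType (cylinders (pt m i.+1)))) => //.
move=> q _.
apply: (@fin_bigcap_measurable _ (g_sigma_algebraType (cylinders (pt m i.+1)))) => //.
move=> r /= r2; apply: history_coord; rewrite pt_ge0/= -(ptD _ m l) ler_pt -e leq_add2l.
by rewrite -ltnS.
Qed.

Lemma cell_event_history m i k j : (i < 2 ^ m)%N ->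
  history (pt m i.+1) (cell_event m i k j).
Proof.
move=> im; rewrite cell_eventE//.
apply: (@bigcap_measurable _ (g_sigma_algebraType (cylinders (pt m i.+1)))).
  by exists 0%N.
by move=> l _; exact: sub_jump_history.
Qed.

Lemma sub_jumpS m i l k j : sub_jump m i l.+1 k j `<=` sub_jump m i l k j.
Proof.
move=> w [q q2 h]; exists q./2; first by rewrite expnS in q2; lia.
move=> r r2; have := h r.*2; rewrite expnS.
have -> : pt (m + l.+1) (i * (2 * 2 ^ l) + r.*2) = pt (m + l) (i * 2 ^ l + r).
  rewrite -(ptD R (m + l) 1) addnS addn1; congr pt; rewrite expn1; lia.
by move=> ->; [congr (if _ then _ else _); lia|lia].
Qed.

End skeleton_events.

Section chain.
Variable R : realType.
Variables a b : int -> R.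
Hypothesis a0 : forall j, 0 < a j.
Hypothesis b0 : forall j, 0 < b j.
Variable P : probability (skorokhod R) R.
Hypothesis PG : has_generator a b P.

Local Notation T := (skorokhod R).
Local Notation K := (gen_bound a b).
Local Notation p A := (fine (P A)).
Local Notation pt := (@pt R).

Lemma p_ge0 (A : set T) : 0 <= p A.
Proof. exact: fine_ge0. Qed.

Lemma p_le (A B : set T) : measurable A -> measurable B -> A `<=` B -> p A <= p B.
Proof.
by move=> mA mB AB; apply: fine_le; rewrite ?fin_num_measure//; apply: le_measure; rewrite ?inE.
Qed.

Lemma p_add (A B : set T) : measurable A -> measurable B -> A `&` B = set0 ->
  p (A `|` B) = p A + p B.
Proof.
move=> mA mB AB; rewrite measureU// fineD ?fin_num_measure//.
Qed.

Lemma p_bigcap (E : nat -> set T) (c : R) : (forall l, measurable (E l)) ->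
  (forall l, E l.+1 `<=` E l) -> (forall l, c <= p (E l)) -> c <= p (\bigcap_l E l).
Proof.
move=> mE dE cE.
have mI : measurable (\bigcap_l E l) by apply: bigcap_measurable => //; exists 0%N.
have : (P \o E) n @[n --> \oo] --> P (\bigcap_l E l).
  apply: nonincreasing_cvg_mu => //.
    by rewrite -ge0_fin_numE ?fin_num_measure.
  by apply/nonincreasing_seqP => n; apply/subsetPset.
rewrite -lee_fin fineK ?fin_num_measure//; apply: cvge_ge.
by apply: nearW => n /=; have := cE n; rewrite -lee_fin fineK ?fin_num_measure.
Qed.

Lemma p_setD (A B : set T) : measurable A -> measurable B ->
  p (A `&` ~` B) = p A - p (A `&` B).
Proof.
move=> mA mB; have mnB := measurableC mB.
rewrite -[in p A](setIT A) -(setUv B) setIUr p_add; first by lra.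
- exact: measurableI.
- exact: measurableI.
- by rewrite setIACA setICr setI0.
Qed.

Lemma pt_bounds m i : (i < 2 ^ m)%N ->
  [/\ 0 <= pt m i, pt m i <= pt m i.+1 & pt m i.+1 <= 1].
Proof. by move=> im; rewrite pt_ge0 ler_pt leqnSn pt_le1. Qed.

Lemma pt_step m i : pt m i.+1 - pt m i = (2 ^+ m)^-1.
Proof. by rewrite ptS addrC addrA addNr add0r. Qed.

Definition stay (m i n : nat) (k : int) : set T :=
  [set w | forall r, (r <= n)%N -> w (pt m (i + r)) = k].

Lemma stayS m i n k :
  stay m i n.+1 k = stay m i n k `&` [set w | w (pt m (i + n.+1)) = k].
Proof.
apply/seteqP; split=> [w h|w [h hn] r].
  by split=> [r rn|]; apply: h => //; exact: leqW.
by rewrite leq_eqVlt => /orP[/eqP->//|]; exact: h.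
Qed.

Lemma stay_history m i n k : history (pt m (i + n)) (stay m i n k).
Proof.
elim: n => [|n ih].
  rewrite (_ : stay m i 0 k = [set w | w (pt m i) = k]).
    by apply: history_coord; rewrite pt_ge0 addn0 lexx.
  apply/seteqP; split=> w /=; first by move=> /(_ 0%N (leqnn _)); rewrite addn0.
  by move=> wk r; rewrite leqn0 => /eqP->; rewrite addn0.
rewrite stayS; apply: historyI.
  by apply: history_le ih; rewrite ler_pt leq_add2l.
by apply: history_coord; rewrite pt_ge0 lexx.
Qed.

(** Each step loses at most the fraction x of the mass of A: the one-step bound
is applied to the event of having stayed so far. *)
Lemma stay_lower (x : R) m i n k (A : set T) :
  (i + n <= 2 ^ m)%N -> 0 <= x ->
  (forall i' (B : set T), (i' < 2 ^ m)%N -> history (pt m i') B ->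
    B `<=` [set w | w (pt m i') = k] ->
    p B * (1 - x) <= p (B `&` [set w | w (pt m i'.+1) = k])) ->
  history (pt m i) A -> A `<=` [set w | w (pt m i) = k] ->
  p A * (1 - n%:R * x) <= p (A `&` stay m i n k).
Proof.
move=> + x0 H hA Ak.
have mst n' : (i + n' <= 2 ^ m)%N -> history (pt m (i + n')) (A `&` stay m i n' k).
  move=> ?; apply: historyI; last exact: stay_history.
  by apply: history_le hA; rewrite ler_pt leq_addr.
elim: n => [|n ih] nm.
  rewrite mul0r subr0 mulr1; rewrite (_ : A `&` _ = A)//.
  by apply: setIidl => w /Ak /= wk r; rewrite leqn0 => /eqP ->; rewrite addn0.
have nm' : (i + n <= 2 ^ m)%N by apply: leq_trans nm; rewrite leq_add2l.
rewrite stayS setIA addnS.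
apply: le_trans (H (i + n)%N _ _ (mst _ nm') _); last 2 first.
- by rewrite -addnS.
- by move=> w [_]; exact.
have mA : measurable A by apply: history_measurable hA; rewrite pt_le1// (leq_trans _ nm')// leq_addr.
have : p (A `&` stay m i n k) <= p A.
  apply: p_le => //; apply: measurableI => //.
  by apply: history_measurable (@stay_history _ _ _ _); rewrite pt_le1.
move: (ih nm') => ih'; rewrite -natr1 => le1.
have : p (A `&` stay m i n k) * x <= p A * x by rewrite ler_wpM2r.
lra.
Qed.

(** The n disjoint ways of jumping from k to j, one for each step, each have
probability at least y times the factors 1 - n x and 1 - n z of staying in k
before the jump and in j after it. The induction on n separates a jump in the
last step from the earlier ones. *)
Lemma skip_lower (x y z : R) m i n k j (A : set T) :
  k != j -> (i + n <= 2 ^ m)%N -> 0 <= x -> n%:R * x <= 1 -> 0 <= y -> 0 <= z <= 1 ->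
  (forall i' (B : set T), (i' < 2 ^ m)%N -> history (pt m i') B ->
    B `<=` [set w | w (pt m i') = k] ->
    p B * (1 - x) <= p (B `&` [set w | w (pt m i'.+1) = k])) ->
  (forall i' (B : set T), (i' < 2 ^ m)%N -> history (pt m i') B ->
    B `<=` [set w | w (pt m i') = k] ->
    p B * y <= p (B `&` [set w | w (pt m i'.+1) = j])) ->
  (forall i' (B : set T), (i' < 2 ^ m)%N -> history (pt m i') B ->
    B `<=` [set w | w (pt m i') = j] ->
    p B * (1 - z) <= p (B `&` [set w | w (pt m i'.+1) = j])) ->
  history (pt m i) A -> A `<=` [set w | w (pt m i) = k] ->
  p A * (n%:R * y * (1 - n%:R * x) * (1 - n%:R * z)) <=
  p (A `&` [set w | exists2 q, (q < n)%N & forall r, (r <= n)%N ->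
      w (pt m (i + r)) = if (r <= q)%N then k else j]).
Proof.
move=> kj nm x0 nx1 y0 /andP[z0 z1] Hk Hkj Hj hA Ak.
pose J n' := [set w : T | exists2 q, (q < n')%N & forall r, (r <= n')%N ->
      w (pt m (i + r)) = if (r <= q)%N then k else j].
have im : (i <= 2 ^ m)%N by apply: leq_trans nm; rewrite leq_addr.
have mA : measurable A by apply: history_measurable hA; rewrite pt_le1.
have JS n' : J n'.+1 = (J n' `&` [set w | w (pt m (i + n').+1) = j])
    `|` (stay m i n' k `&` [set w | w (pt m (i + n').+1) = j]).
  apply/seteqP; split=> [w [q qn h]|w].
    have [qn'|] := ltnP q n'.
      left; split; last by rewrite /= -addnS h// leqNgt qn.
      by exists q => // r rn; apply: h; exact: leqW.
    move=> n'q; have qE : q = n' by lia.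
    right; split; last by rewrite /= -addnS h// leqNgt qn.
    by move=> r rn; rewrite h ?leqW// qE rn.
  move=> [[[q qn h] hn]|[h hn]].
    exists q; first exact: leqW.
    move=> r; rewrite leq_eqVlt => /orP[/eqP->|]; last by rewrite ltnS; exact: h.
    by rewrite addnS leqNgt ltnS (ltnW qn).
  exists n' => // r; rewrite leq_eqVlt => /orP[/eqP->|].
    by rewrite addnS ltnn.
  by rewrite ltnS => rn; rewrite rn; exact: h.
have Jend n' w : J n' w -> w (pt m (i + n')) = j.
  by move=> [q qn h]; rewrite h// leqNgt qn.
have hJ n' : history (pt m (i + n')) (J n').
  elim: n' => [|n' ih].
    rewrite (_ : J 0%N = set0); last by apply/seteqP; split => // w [].
    exact: (@measurable0 _ (g_sigma_algebraType (cylinders _))).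
  rewrite JS addnS.
  apply: (@measurableU _ (g_sigma_algebraType (cylinders (pt m (i + n').+1))));
    apply: historyI; try by apply: history_coord; rewrite pt_ge0 lexx.
    by apply: history_le ih; rewrite ler_pt.
  by apply: history_le (@stay_history _ _ _ _); rewrite ler_pt.
have hAI n' E : history (pt m (i + n')) E -> history (pt m (i + n')) (A `&` E).
  by apply: historyI; apply: history_le hA; rewrite ler_pt leq_addr.
suff H n' : (n' <= n)%N ->
    p A * (n'%:R * y * (1 - n%:R * x) * (1 - n'%:R * z)) <= p (A `&` J n').
  exact: H.
elim: n' => [|n' ih] n'n; first by rewrite !mul0r mulr0 p_ge0.
have inm : (i + n' < 2 ^ m)%N by apply: leq_trans nm; rewrite ltn_add2l.
have mm E : history (pt m (i + n').+1) E -> measurable E.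
  by apply: history_measurable; rewrite pt_le1.
have hj : history (pt m (i + n').+1) [set w : T | w (pt m (i + n').+1) = j].
  by apply: history_coord; rewrite pt_ge0 lexx.
have hAI' E : history (pt m (i + n')) E -> history (pt m (i + n').+1) (A `&` E).
  by move=> hE; apply: history_le (hAI _ _ hE); rewrite ler_pt.
rewrite JS setIUr !setIA p_add; last first.
- apply/seteqP; split => // w [[[Aw Jw] _] [[_ Sw] _]].
  move/eqP: kj; apply; rewrite -(Jend _ _ Jw); apply/esym; exact: Sw.
- by apply: mm; apply: historyI => //; apply: hAI'; exact: stay_history.
- by apply: mm; apply: historyI => //; apply: hAI'; exact: hJ.
have h1 := Hj _ _ inm (hAI _ _ (hJ n')) (fun w AJ => Jend _ _ AJ.2).
have h2 := Hkj _ _ inm (hAI _ _ (@stay_history m i n' k)) (fun w AS => AS.2 _ (leqnn _)).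
have h3 : p A * (1 - n'%:R * x) <= p (A `&` stay m i n' k).
  exact: stay_lower (ltnW inm) _ _ _ _.
have h4 := ih (ltnW n'n).
have pA := p_ge0 A.
set L := 1 - n%:R * x in h4 *.
have L0 : 0 <= L by rewrite subr_ge0.
have h5 : p A * L * y <= p (A `&` stay m i n' k) * y.
  rewrite ler_wpM2r//; apply: le_trans h3; rewrite ler_wpM2l// lerD2l lerN2.
  by rewrite ler_wpM2r// ler_nat ltnW.
have h6 : p A * (n'%:R * y * L * (1 - n'%:R * z)) * (1 - z) <= p (A `&` J n') * (1 - z).
  by rewrite ler_wpM2r// subr_ge0.
have N0 : 0 <= n'%:R :> R by [].
have : 0 <= p A * (L * y) * z * (1 + n'%:R + n'%:R * n'%:R * z).
  by rewrite !mulr_ge0// !addr_ge0// !mulr_ge0.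
rewrite -natr1; lra.
Qed.

End chain.

(** * Crossing one dyadic cell *)

Section cells.
Variable R : realType.
Variables a b : int -> R.
Hypothesis a0 : forall j, 0 < a j.
Hypothesis b0 : forall j, 0 < b j.
Variable P : probability (skorokhod R) R.
Hypothesis PG : has_generator a b P.

Local Notation T := (skorokhod R).
Local Notation K := (gen_bound a b).
Local Notation p A := (fine (P A)).
Local Notation pt := (@pt R).

Lemma cell_event_measurable m i k j : (i < 2 ^ m)%N ->
  measurable (@cell_event R m i k j).
Proof.
move=> im; apply: history_measurable (@cell_event_history R m i k j im).
exact: pt_le1.
Qed.

Lemma cell_lower m i k j (A : set T) (c : R) : (i < 2 ^ m)%N ->
  history (pt m i) A ->
  (forall l, c <= p (A `&` sub_jump m i l k j)) -> c <= p (A `&` cell_event m i k j).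
Proof.
move=> im hA H; have [_ _ im1] := pt_bounds R im.
have mA : measurable A by apply: history_measurable hA; rewrite pt_le1// ltnW.
rewrite cell_eventE// setIC -bigcapIl; last by exists 0%N.
apply: p_bigcap => [l|l|l]; last by rewrite setIC.
  apply: measurableI => //.
  exact: history_measurable (@sub_jump_history R m i l k j im).
by apply: setSI; exact: sub_jumpS.
Qed.

Lemma cell_event_cst m i k (w : T) (r : R) : cell_event m i k k w ->
  pt m i <= r <= pt m i.+1 -> w r = k.
Proof.
move=> [wk wk' [u _ [h1 h2]]] /andP[r1 r2]; have [ru|ur] := ltP r u.
  by rewrite h1 ?r1.
by rewrite h2 ?ur.
Qed.

(** The 2^l steps of the subgrid of level m + l lose x / 2^l each, hence x in
total, whatever l. *)
Lemma cell_stay_lower m i k (A : set T) (x : R) : (i < 2 ^ m)%N ->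
  history (pt m i) A -> A `<=` [set w | w (pt m i) = k] ->
  0 <= x ->
  (forall l i' (B : set T), (i' < 2 ^ (m + l))%N -> history (pt (m + l) i') B ->
    B `<=` [set w | w (pt (m + l) i') = k] ->
    p B * (1 - x / 2 ^+ l) <= p (B `&` [set w | w (pt (m + l) i'.+1) = k])) ->
  p A * (1 - x) <= p (A `&` cell_event m i k k).
Proof.
move=> im hA Ak x0 H; apply: cell_lower => // l.
have [_ _ im1] := pt_bounds R im.
have mA : measurable A by apply: history_measurable hA; rewrite pt_le1// ltnW.
have e : (i * 2 ^ l + 2 ^ l = i.+1 * 2 ^ l)%N by rewrite mulSn addnC.
have iln : (i * 2 ^ l + 2 ^ l <= 2 ^ (m + l))%N by rewrite e expnD leq_mul2r im orbT.
rewrite -[in X in X <= _](@mulfVK _ (2 ^+ l) _ x) ?expf_neq0//.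
rewrite [_ * 2 ^+ l]mulrC -natrX.
apply: le_trans (@stay_lower R P (x / (2 ^ l)%:R) (m + l) (i * 2 ^ l) (2 ^ l) k A _ _ _ _ _) _ => //.
- by rewrite divr_ge0.
- by move=> i' B i'm hB Bk; rewrite natrX; exact: H.
- by rewrite ptD.
- by rewrite ptD.
apply: p_le.
- apply: measurableI => //.
  apply: history_measurable (@stay_history _ _ _ _ _) => //.
  by rewrite e ptD.
- apply: measurableI => //.
  exact: history_measurable (@sub_jump_history R m i l k k im).
- apply: setIS => w h; exists 0%N; first by rewrite expn_gt0.
  by move=> r r2; rewrite h// if_same.
Qed.

(** A rough constant, from [stay_point]. It bounds the exceptional event in
[transition_bound], which in turn gives the exact first-order constant in
[cell_stay_bound]. *)
Lemma cell_const_lower m i k (A : set T) : (i < 2 ^ m)%N ->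
  history (pt m i) A -> A `<=` [set w | w (pt m i) = k] ->
  p A * (1 - K k / 2 ^+ m) <= p (A `&` cell_event m i k k).
Proof.
move=> im hA Ak; apply: cell_stay_lower => //.
  by rewrite divr_ge0 ?exprn_ge0// ltW// K_gt0.
move=> l i' B i'm hB Bk; have [i'0 i'1 i'2] := pt_bounds R i'm.
have := stay_point a0 b0 PG i'0 i'1 i'2 hB Bk.
by rewrite pt_step exprD invfM mulrA.
Qed.

(** For a path that is constant in the cell the compensator is exactly the rate
times the length of the cell. The other paths have probability of order h and a
compensator of order h, so that they only count at order h^2. *)
Lemma transition_bound m i k j (A : set T) : (i < 2 ^ m)%N ->
  history (pt m i) A -> A `<=` [set w | w (pt m i) = k] ->
  `|p (A `&` [set w | w (pt m i.+1) = j]) -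
      ((k == j)%:R + walk_generator a b (indic1 R j) k / 2 ^+ m) * p A|
   <= 2 * K j * K k / 2 ^+ m / 2 ^+ m * p A.
Proof.
move=> im hA Ak; have [i0 i1 i2] := pt_bounds R im.
have mA : measurable A by apply: history_measurable hA; rewrite pt_le1// ltnW.
have mC := @cell_event_measurable m i k k im.
have Kj := K_gt0 a0 b0 j; have h0 := pow2_gt0 R m.
set h := (2 ^+ m)^-1; have {h0} h0 : 0 < h by rewrite invr_gt0.
have := @increment_bound R a b P PG _ _ A (~` cell_event m i k k) j k
  (walk_generator a b (indic1 R j) k * h) 0 (2 * K j * h) i0 i1 i2 hA Ak (measurableC mC).
move=> H; apply: le_trans (H _) _.
  move=> w Aw; rewrite add0r indicE.
  case: (boolP (w \in ~` cell_event m i k k)).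
    move=> _; rewrite mulr1; apply: le_trans (ler_normB _ _) _.
    have := compensator_bound a0 b0 j w i1; rewrite pt_step -/h => h1.
    rewrite normrM (gtr0_norm h0).
    have : `|walk_generator a b (indic1 R j) k| * h <= K j * h.
      by rewrite ler_pM2r// gen_indic_bound.
    lra.
  move=> /negP; rewrite inE /= => /contrapT cw.
  rewrite (compensator_cst a b j i1 (fun r => @cell_event_cst m i k w r cw)).
  by rewrite pt_step subrr normr0 mulr0.
rewrite mul0r add0r p_setD//.
have : p A - p (A `&` cell_event m i k k) <= K k * h * p A.
  by have := cell_const_lower im hA Ak; rewrite -/h; lra.
move=> /(ler_wpM2l (_ : 0 <= 2 * K j * h)) h1.
apply: le_trans (h1 _) _; first by rewrite !mulr_ge0// ltW.
by rewrite le_eqVlt; apply/orP; left; apply/eqP; ring.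
Qed.

Definition rate (k j : int) : R := walk_generator a b (indic1 R j) k.

Lemma rate_up k : rate k (k + 1) = a k.
Proof.
rewrite /rate gen_indic addrK eqxx mul1r.
rewrite (_ : (k == k + 1 + 1) = false); last first.
  by apply/negbTE; rewrite eq_sym -addrA -subr_eq0 addrAC subrr add0r.
rewrite (_ : (k == k + 1) = false); last first.
  by apply/negbTE; rewrite eq_sym -subr_eq0 addrAC subrr add0r.
by rewrite !mul0r addr0 subr0.
Qed.

Lemma rate_down k : rate k (k - 1) = b k.
Proof.
rewrite /rate gen_indic subrK eqxx mul1r.
rewrite (_ : (k == k - 1 - 1) = false); last first.
  by apply/negbTE; rewrite eq_sym -addrA -subr_eq0 addrAC subrr add0r.
rewrite (_ : (k == k - 1) = false); last first.
  by apply/negbTE; rewrite eq_sym -subr_eq0 addrAC subrr add0r.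
by rewrite !mul0r add0r subr0.
Qed.

Lemma rate_stay k : rate k k = - (a k + b k).
Proof.
rewrite /rate gen_indic eqxx mul1r.
rewrite (_ : (k == k + 1) = false); last first.
  by apply/negbTE; rewrite eq_sym -subr_eq0 addrAC subrr add0r.
rewrite (_ : (k == k - 1) = false); last first.
  by apply/negbTE; rewrite eq_sym -subr_eq0 addrAC subrr add0r.
by rewrite !mul0r !add0r.
Qed.

Lemma cell_stay_bound m i k (A : set T) : (i < 2 ^ m)%N ->
  history (pt m i) A -> A `<=` [set w | w (pt m i) = k] ->
  p A * (1 - ((a k + b k) / 2 ^+ m + 2 * K k ^+ 2 / 2 ^+ m / 2 ^+ m)) <=
  p (A `&` cell_event m i k k).
Proof.
move=> im hA Ak; have Kk := K_gt0 a0 b0 k; have h0 := pow2_gt0 R m.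
set h := (2 ^+ m)^-1; have {h0} h0 : 0 < h by rewrite invr_gt0.
apply: cell_stay_lower => //.
  rewrite addr_ge0// !mulr_ge0 ?exprn_ge0// ?(ltW h0)// ?(ltW Kk)//.
  by rewrite addr_ge0// ltW.
move=> l i' B i'm hB Bk.
have /ler_normlP[+ _] := transition_bound k i'm hB Bk.
rewrite eqxx -/(rate k k) rate_stay exprD !invfM -/h.
have : (2 ^+ l)^-1 <= 1 :> R by rewrite invf_le1 ?pow2_gt0// exprn_ege1// ler1n.
have : 0 <= (2 ^+ l)^-1 :> R by rewrite invr_ge0 ltW// pow2_gt0.
set g := (2 ^+ l)^-1 => g0 g1.
have : 0 <= p B * K k ^+ 2 * h ^+ 2 * (g * (1 - g)).
  by rewrite !mulr_ge0 ?p_ge0 ?(ltW Kk) ?(ltW h0) ?subr_ge0.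
rewrite ?expr2 mulr1n; lra.
Qed.

(** On the subgrid of level m + l, [skip_lower] has 2^l steps, each of which jumps
with probability about rate k j / 2^(m + l); the errors of these steps add up to
at most 2 K j K k / 4^m. *)
Lemma cell_jump_bound m i k j (A : set T) : (i < 2 ^ m)%N -> k != j ->
  history (pt m i) A -> A `<=` [set w | w (pt m i) = k] ->
  K k / 2 ^+ m <= 1 -> K j / 2 ^+ m <= 1 ->
  2 * K j * K k / 2 ^+ m / 2 ^+ m <= rate k j / 2 ^+ m ->
  p A * ((rate k j / 2 ^+ m - 2 * K j * K k / 2 ^+ m / 2 ^+ m)
         * (1 - K k / 2 ^+ m) * (1 - K j / 2 ^+ m)) <=
  p (A `&` cell_event m i k j).
Proof.
move=> im kj hA Ak; have Kk := K_gt0 a0 b0 k; have Kj := K_gt0 a0 b0 j.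
have := pow2_gt0 R m; set h := (2 ^+ m)^-1 => h0' K1 K2 K3.
have h0 : 0 < h by rewrite invr_gt0.
apply: cell_lower => // l.
have e : (i * 2 ^ l + 2 ^ l = i.+1 * 2 ^ l)%N by rewrite mulSn addnC.
have iln : (i * 2 ^ l + 2 ^ l <= 2 ^ (m + l))%N by rewrite e expnD leq_mul2r im orbT.
have g1 : (2 ^+ l)^-1 <= 1 :> R by rewrite invf_le1 ?pow2_gt0// exprn_ege1// ler1n.
have g0 : 0 < (2 ^+ l)^-1 :> R by rewrite invr_gt0 pow2_gt0.
set g := (2 ^+ l)^-1 in g1 g0.
have Ng : (2 ^ l)%:R * g = 1 by rewrite natrX divff// expf_neq0.
have pA := p_ge0 P A.
have g1' : 0 <= 1 - g by rewrite subr_ge0.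
have H0 : 0 <= rate k j * h * g - 2 * K j * K k * (h * g) * (h * g).
  have : 0 <= (rate k j * h - 2 * K j * K k * h * h) * g by rewrite mulr_ge0 ?subr_ge0// ltW.
  have : 0 <= 2 * K j * K k * h * h * (g * (1 - g)).
    by rewrite !mulr_ge0 ?(ltW Kk) ?(ltW Kj) ?(ltW h0) ?(ltW g0).
  lra.
have step k' i' (B : set T) : (i' < 2 ^ (m + l))%N -> history (pt (m + l) i') B ->
    B `<=` [set w | w (pt (m + l) i') = k'] ->
    p B * (1 - K k' * h * g) <= p (B `&` [set w | w (pt (m + l) i'.+1) = k']).
  move=> i'm hB Bk; have [i'0 i'1 i'2] := pt_bounds R i'm.
  have := stay_point a0 b0 PG i'0 i'1 i'2 hB Bk.
  by rewrite pt_step exprD invfM -/h -/g mulrA.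
have := @skip_lower R P (K k * h * g) (rate k j * h * g - 2 * K j * K k * (h * g) * (h * g))
  (K j * h * g) (m + l) (i * 2 ^ l) (2 ^ l) k j A kj iln.
rewrite (_ : (2 ^ l)%:R * (K k * h * g) = K k * h); last first.
  by rewrite mulrCA Ng mulr1.
rewrite (_ : (2 ^ l)%:R * (K j * h * g) = K j * h); last first.
  by rewrite mulrCA Ng mulr1.
rewrite (_ : (2 ^ l)%:R * (rate k j * h * g - 2 * K j * K k * (h * g) * (h * g))
   = rate k j * h - 2 * K j * K k * h * (h * g)); last first.
  have -> : rate k j * h * g - 2 * K j * K k * (h * g) * (h * g) =
            (rate k j * h - 2 * K j * K k * h * (h * g)) * g by ring.
  by rewrite mulrCA Ng mulr1.
move=> H; apply: le_trans _ (H _ _ _ _ _ _ _ _ _) => //.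
- rewrite ler_wpM2l// ler_wpM2r ?subr_ge0// ler_wpM2r ?subr_ge0// lerD2l lerN2.
  by rewrite ler_wpM2l ?ler_piMr// ?(ltW h0)// !mulr_ge0// ?(ltW h0)// ltW.

- by rewrite !mulr_ge0 ?ltW.
- rewrite !mulr_ge0 ?(ltW Kj) ?(ltW h0) ?(ltW g0)//=.
  by rewrite (le_trans _ K2)// ler_piMr// mulr_ge0// ltW.
- by move=> i' B; exact: step.
- move=> i' B i'm hB Bk.
  have /ler_normlP[+ _] := transition_bound j i'm hB Bk.
  rewrite (negbTE kj) mulr0n -/(rate k j) exprD !invfM -/h -/g; lra.
- by move=> i' B; exact: step.
- by rewrite ptD.
- by rewrite ptD.
Qed.

End cells.

(** * Relative errors, and chains of cells *)

Ltac nneg := repeat first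
  [ done | by apply: ltW | apply: sqr_ge0 | by apply: expR_ge0 | apply: exprn_ge0
  | apply: mulr_ge0 | apply: addr_ge0 ].

Section exponential.
Variable R : realType.
Implicit Types x : R.

Lemma expRN_le x : 0 <= x <= 2^-1 -> expR (- (x + 2 * x ^+ 2)) <= 1 - x.
Proof.
move=> /andP[x0 x1]; set y := x + 2 * x ^+ 2.
have y0 : 0 <= y by rewrite addr_ge0// mulr_ge0// sqr_ge0.
rewrite expRN; apply: (@le_trans _ _ (1 + y)^-1).
  by rewrite lef_pV2 ?posrE ?expR_gt0 ?expR_ge1Dx//; lra.
rewrite -[X in X <= _]mul1r ler_pdivrMr; last by lra.
rewrite /y; have : 0 <= x ^+ 2 * (1 - 2 * x) by rewrite mulr_ge0 ?sqr_ge0//; lra.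
lra.
Qed.

Lemma expRN_le2 x : 0 <= x <= 2^-1 -> expR (- (2 * x)) <= 1 - x.
Proof.
move=> x01; apply: le_trans (expRN_le x01); rewrite ler_expR lerN2.
case/andP: x01 => x0 x1.
have : 0 <= x * (1 - 2 * x) by rewrite mulr_ge0//; lra.
lra.
Qed.

End exponential.

Section boxes.
Variable R : realType.
Variables a b : int -> R.
Hypothesis a0 : forall j, 0 < a j.
Hypothesis b0 : forall j, 0 < b j.
Variable P : probability (skorokhod R) R.
Hypothesis PG : has_generator a b P.

Local Notation T := (skorokhod R).
Local Notation K := (gen_bound a b).
Local Notation p A := (fine (P A)).
Local Notation pt := (@pt R).

Definition unit_step (k j : int) : Prop := [\/ j = k, j = k + 1 | j = k - 1].

(** Leading term of the probability of crossing a cell of length h from k to j. *)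
Definition cell_weight (k j : int) (h : R) : R :=
  if j == k then expR (- ((a k + b k) * h)) else rate a b k j * h.

(** Relative errors: of order h^2 for a cell without jump, so that 2^m of them
add up to order h, and of order h for a cell with a jump, of which there are
boundedly many. The numerical factors only have to be large enough. *)
Definition cell_error (L : R) (k j : int) (h : R) : R :=
  if j == k then 20 * L ^+ 2 * h ^+ 2 else 8 * L ^+ 3 * h.

(** The bounds on the inverses of the rates turn additive errors into relative
ones. *)
Definition rates_bounded (L : R) (k : int) : Prop :=
  [/\ K k <= L, (a k)^-1 <= L & (b k)^-1 <= L].

Lemma cell_weight_gt0 k j h : 0 < h -> unit_step k j -> 0 < cell_weight k j h.
Proof.
move=> h0 kj; rewrite /cell_weight; case: eqP => [_|]; first exact: expR_gt0.
by case: kj => // -> _; rewrite ?rate_up ?rate_down mulr_gt0.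
Qed.

(** Up to second order 1 - x is exp (- x), and an additive error of order h^2 is a
relative error of order h for a jump, which has probability at least h / L. *)
Lemma cell_estimate (L : R) m i k j (A : set T) : (i < 2 ^ m)%N ->
  history (pt m i) A -> A `<=` [set w | w (pt m i) = k] ->
  1 <= L -> 8 * L ^+ 3 <= 2 ^+ m -> rates_bounded L k -> rates_bounded L j ->
  unit_step k j ->
  p A * (cell_weight k j (2 ^+ m)^-1 * expR (- cell_error L k j (2 ^+ m)^-1))
    <= p (A `&` cell_event m i k j)
    <= p A * (cell_weight k j (2 ^+ m)^-1 * expR (cell_error L k j (2 ^+ m)^-1)).
Proof.
move=> im hA Ak L1 Lm [Kk ak bk] [Kj _ _] kj.
have Kk0 := K_gt0 a0 b0 k; have Kj0 := K_gt0 a0 b0 j.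
have L0 : 0 < L by lra.
have /ler_normlP[_ up] := transition_bound a0 b0 PG j im hA Ak.
have lo1 := cell_stay_bound a0 b0 PG im hA Ak.
have lo2 kj' := cell_jump_bound (j := j) a0 b0 PG im kj' hA Ak.
have h0 : 0 < (2 ^+ m)^-1 :> R by rewrite invr_gt0 pow2_gt0.
have Lh : 8 * L ^+ 3 * (2 ^+ m)^-1 <= 1 by rewrite ler_pdivrMr ?mul1r// pow2_gt0.
have pA := p_ge0 P A.
have [_ _ im1] := pt_bounds R im.
have mA : measurable A by apply: history_measurable hA; rewrite pt_le1// ltnW.
have up' : p (A `&` cell_event m i k j) <= p (A `&` [set w | w (pt m i.+1) = j]).
  apply: p_le.
  - by apply: measurableI => //; exact: cell_event_measurable.
  - apply: measurableI => //; apply: measurable_coord.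
    by rewrite pt_ge0.
  - by apply: setIS => w [].
rewrite /cell_weight /cell_error; move: up lo1 lo2.
set h := (2 ^+ m)^-1 in h0 Lh *; move=> up lo1 lo2.
have L2 : L <= L ^+ 2 by rewrite expr2 ler_peMr// ltW.
have L3 : L ^+ 2 <= L ^+ 3 by rewrite [leRHS]exprSr ler_peMr// sqr_ge0.
have L2h : L ^+ 2 * h <= L ^+ 3 * h by rewrite ler_wpM2r// ltW.
have Lh' : L * h <= L ^+ 2 * h by rewrite ler_wpM2r// ltW.
have Lh0 : 0 < L * h by rewrite mulr_gt0.
have KK : 2 * K j * K k * h * h <= 2 * L ^+ 2 * h ^+ 2.
  rewrite expr2 -[leLHS]mulrA -expr2 ler_wpM2r ?sqr_ge0//.
  by rewrite -!mulrA ler_wpM2l// ler_pM// ltW.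
apply/andP; split; last first.
  apply: le_trans up' _.
  have {}up : p (A `&` [set w | w (pt m i.+1) = j]) <=
      p A * ((k == j)%:R + rate a b k j * h + 2 * L ^+ 2 * h ^+ 2).
    have := ler_wpM2r pA KK; rewrite /rate; lra.
  apply: le_trans up _; rewrite ler_wpM2l//.
  case: (j =P k) kj => [-> _|kj].
    rewrite rate_stay -expRD eqxx mulr1n.
    apply: le_trans (expR_ge1Dx _); rewrite -addrA lerD2l.
    have : 0 <= 18 * L ^+ 2 * h ^+ 2 by nneg.
    lra.
  move=> us; rewrite (_ : k == j = false) ?mulr0n; last first.
    by apply/negbTE/eqP => e; exact: kj.
  have q0 : 0 < rate a b k j /\ (rate a b k j)^-1 <= L.
    by case: us => [//|->|->]; rewrite ?rate_up ?rate_down.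
  case: q0 => q0 qL; set q := rate a b k j in q0 qL *.
  have qL1 : 1 <= L * q by rewrite -ler_pdivrMr// mul1r.
  apply: (@le_trans _ _ (q * h * (1 + 8 * L ^+ 3 * h))).
    have : 2 * L ^+ 2 * h ^+ 2 * 1 <= 2 * L ^+ 2 * h ^+ 2 * (L * q).
      by rewrite ler_wpM2l//; nneg.
    have : 0 <= 6 * L ^+ 3 * h ^+ 2 * q.
      by nneg.
    rewrite add0r; lra.
  by rewrite ler_wpM2l ?expR_ge1Dx// mulr_ge0// ltW.
case: (j =P k) kj => [jk _|kj us].
  rewrite jk; apply: le_trans lo1; rewrite ler_wpM2l// -expRD.
  set x := (X in 1 - X).
  have akL : (a k + b k) <= L.
    apply: le_trans Kk; rewrite /gen_bound.
    by have := a0 (k - 1); have := b0 (k + 1); lra.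
  have ab0 : 0 < a k + b k by rewrite addr_gt0.
  have xL : x <= 3 * (L * h).
    rewrite /x.
    have : (a k + b k) * h <= L * h by rewrite ler_wpM2r// ltW.
    have : 2 * K k ^+ 2 * h * h <= 2 * L ^+ 2 * h * h.
      rewrite !ler_wpM2r ?(ltW h0)// ler_wpM2l// lerXn2r ?nnegrE// ltW//.
    have : 2 * (L * h) * (L * h) <= 2 * (L * h) * 1.
      by rewrite ler_wpM2l//; lra.
    rewrite !expr2; lra.
  have x0 : 0 <= x.
    by rewrite /x; nneg.
  apply: le_trans (expRN_le (_ : 0 <= x <= 2^-1)); last by apply/andP; split; lra.
  rewrite ler_expR.
  have : x ^+ 2 <= (3 * (L * h)) ^+ 2 by rewrite lerXn2r ?nnegrE//; lra.
  have : x <= (a k + b k) * h + 2 * L ^+ 2 * h ^+ 2.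
    have KL : K k ^+ 2 <= L ^+ 2 by rewrite lerXn2r ?nnegrE// ltW.
    have : K k ^+ 2 * h ^+ 2 <= L ^+ 2 * h ^+ 2 by rewrite ler_wpM2r// sqr_ge0.
    by rewrite /x; lra.
  rewrite expr2; nra.
have kj' : k != j by apply/eqP => e; exact: kj.
have q0 : 0 < rate a b k j /\ (rate a b k j)^-1 <= L.
  by case: us => [//|->|->]; rewrite ?rate_up ?rate_down.
case: q0 => q0 qL; set q := rate a b k j in q0 qL lo2 *.
have qL1 : 1 <= L * q by rewrite -ler_pdivrMr// mul1r.
have Kkh : K k * h <= L * h by rewrite ler_wpM2r// ltW.
have Kjh : K j * h <= L * h by rewrite ler_wpM2r// ltW.
have L3h0 : 0 < L ^+ 3 * h by rewrite mulr_gt0// exprn_gt0.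
have qq : 2 * L ^+ 2 * h ^+ 2 <= q * h * (2 * (L ^+ 3 * h)).
  have : 2 * L ^+ 2 * h ^+ 2 * 1 <= 2 * L ^+ 2 * h ^+ 2 * (L * q).
    by rewrite ler_wpM2l//; nneg.
  lra.
have qh0 : 0 < q * h by rewrite mulr_gt0.
apply: le_trans _ (lo2 kj' _ _ _); last 3 first.
- lra.
- lra.
- apply: le_trans KK _; apply: le_trans qq _; rewrite -[leRHS]mulr1 ler_wpM2l ?ltW//; lra.
rewrite ler_wpM2l//.
set y := L ^+ 3 * h in L2h L3h0 qq.
have y1 : 8 * y <= 1 by rewrite /y mulrA.
have -> : - (8 * L ^+ 3 * h) = - (2 * (2 * y)) + (- (2 * y)) + (- (2 * y)) by rewrite /y; ring.
rewrite !expRD.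
have e1 : expR (- (2 * (2 * y))) <= 1 - 2 * y.
  by apply: expRN_le2; apply/andP; split; lra.
have e2 : expR (- (2 * y)) <= 1 - y.
  by apply: expRN_le2; apply/andP; split; lra.
move: e1 e2 (expR_ge0 (- (2 * (2 * y)))) (expR_ge0 (- (2 * y))).
move: (expR _) (expR _) => x1 x2 e1 e2 x10 x20.
rewrite [leLHS]mulrA [in leLHS]mulrA.
apply: ler_pM => //; last by lra.
  by nneg.
apply: ler_pM => //; last by lra.
  by nneg.
apply: (@le_trans _ _ (q * h * (1 - 2 * y))).
  by rewrite ler_wpM2l// ltW.
lra.
Qed.

Definition box_upto (m n : nat) (k : nat -> int) : set T :=
  [set w | (forall i, (i <= n)%N -> w (pt m i) = k i) /\
           (forall i, (i < n)%N -> single_jump w (pt m i) (pt m i.+1))].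

Lemma box_uptoS m n k :
  box_upto m n.+1 k = box_upto m n k `&` cell_event m n (k n) (k n.+1).
Proof.
apply/seteqP; split=> [w [h1 h2]|w [[h1 h2] [g1 g2 g3]]].
  by split; [split=> i ?; [apply: h1|apply: h2]; exact: leqW|
    split; [exact: h1|exact: h1|exact: h2]].
split=> i; first by rewrite leq_eqVlt => /orP[/eqP->//|]; exact: h1.
by rewrite ltnS leq_eqVlt => /orP[/eqP->//|]; exact: h2.
Qed.

Lemma box_upto0 m k : box_upto m 0 k = [set w | w 0 = k 0%N].
Proof.
apply/seteqP; split=> w /=; first by move=> [/(_ 0%N (leqnn _))]; rewrite pt0.
by move=> wk; split=> // i; rewrite leqn0 => /eqP->; rewrite pt0.
Qed.

Lemma box_upto_history m n k : (n <= 2 ^ m)%N -> history (pt m n) (box_upto m n k).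
Proof.
elim: n => [|n ih] nm.
  by rewrite box_upto0; apply: history_coord; rewrite pt_ge0 lexx.
rewrite box_uptoS; apply: historyI; last exact: cell_event_history.
by apply: history_le (ih (ltnW nm)); rewrite ler_pt.
Qed.

(** The estimate of one cell, applied successively with the box built so far as
the event of the past. *)
Lemma box_estimate (L : R) m n (k : nat -> int) : (n <= 2 ^ m)%N ->
  1 <= L -> 8 * L ^+ 3 <= 2 ^+ m ->
  (forall i, (i <= n)%N -> rates_bounded L (k i)) ->
  (forall i, (i < n)%N -> unit_step (k i) (k i.+1)) ->
  p [set w | w 0 = k 0%N] *
    (\prod_(i < n) cell_weight (k i) (k i.+1) (2 ^+ m)^-1 *
     expR (- \sum_(i < n) cell_error L (k i) (k i.+1) (2 ^+ m)^-1))
  <= p (box_upto m n k) <=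
  p [set w | w 0 = k 0%N] *
    (\prod_(i < n) cell_weight (k i) (k i.+1) (2 ^+ m)^-1 *
     expR (\sum_(i < n) cell_error L (k i) (k i.+1) (2 ^+ m)^-1)).
Proof.
move=> + L1 Lm; elim: n => [|n ih] nm Lk us.
  by rewrite !big_ord0 oppr0 expR0 !mulr1 box_upto0 lexx.
rewrite !big_ord_recr /= box_uptoS.
have /ih : (n <= 2 ^ m)%N by exact: ltnW.
move=> /(_ (fun i h => Lk i (leqW h)) (fun i h => us i (leqW h))) /=.
set q := p [set w | w 0 = _]; set W' := \prod_(i < n) _; set E' := \sum_(i < n) _.
move=> /andP[h1 h2].
have /andP[g1 g2] := @cell_estimate L m n (k n) (k n.+1) (box_upto m n k) nm
  (@box_upto_history m n k (ltnW nm)) (fun w h => h.1 n (leqnn n)) L1 Lm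
  (Lk n (leqnSn n)) (Lk _ (leqnn _)) (us n (leqnn _)).
have h0 : 0 < (2 ^+ m)^-1 :> R by rewrite invr_gt0 pow2_gt0.
have c0 := cell_weight_gt0 h0 (us n (leqnn _)).
set c := cell_weight (k n) (k n.+1) _ in g1 g2 c0 *.
set e := cell_error L (k n) _ _ in g1 g2 *.
have m0 (x : R) : 0 <= c * expR x by rewrite mulr_ge0 ?expR_ge0// ltW.
rewrite opprD !expRD; apply/andP; split.
  apply: le_trans g1; apply: le_trans (ler_wpM2r (m0 _) h1).
  by rewrite le_eqVlt; apply/orP; left; apply/eqP; ring.
apply: (le_trans g2); apply: le_trans (ler_wpM2r (m0 _) h2) _.
by rewrite le_eqVlt; apply/orP; left; apply/eqP; ring.
Qed.

End boxes.

(** * The density functional along a dyadic grid *)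

Section density_on_boxes.
Variable R : realType.
Local Notation pt := (@pt R).
Implicit Types (w : skorokhod R) (s t : R).

Lemma left_value_cst w s t (k : int) : s < t ->
  (forall r, s < r < t -> w r = k) -> left_value w t = k.
Proof.
move=> st wk; apply: left_valueE; near=> r; apply: wk; apply/andP; split.
  near: r; exact: nbhs_left_gt.
by near: r; exact: nbhs_left_lt.
Unshelve. all: by end_near. Qed.

Lemma single_jumpP w s t : single_jump w s t ->
  exists2 u, s < u <= t & [/\ left_value w u = w s, w u = w t &
    forall r, s < r <= t -> r != u ->
      left_value w r = w r /\ (w r = w s \/ w r = w t)].
Proof.
move=> [u /andP[su ut] [h1 h2]]; exists u; first by rewrite su.
split.
- by apply: (left_value_cst su) => r /andP[sr ru]; rewrite h1// ru ltW.
- by rewrite h2// lexx.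
move=> r /andP[sr rt]; rewrite neq_lt => /orP[ru|ur].
  rewrite h1 ?ru ?ltW//; split; last by left.
  by apply: (left_value_cst sr) => x /andP[sx xr]; rewrite h1// ltW//= (lt_trans xr).
rewrite h2 ?rt ?ltW//; split; last by right.
by apply: (left_value_cst ur) => x /andP[ux xr]; rewrite h2// ltW//= (le_trans _ rt)// ltW.
Qed.

Definition in_cells w m := forall i, (i < 2 ^ m)%N -> single_jump w (pt m i) (pt m i.+1).

(** A cell whose end values differ by e contains exactly one jump of size e, and
the other cells contain none. *)
Lemma jump_times_bij w m (e : int) : in_cells w m -> left_value w 1 = w 1 -> e != 0 ->
  exists2 f : nat -> R,
    set_bij (`I_(2 ^ m) `&` [set i | w (pt m i.+1) = w (pt m i) + e]) (jump_times e w) f &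
    forall i, (i < 2 ^ m)%N -> w (pt m i.+1) = w (pt m i) + e ->
      left_value w (f i) = w (pt m i).
Proof.
move=> cw w1 e0.
have /choice[f fP] : forall i, exists u, (i < 2 ^ m)%N ->
   pt m i < u <= pt m i.+1 /\
   [/\ left_value w u = w (pt m i), w u = w (pt m i.+1) &
    forall r, pt m i < r <= pt m i.+1 -> r != u ->
      left_value w r = w r /\ (w r = w (pt m i) \/ w r = w (pt m i.+1))].
  move=> i; have [im|] := ltnP i (2 ^ m)%N; last by exists 0.
  by have [u u1 u2] := single_jumpP (cw i im); exists u.
exists f; last by move=> i im _; have [_ []] := fP i im.
split.
- move=> i /= [im st]; have [/andP[f1 f2] [f3 f4 _]] := fP i im.
  split; last by rewrite f3 f4.
  apply/andP; split; first by apply: le_lt_trans f1; exact: pt_ge0.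
  rewrite lt_neqAle (le_trans f2) ?pt_le1// andbT; apply/eqP => fi1.
  have /eqP : left_value w (f i) = w (f i) by rewrite fi1.
  by rewrite f3 f4 st eq_sym -subr_eq0 addrAC subrr add0r (negbTE e0).
- move=> i j; rewrite !inE => -[im _] [jm _] fij.
  have [/andP[i1 i2] _] := fP i im; have [/andP[j1 j2] _] := fP j jm.
  have : (i < j.+1)%N by rewrite -(ltr_pt R m) (lt_le_trans i1)// fij.
  have : (j < i.+1)%N by rewrite -(ltr_pt R m) (lt_le_trans j1)// -fij.
  by rewrite !ltnS => ji ij; apply/eqP; rewrite eqn_leq ij.
move=> t [/andP[t0 t1] wt].
have [|i im it] := @grid_cellP R m t; first by rewrite t0 ltW.
have [_ [f3 f4 f5]] := fP i im.
have [tf|/(f5 t it)[]] := eqVneq t (f i); last first.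
  move=> lt _; move/eqP: wt; rewrite lt eq_sym -subr_eq0 addrAC subrr add0r.
  by rewrite (negbTE e0).
exists i; last by [].
by split=> //=; rewrite -f4 -f3 -tf.
Qed.

Lemma in_cells_left w m i t : (i < 2 ^ m)%N -> in_cells w m ->
  pt m i < t <= pt m i.+1 ->
  left_value w t = w (pt m i) \/ left_value w t = w (pt m i.+1).
Proof.
move=> im cw it; have [u ui [f3 f4 f5]] := single_jumpP (cw i im).
have [->|/(f5 t it)[-> ]//] := eqVneq t u.
by left.
Qed.

Section M.
Variables a b : int -> R.
Hypothesis a0 : forall j, 0 < a j.
Hypothesis b0 : forall j, 0 < b j.
Variables (w : skorokhod R) (m : nat).
Hypothesis cw : in_cells w m.
Hypothesis w1 : left_value w 1 = w 1.
Hypothesis w0 : left_value w 0 = w 0.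
Local Notation N := (2 ^ m)%N.
Local Notation k i := (w (pt m i)).
Hypothesis us : forall i, (i < N)%N -> unit_step (k i) (k i.+1).
Local Notation h := ((2 ^+ m)^-1 : R).

Lemma fsbig_jumps (S : Type) (idx : S) (op : Monoid.com_law idx) (e : int)
    (F : int -> S) : e != 0 ->
  \big[op/idx]_(t \in jump_times e w) F (left_value w t) =
  \big[op/idx]_(i < N | k i.+1 == k i + e) F (k i).
Proof.
move=> e0; have [f fb fl] := jump_times_bij cw w1 e0.
rewrite (reindex_fsbig _ _ _ _ fb) fsbig_mkcondr.
rewrite [RHS]big_mkcond (fsbig_ord _ _ (fun i => if k i.+1 == k i + e then F (k i) else idx)).
apply: eq_fsbigr => i; rewrite inE /= => iN.
case: eqP => st; first by rewrite mem_set// fl.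
by rewrite memNset.
Qed.

Definition nb_jumps : nat := \sum_(i < N) (k i.+1 != k i).

Variable L : R.
Hypothesis kL : forall i, (i <= N)%N -> rates_bounded a b L (k i).

(** In a cell without jump the total rate is constant; in the nb_jumps others it
lies between 0 and L. *)
Lemma holding_integral :
  let c j := a j + b j in
  let S := \sum_(i < N) (if k i.+1 == k i then c (k i) * h else 0) in
  let I := \int[lebesgue_measure]_(t in `[0, 1])
            (a (left_value w t) + b (left_value w t)) in
  S <= I /\ I <= S + L * h * nb_jumps%:R.
Proof.
move=> c S I.
have h0 : 0 < h by rewrite invr_gt0 pow2_gt0.
have c0 j : 0 < c j by rewrite addr_gt0.
have cL i : (i <= N)%N -> c (k i) <= L.
  move=> /kL[+ _ _]; apply: le_trans; rewrite /gen_bound /c.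
  by have := a0 (k i - 1); have := b0 (k i + 1); lra.
pose lo i : R := if k i.+1 == k i then c (k i) else 0.
pose hi i : R := if k i.+1 == k i then c (k i) else L.
(* half-open cells (bb = false) contain each t > 0 once; closed ones also cover 0 *)
pose cell bb i : set R := [set` Interval (BSide bb (pt m i)) (BRight (pt m i.+1))].
have simple bb (v : nat -> R) : (forall i, (i < N)%N -> 0 <= v i) ->
    (\int[lebesgue_measure]_(t in `[0%R, 1%R]) (\sum_(i < N)
        (v i)%:E * (\1_(cell bb i) t)%:E) =
     (\sum_(i < N) v i * h)%:E)%E.
  move=> v0; rewrite ge0_integral_sum//; last 2 first.
  - move=> i; apply: measurable_funeM; apply/measurable_EFinP.
    by apply: measurable_indic; exact: measurable_itv.
  - by move=> i t _; rewrite mule_ge0// lee_fin v0.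
  rewrite -sumEFin; apply: eq_bigr => i _; rewrite integralZl//; last first.
    apply: (integrableS measurableT) => //; apply: integrable_indic_itv.
  rewrite integral_indic//=; last exact: measurable_itv.
  rewrite setIidl; last first.
    have := pt_ge0 R m i; have := pt_le1 R (ltn_ord i).
    move=> p1 p0 x /=; rewrite /cell; case: bb; rewrite /= !in_itv /= => /andP[x1 x2].
      by rewrite (le_trans p0 x1) (le_trans x2).
    by rewrite (le_trans p0 (ltW x1)) (le_trans x2).
  rewrite lebesgue_measure_itv /= lte_fin ltr_pt leqnn -EFinB pt_step.
  by rewrite EFinM.
have pick (v : nat -> R) i t : (i < N)%N -> pt m i < t <= pt m i.+1 ->
    (\sum_(j < N) (v j)%:E * (\1_(cell false j) t)%:E)%E = (v i)%:E.
  move=> iN it; have c1 : cell false i t by rewrite /cell /= in_itv /=.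
  rewrite (bigD1 (Ordinal iN))//= indicE (mem_set c1) mule1 big1 ?adde0//.
  move=> j ji; rewrite indicE memNset ?mule0// /cell /= in_itv /= => /andP[j1 j2].
  move/negP: ji; apply; apply/eqP/val_inj => /=; apply/eqP; rewrite eqn_leq.
  case/andP: it => i1 i2.
  rewrite -(ltnS j) -(ltnS i) -!(ltr_pt R m).
  by rewrite (lt_le_trans j1 i2) (lt_le_trans i1 j2).
have pick_le (v : nat -> R) i t : (forall j, (j < N)%N -> 0 <= v j) ->
    (i < N)%N -> pt m i <= t <= pt m i.+1 ->
    ((v i)%:E <= \sum_(j < N) (v j)%:E * (\1_(cell true j) t)%:E)%E.
  move=> v0 iN it; have c1 : cell true i t by rewrite /cell /= in_itv /=.
  rewrite (bigD1 (Ordinal iN))//= indicE (mem_set c1) mule1.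
  by rewrite leeDl// sume_ge0// => j _; rewrite mule_ge0// lee_fin v0.
have l1 : ((\sum_(i < N) lo i * h)%:E <=
   \int[lebesgue_measure]_(t in `[0%R, 1%R]) (c (left_value w t))%:E)%E.
  rewrite -(simple false); last by move=> i iN; rewrite /lo; case: ifP => // _; exact: ltW.
  apply: le_integral_any => t /=; rewrite in_itv /= => /andP[].
  rewrite le_eqVlt => /orP[/eqP <- _|t0 t1].
    rewrite big1 ?lee_fin ?ltW// => i _.
    by rewrite indicE memNset ?mule0// /cell /= in_itv/= ltNge pt_ge0.
  have [|i iN it] := @grid_cellP R m t; first by rewrite t0.
  rewrite (pick _ i)// lee_fin /lo; case: eqP => [e|_]; last by rewrite ltW.
  by have [->|->] := in_cells_left iN cw it; rewrite ?e.
have hi0 i : (i < N)%N -> 0 <= hi i.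
  move=> iN; rewrite /hi; case: ifP => _; rewrite ltW//.
  exact: lt_le_trans (c0 _) (cL _ (ltnW iN)).
have l2 : (\int[lebesgue_measure]_(t in `[0%R, 1%R]) (c (left_value w t))%:E <=
    (\sum_(i < N) hi i * h)%:E)%E.
  rewrite -(simple true)//.
  apply: le_integral_any => t /=; rewrite in_itv /= => /andP[].
  rewrite le_eqVlt => /orP[/eqP <- _|t0 t1].
    have N0 : (0 < N)%N by rewrite expn_gt0.
    apply: le_trans (pick_le _ 0%N _ hi0 N0 _); last by rewrite pt0 lexx pt_ge0.
    rewrite lee_fin w0 -(pt0 R m) /hi; case: ifP => // _.
    exact: cL.
  have [|i iN it] := @grid_cellP R m t; first by rewrite t0.
  apply: le_trans (pick_le _ i _ hi0 iN _); last by case/andP: it => /ltW -> ->.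
  rewrite lee_fin /hi; case: eqP => [e|_].
    by have [->|->] := in_cells_left iN cw it; rewrite ?e.
  by have [->|->] := in_cells_left iN cw it; apply: cL => //; exact: ltnW.
have SE : S = \sum_(i < N) lo i * h.
  by apply: eq_bigr => i _; rewrite /lo; case: ifP => // _; rewrite mul0r.
have hiE : \sum_(i < N) hi i * h = S + L * h * nb_jumps%:R.
  rewrite /nb_jumps natr_sum mulr_sumr -big_split /=; apply: eq_bigr => i _.
  by rewrite /hi; case: ifP => _; rewrite ?mulr0 ?addr0 ?add0r ?mulr1.
move: l1 l2; rewrite -SE hiE /I /Rintegral -/c.
by case: (integral _ _ _) => // v; rewrite !lee_fin.
Qed.

(** The product of the cell weights contains the same jump rates as M, with one
factor h for each jump, and the same exponential up to the time spent in the
cells with a jump. *)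
Lemma M_estimate :
  let W := \prod_(i < N) cell_weight a b (k i) (k i.+1) h in
  W * expR (- (L * h * nb_jumps%:R)) <= M a b w * h ^+ nb_jumps /\
  M a b w * h ^+ nb_jumps <= W.
Proof.
move=> W; have [I1 I2] := holding_integral.
have h0 : 0 < h by rewrite invr_gt0 pow2_gt0.
set S := \sum_(i < N) _ in I1 I2; set I := Rintegral _ _ _ in I1 I2.
set A := \prod_(i < N | k i.+1 == k i + 1) a (k i).
set B := \prod_(i < N | k i.+1 == k i - 1) b (k i).
have ME : M a b w = expR (- I) * A * B.
  by rewrite /M (fsbig_jumps _ a)// (fsbig_jumps _ b).
have A0 : 0 < A by apply: prodr_gt0.
have B0 : 0 < B by apply: prodr_gt0.
have WE : W = expR (- S) * A * B * h ^+ nb_jumps.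
  have -> : A = \prod_(i < N) (if k i.+1 == k i + 1 then a (k i) else 1).
    exact: big_mkcond.
  have -> : B = \prod_(i < N) (if k i.+1 == k i - 1 then b (k i) else 1).
    exact: big_mkcond.
  rewrite /S /nb_jumps -sumrN expR_sum -prodrXr -!big_split /=.
  apply: eq_bigr => i _; have := us (ltn_ord i).
  have n1 (x : int) : (x + 1 == x) = false.
    by rewrite -subr_eq0 addrAC subrr add0r.
  have n2 (x : int) : (x - 1 == x) = false.
    by rewrite -subr_eq0 addrAC subrr add0r.
  have n3 (x : int) : (x - 1 == x + 1) = false.
    by rewrite -subr_eq0 opprD addrACA subrr add0r.
  rewrite /cell_weight => -[] ->.
  - by rewrite eqxx ![k i == _]eq_sym n1 n2 /= expr0 !mulr1.
  - by rewrite n1 eqxx [k i + 1 == _]eq_sym n3 /= oppr0 expR0 mul1r !mulr1 expr1 rate_up.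
  - by rewrite n2 eqxx n3 /= oppr0 expR0 !mul1r expr1 rate_down.
have AB : 0 <= A * B * h ^+ nb_jumps by rewrite !mulr_ge0// ?ltW// exprn_ge0// ltW.
rewrite ME WE; split.
  have : expR (- (S + L * h * nb_jumps%:R)) <= expR (- I) by rewrite ler_expR lerN2.
  by rewrite opprD expRD => /(ler_wpM2r AB); lra.
have : expR (- I) <= expR (- S) by rewrite ler_expR lerN2.
by move=> /(ler_wpM2r AB); lra.
Qed.

End M.
End density_on_boxes.

(** * Box probabilities *)

Section jump_pair_boxes.
Variable R : realType.
Local Notation pt := (@pt R).
Implicit Types (U V : jump_pair R) (w : skorokhod R).

Definition npairs U : nat := #|` fset_set (ups U)|.

Lemma npairs_downs U : #|` fset_set (downs U)| = npairs U.
Proof.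
have [/= [fu fd] _ _ ud] := jump_pairP U.
by apply/esym/fcard_eq.
Qed.

Lemma ups_finite U : finite_set (ups U).
Proof. by have [[]] := jump_pairP U. Qed.

Lemma downs_finite U : finite_set (downs U).
Proof. by have [[]] := jump_pairP U. Qed.

Lemma ups_in U t : ups U t -> 0 < t < 1.
Proof. by have [_ [/= h _] _ _] := jump_pairP U; exact: h. Qed.

Lemma downs_in U t : downs U t -> 0 < t < 1.
Proof. by have [_ [/= _ h] _ _] := jump_pairP U; exact: h. Qed.

Lemma ups_downs U t : ups U t -> downs U t -> False.
Proof.
have [_ _ /= h _] := jump_pairP U => u d.
by have : (ups U `&` downs U) t by []; rewrite h.
Qed.

Lemma jump_path_bound U t : (`|jump_path U t| <= npairs U)%N.
Proof.
rewrite /= /jump_path_fun.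
have h (F : set R) : finite_set F -> (count_le F t <= #|` fset_set F|)%N.
  move=> fF; rewrite /count_le; apply: fsubset_leq_card.
  by rewrite -fset_set_sub//; exact: finite_setIl.
have := h _ (ups_finite U); have := h _ (downs_finite U).
rewrite npairs_downs -/(npairs U); lia.
Qed.

Lemma jump_path_left0 U : left_value (jump_path U) 0 = jump_path U 0.
Proof.
rewrite (@left_valueE _ _ 0 0) ?jump_path0//.
near=> s; apply: jump_path_fun_out; left.
by near: s; exact: nbhs_left_le.
Unshelve. all: by end_near. Qed.

Lemma jump_path_left1 U : left_value (jump_path U) 1 = jump_path U 1.
Proof.
have nu : ~ ups U 1 by move=> /ups_in; rewrite ltxx andbF.
have nd : ~ downs U 1 by move=> /downs_in; rewrite ltxx andbF.
by rewrite [RHS]jump_path_jump (asboolF nu) (asboolF nd) addr0 subr0.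
Qed.

Lemma jump_path_step U m i : (i < 2 ^ m)%N -> in_cells (jump_path U) m ->
  unit_step (jump_path U (pt m i)) (jump_path U (pt m i.+1)).
Proof.
move=> im cw; have [u _ [lu ru _]] := single_jumpP (cw i im).
rewrite -ru [X in unit_step _ X]jump_path_jump lu.
case: asboolP => up; case: asboolP => down; rewrite ?addr0 ?subr0.
- by case: (ups_downs up down).
- by apply: Or32.
- by apply: Or33.
- by apply: Or31.
Qed.

Lemma npairs_steps U m (e : int) (F : set R) : in_cells (jump_path U) m -> e != 0 ->
  jump_times e (jump_path U) = F -> finite_set F ->
  #|` fset_set F| =
  (\sum_(i < 2 ^ m | jump_path U (pt m i.+1) == (jump_path U (pt m i) + e)%R) 1)%N.
Proof.
move=> cw e0 <- fF.
have := @fsbig_jumps R _ m cw (jump_path_left1 U) _ 0%N addn e (fun=> 1%N) e0.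
by rewrite fsbig_finite//= => <-; rewrite big_const_seq count_predT iter_addn_0 mul1n.
Qed.

Lemma nb_jumps_npairs U m : in_cells (jump_path U) m ->
  nb_jumps (jump_path U) m = (npairs U).*2.
Proof.
move=> cw; rewrite -addnn.
rewrite -[X in (_ + X)%N]npairs_downs [in RHS]/npairs.
rewrite (npairs_steps cw _ (jump_times_up U) (ups_finite U))//.
rewrite (npairs_steps cw _ (jump_times_down U) (downs_finite U))//.
rewrite [X in (X + _)%N]big_mkcond [X in (_ + X)%N]big_mkcond /= -big_split /=.
apply: eq_bigr => i _; have := jump_path_step (ltn_ord i) cw.
rewrite /=; move: (jump_path_fun U _) (jump_path_fun U _) => j k.
move=> kj; case: (j =P k) => e1; case: (j =P k + 1) => e2;
  case: (j =P k - 1) => e3; case: kj => e4 //=; lia.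
Qed.

End jump_pair_boxes.

Section key_estimate.
Variable R : realType.
Variables a b : int -> R.
Hypothesis a0 : forall j, 0 < a j.
Hypothesis b0 : forall j, 0 < b j.
Variable P : probability (skorokhod R) R.
Hypothesis PG : has_generator a b P.
Local Notation pt := (@pt R).
Local Notation p A := (fine (P A)).

Lemma rates_bounded_exists n : exists2 L : R, 1 <= L &
  forall k : int, (`|k| <= n)%N -> rates_bounded a b L k.
Proof.
(* one bound for the finitely many states in [-n, n] *)
pose f (k : int) : R := gen_bound a b k + (a k)^-1 + (b k)^-1.
have f0 k : 0 < f k.
  by rewrite !addr_gt0 ?invr_gt0// K_gt0.
exists (1 + \sum_(i < n.+1) (f i%:Z + f (- i%:Z))).
  by rewrite lerDl sumr_ge0// => i _; rewrite addr_ge0// ltW.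
move=> k kn.
have fL : f k <= 1 + \sum_(i < n.+1) (f i%:Z + f (- i%:Z)).
  have kn' : (`|k| < n.+1)%N by [].
  rewrite (bigD1 (Ordinal kn'))//= addrCA -[X in X <= _]addr0 lerD//.
    have := f0 `|k|%N; have := f0 (- `|k|%N%:Z).
    by case: (ltP 0 k) => [k0|k0]; [rewrite gtz0_abs//|rewrite lez0_abs// opprK]; lra.
  by rewrite addr_ge0// sumr_ge0// => i _; rewrite addr_ge0// ltW.
have := K_gt0 a0 b0 k; have : 0 < (a k)^-1 by rewrite invr_gt0.
have : 0 < (b k)^-1 by rewrite invr_gt0.
by split; apply: le_trans fL; rewrite /f; lra.
Qed.

Definition box (m : nat) (U : jump_pair R) : set (skorokhod R) :=
  box_upto m (2 ^ m) (fun i => jump_path U (pt m i)).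

(** A path with n pairs of jumps stays in [-n, n], where the rates are bounded
above and below, and has 2 n jumps: hence a constant that depends on U through
n only. *)
Lemma key_estimate n : exists C : R, exists m0 : nat, forall m, (m0 <= m)%N ->
  forall U, npairs U = n -> in_cells (jump_path U) m ->
  p [set w | w 0 = 0] * (M a b (jump_path U) * (2 ^+ m)^-1 ^+ n.*2) * expR (- (C / 2 ^+ m))
  <= p (box m U) <=
  p [set w | w 0 = 0] * (M a b (jump_path U) * (2 ^+ m)^-1 ^+ n.*2) * expR (C / 2 ^+ m).
Proof.
have [L L1 HL] := rates_bounded_exists n.
have [m0 _ Hm0] : \forall m \near \oo, 8 * L ^+ 3 <= 2 ^+ m.
  have X0 : 0 < 8 * L ^+ 3 by rewrite mulr_gt0// exprn_gt0//; lra.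
  move: X0; set X := 8 * L ^+ 3 => X0.
  have e0 : 0 < X^-1 by rewrite invr_gt0.
  have := near_pow2 e0; apply: filterS => m /ltW.
  by rewrite -[X in X <= _]div1r ler_pdivrMr ?pow2_gt0// mulrC ler_pdivlMr// mul1r.
(* cells without jump, cells with a jump, and the time spent in the latter *)
exists (20 * L ^+ 2 + 8 * L ^+ 3 * n.*2%:R + L * n.*2%:R), m0 => m mm U Un cw.
have h0 : 0 < (2 ^+ m)^-1 :> R by rewrite invr_gt0 pow2_gt0.
have Lm : 8 * L ^+ 3 <= 2 ^+ m by exact: Hm0.
have kL i : (i <= 2 ^ m)%N -> rates_bounded a b L (jump_path U (pt m i)).
  by move=> _; apply: HL; rewrite -Un; exact: jump_path_bound.
have us i : (i < 2 ^ m)%N ->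
    unit_step (jump_path U (pt m i)) (jump_path U (pt m i.+1)).
  by move=> im; exact: jump_path_step.
have [M1 M2] := M_estimate a0 b0 cw (jump_path_left1 U) (jump_path_left0 U) us kL.
have /andP[p1 p2] := box_estimate a0 b0 PG (leqnn _) L1 Lm kL us.
rewrite nb_jumps_npairs// Un in M1 M2.
move: p1 p2 M1 M2; rewrite pt0 jump_path0 -/(box m U).
set W := \prod_(i < _) _; set E := \sum_(i < _) _; set q := p [set w | w 0 = 0].
have L0 : 0 <= L by lra.
have EC : E + L * (2 ^+ m)^-1 * n.*2%:R <=
    (20 * L ^+ 2 + 8 * L ^+ 3 * n.*2%:R + L * n.*2%:R) / 2 ^+ m.
  have E1 : E <= 20 * L ^+ 2 / 2 ^+ m + 8 * L ^+ 3 / 2 ^+ m * n.*2%:R.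
    rewrite -Un -(nb_jumps_npairs cw) /nb_jumps natr_sum mulr_sumr.
    have -> : 20 * L ^+ 2 / 2 ^+ m = \sum_(i < 2 ^ m) 20 * L ^+ 2 / 2 ^+ m / 2 ^+ m.
      by rewrite sumr_const card_ord -[RHS]mulr_natr natrX divfK // lt0r_neq0 // pow2_gt0.
    rewrite -big_split /=; apply: ler_sum => i _.
    rewrite /cell_error; case: eqP => _ /=.
      by rewrite mulr0n exprVn; lra.
    by rewrite mulr1n mulr1 lerDr; nneg.
  by lra.
have E0 : 0 <= E.
  apply: sumr_ge0 => i _; rewrite /cell_error; case: ifP => _.
    by nneg.
  by nneg.
set C := 20 * L ^+ 2 + 8 * L ^+ 3 * n.*2%:R + L * n.*2%:R in EC *.
set h := (2 ^+ m)^-1 in h0 EC *; set X := M a b _ * _.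
move=> p1 p2 M1 M2.
have q0 : 0 <= q by exact: p_ge0.
have W0 : 0 <= W.
  by apply: prodr_ge0 => i _; rewrite ltW// cell_weight_gt0//; exact: us.
have X0 : 0 <= X.
  by apply: le_trans M1; rewrite mulr_ge0// expR_ge0.
have LhJ : 0 <= L * h * n.*2%:R by rewrite !mulr_ge0 ?(ltW h0)//; lra.
apply/andP; split.
  apply: le_trans p1; rewrite -mulrA ler_wpM2l//.
  apply: ler_pM; rewrite ?expR_ge0// ler_expR lerN2; lra.
apply: (le_trans p2); rewrite -[leRHS]mulrA ler_wpM2l//.
have -> : C * h = L * h * n.*2%:R + (C * h - L * h * n.*2%:R) by lra.
rewrite expRD mulrA; apply: ler_pM; rewrite ?expR_ge0//; last first.
  rewrite ler_expR; lra.
apply: le_trans (ler_wpM2r (expR_ge0 (L * h * n.*2%:R)) M1).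
by rewrite -[leRHS]mulrA -expRD addNr expR0 mulr1.
Qed.

End key_estimate.

(** * The range of the path map *)

Lemma countable_bigcup_measurable d (T : measurableType d) (I : countType)
    (D : set I) (F : I -> set T) :
  (forall i, D i -> measurable (F i)) -> measurable (\bigcup_(i in D) F i).
Proof.
move=> mF; pose G n := if @choice.unpickle I n is Some i then
  (if i \in D then F i else set0) else set0.
rewrite (_ : \bigcup_(i in D) F i = \bigcup_n G n).
  apply: bigcupT_measurable => n; rewrite /G; case: choice.unpickle => // i.
  by case: ifPn => //; rewrite inE; exact: mF.
apply/seteqP; split=> [x [i Di Fi]|x [n _]].
  by exists (choice.pickle i) => //; rewrite /G choice.pickleK mem_set.
by rewrite /G; case: choice.unpickle => // i; case: ifPn => //; rewrite inE => Di Fi; exists i.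
Qed.

Lemma countable_bigcup_null d (T : measurableType d) (R : realType)
    (mu : {measure set T -> \bar R}) (I : countType) (D : set I) (F : I -> set T) :
  (forall i, D i -> measurable (F i)) -> (forall i, D i -> mu (F i) = 0%E) ->
  mu (\bigcup_(i in D) F i) = 0%E.
Proof.
move=> mF F0; pose G n := if @choice.unpickle I n is Some i then
  (if i \in D then F i else set0) else set0.
have mG n : measurable (G n).
  rewrite /G; case: choice.unpickle => // i.
  by case: ifPn => //; rewrite inE; exact: mF.
rewrite (_ : \bigcup_(i in D) F i = \bigcup_n G n).
  have mUG : measurable (\bigcup_n G n) by exact: bigcupT_measurable.
  apply/(negligibleP mu mUG)/negligible_bigcup => n; apply/(negligibleP mu (mG n)).
  rewrite /G; case: choice.unpickle => [i|]; last exact: measure0.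
  by case: ifPn => [|_]; [rewrite inE; exact: F0|exact: measure0].
apply/seteqP; split=> [x [i Di Fi]|x [n _]].
  by exists (choice.pickle i) => //; rewrite /G choice.pickleK mem_set.
by rewrite /G; case: choice.unpickle => // i; case: ifPn => //; rewrite inE => Di Fi; exists i.
Qed.

Section range_of_jump_path.
Variable R : realType.
Local Notation T := (skorokhod R).
Local Notation pt := (@pt R).
Implicit Types (w : T).

Lemma measurable_coord2 (r s : R) (Q : int -> int -> Prop) :
  0 <= r <= 1 -> 0 <= s <= 1 -> measurable [set w : T | Q (w r) (w s)].
Proof.
move=> r01 s01.
rewrite (_ : [set _ | _] = \bigcup_(kj in [set kj : int * int | Q kj.1 kj.2])
   ([set w : T | w r = kj.1] `&` [set w : T | w s = kj.2])).
  apply: countable_bigcup_measurable => -[k j] _ /=.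
  by apply: measurableI; exact: measurable_coord.
by apply/seteqP; split=> [w Qw|w [[k j] /= Q' [-> ->]]//]; exists (w r, w s).
Qed.

(** The range of [jump_path] in terms of countably many coordinates. The
condition on the last cell excludes a jump at time 1. *)
Definition unit_range : set T := [set w | pinned R w /\
  exists m0, forall m, (m0 <= m)%N ->
    (forall i, (i < 2 ^ m)%N -> unit_step (w (pt m i)) (w (pt m i.+1))) /\
    w (pt m (2 ^ m).-1) = w 1].

Lemma measurable_pinned : measurable (pinned R).
Proof.
apply: measurableI; first by apply: (@measurable_coord R 0 0); rewrite lexx ler01.
by apply: (@measurable_coord R 1 0); rewrite lexx ler01.
Qed.

Lemma pt_01 m i : (i <= 2 ^ m)%N -> 0 <= pt m i <= 1.
Proof. by move=> im; rewrite pt_ge0 pt_le1. Qed.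

Lemma measurable_unit_range : measurable unit_range.
Proof.
rewrite (_ : unit_range = pinned R `&` \bigcup_m0 \bigcap_(m in [set m | (m0 <= m)%N])
  ((\bigcap_(i in `I_(2 ^ m)) [set w : T | unit_step (w (pt m i)) (w (pt m i.+1))])
   `&` [set w : T | w (pt m (2 ^ m).-1) = w 1])).
  apply: measurableI; first exact: measurable_pinned.
  apply: bigcupT_measurable => m0; apply: bigcap_measurable; first by exists m0 => /=.
  move=> m _; apply: measurableI.
    apply: fin_bigcap_measurable => // i im.
    by apply: (@measurable_coord2 _ _ unit_step); apply: pt_01 => //; exact: ltnW.
  apply: (@measurable_coord2 _ _ eq); last by rewrite ler01 lexx.
  by apply: pt_01; exact: leq_pred.
apply/seteqP; split=> [w [pw [m0 h]]|w [pw [m0 _ h]]].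
  split=> //; exists m0 => // m mm; have [h1 h2] := h m mm; split=> // i im; exact: h1.
split=> //; exists m0 => // m mm; have [h1 h2] := h m mm; split=> // i im; exact: h1.
Qed.

Lemma pt_pred m : pt m (2 ^ m).-1 = 1 - (2 ^+ m)^-1.
Proof.
have : pt m (2 ^ m).-1.+1 = 1 by rewrite prednK ?expn_gt0// pt1.
by rewrite ptS => e; lra.
Qed.

Lemma left_value_near w (t : R) : 0 < t <= 1 ->
  exists2 d, 0 < d & forall y, t - d < y < t -> w y = left_value w t.
Proof.
move=> /andP[t0 t1].
have [d [k [d0 hl hr]]] := cadlag_local (path_cadlag w) (introT andP (conj (ltW t0) t1)).
exists d => // y yt; rewrite hl// (@left_value_cst R w (t - d) t k)//; lra.
Qed.

Lemma range_unit_range : range (@jump_path R) `<=` unit_range.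
Proof.
move=> _ [U _ <-]; split; first by split; [exact: jump_path0|exact: jump_path1].
have [m1 _ h1] := cadlag_single_jumps (path_cadlag (jump_path U)).
have [|d d0 hd] := @left_value_near (jump_path U) 1; first by rewrite ltr01 lexx.
have [m2 _ h2] := near_pow2 d0.
exists (maxn m1 m2) => m; rewrite geq_max => /andP[mm1 mm2].
split; first by move=> i im; apply: jump_path_step => // ; exact: h1.
rewrite pt_pred hd ?jump_path_left1//.
have := h2 m mm2; have : 0 < (2 ^+ m)^-1 :> R by rewrite invr_gt0 pow2_gt0.
by move=> *; apply/andP; split; lra.
Qed.

Lemma unit_range_jumps w : unit_range w ->
  [/\ left_value w 1 = w 1, forall t, 0 < t < 1 -> unit_step (left_value w t) (w t)
    & exists m, in_cells w m].
Proof.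
move=> [_ [m0 h]].
have [m1 _ h1] := cadlag_single_jumps (path_cadlag w).
pose m := maxn m0 m1; have cw : in_cells w m by exact: h1 (leq_maxr _ _).
have [us w1] := h m (leq_maxl _ _).
split; last by exists m.
- have N0 : (0 < 2 ^ m)%N by rewrite expn_gt0.
  have im : ((2 ^ m).-1 < 2 ^ m)%N by rewrite prednK.
  have [u _ [lu ru hu]] := single_jumpP (cw _ im).
  rewrite prednK// in ru hu.
  have [e|/hu[]] := eqVneq 1 u; last by [].
    by rewrite e lu -e w1.
  by rewrite -(pt1 R m) lexx ltr_pt im.
- move=> t /andP[t0 t1].
  have [|i im it] := @grid_cellP R m t; first by rewrite t0 ltW.
  have [u _ [lu ru hu]] := single_jumpP (cw _ im).
  have [->|/(hu t it)[-> _]] := eqVneq t u; last by apply: Or31.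
  by rewrite lu ru; exact: us.
Qed.

(** Connectedness of the line, in the form of a vanishing derivative. *)
Lemma locally_cst_cst (D : R -> R) :
  (forall x, \forall y \near x, D y = D x) -> forall x y, D x = D y.
Proof.
move=> h x y; apply: is_derive_0_is_cst => z.
have := is_derive_cst (D z) z (1 : R).
by apply: near_eq_is_derive; apply: filterS (h z) => v ->.
Qed.

(** The difference between w and the path rebuilt from its jump times does not
jump, so it is locally constant, and it vanishes at 0. *)
Lemma unit_range_range : unit_range `<=` range (@jump_path R).
Proof.
move=> w rw; have [w1 us [m cw]] := unit_range_jumps rw.
have [[w00 w10] _] := rw.
pose F := jump_times 1 w; pose G := jump_times (-1) w.
have fF : finite_set F.
  have [f [_ _ sur] _] := jump_times_bij cw w1 (isT : (1 : int) != 0).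
  by apply: sub_finite_set sur _; apply: finite_image; exact: finite_setIl.
have fG : finite_set G.
  have [f [_ _ sur] _] := jump_times_bij cw w1 (isT : (-1 : int) != 0).
  by apply: sub_finite_set sur _; apply: finite_image; exact: finite_setIl.
(* the path with up-jumps F and down-jumps G *)
pose g (t : R) : int := (count_le F t)%:Z - (count_le G t)%:Z.
have FG0 : F `&` G = set0.
  apply/seteqP; split => // t [[_ wt] [_ ]]; rewrite wt => /addrI.
  by [].
have [wr wl wn wp] := path_cadlag w.
have F1 t : F t -> 0 < t < 1 by case.
have G1 t : G t -> 0 < t < 1 by case.
have jump t : w t = left_value w t + (`[< F t >] : nat)%:Z - (`[< G t >] : nat)%:Z.
  have out : ~ (0 < t < 1) -> `[< F t >] = false /\ `[< G t >] = false.
    by move=> nt; split; apply/negbTE/asboolPn => /= -[].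
  have [t0|t0] := leP t 0.
    have [-> ->] : `[< F t >] = false /\ `[< G t >] = false.
      by apply: out => /andP[]; rewrite ltNge t0.
    rewrite addr0 subr0; apply/esym/left_valueE; near=> s.
    have st : s < t by near: s; exact: nbhs_left_lt.
    rewrite (wn s); last exact: lt_le_trans st t0.
    by move: t0; rewrite le_eqVlt => /orP[/eqP->|/wn].
  have [t1|t1] := ltP 1 t.
    have [-> ->] : `[< F t >] = false /\ `[< G t >] = false.
      by apply: out => /andP[_]; rewrite ltNge ltW.
    rewrite addr0 subr0; apply/esym/left_valueE; near=> s.
    by rewrite (wp s) ?(wp t)//; near: s; exact: nbhs_left_gt.
  move: t1; rewrite le_eqVlt => /orP[/eqP->|t1].
    have [-> ->] : `[< F 1 >] = false /\ `[< G 1 >] = false.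
      by split; apply/negbTE/asboolPn => -[]; rewrite ltxx andbF.
    by rewrite addr0 subr0.
  have t01 : 0 < t < 1 by rewrite t0.
  have FE : F t <-> w t = left_value w t + 1 by split=> [[]//|]; split.
  have GE : G t <-> w t = left_value w t - 1 by split=> [[]//|]; split.
  have nz (x y : int) : y != 0 -> x <> x + y.
    by move=> y0 /eqP; rewrite eq_sym -subr_eq0 addrAC subrr add0r (negbTE y0).
  have [e|e|e] := us t t01.
  - rewrite !asboolF ?addr0 ?subr0//; first by rewrite GE e; exact: nz.
    by rewrite FE e; exact: nz.
  - rewrite asboolT; last exact/FE.
    by rewrite asboolF ?subr0// GE e => /addrI.
  - rewrite (asboolT (GE.2 e)).
    by rewrite asboolF ?addr0// FE e => /addrI.
have D0 x : \forall y \near x, ((w y - g y)%:~R : R) = (w x - g x)%:~R.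
  have left : \forall y \near x^'-, w y - g y = w x - g x.
    have lw : \forall y \near x^'-, w y = left_value w x.
      have [x0|x0] := leP x 0.
        rewrite (left_valueE (_ : \forall s \near x^'-, w s = w 0)).
          by near=> s; apply: wn; apply: lt_le_trans x0; near: s; exact: nbhs_left_lt.
        by near=> s; apply: wn; apply: lt_le_trans x0; near: s; exact: nbhs_left_lt.
      have [x1|x1] := ltP 1 x.
        rewrite (left_valueE (_ : \forall s \near x^'-, w s = w 1)).
          by near=> s; apply: wp; near: s; exact: nbhs_left_gt.
        by near=> s; apply: wp; near: s; exact: nbhs_left_gt.
      have /wl[k wk] : 0 < x <= 1 by rewrite x0.
      by rewrite (left_valueE wk).
    apply: filterS3 lw (count_le_left x fF) (count_le_left x fG) => y yl yF yG.
    rewrite /g yF yG yl !count_leS// [w x]jump !PoszD; lia.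
  have right : \forall y \near x^'+, w y - g y = w x - g x.
    have rw' : \forall y \near x^'+, w y = w x.
      have [x0|x0] := ltP x 0.
        rewrite (wn x x0); near=> s; apply: wn.
        by near: s; exact: nbhs_right_lt.
      have [x1|x1] := leP 1 x.
        have -> : w x = w 1 by move: x1; rewrite le_eqVlt => /orP[/eqP->//|/wp].
        by near=> s; apply: wp; apply: le_lt_trans x1 _; near: s; exact: nbhs_right_gt.
      by apply: wr; rewrite x0.
    apply: filterS3 rw' (count_le_right x fF) (count_le_right x fG) => y yl yF yG.
    by rewrite /g yF yG yl.
  have [d1 d10 h1] := nbhs_leftP left.
  have [d2 d20 h2] := nbhs_rightP right.
  apply/nbhs_ballP; exists (Num.min d1 d2); first by rewrite /= lt_min d10.
  move=> y; rewrite /ball /= lt_min => /andP[y1 y2]; congr (_%:~R).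
  have [yx|xy|->//] := ltgtP y x.
    by apply: h1; rewrite yx andbT; move: y1; rewrite ltr_norml => /andP[]; lra.
  by apply: h2; rewrite xy /=; move: y2; rewrite ltr_norml => /andP[]; lra.
have empty (H : set R) : (forall t, H t -> 0 < t < 1) -> count_le H 0 = 0%N.
  move=> HI; rewrite /count_le (_ : _ `&` _ = set0) ?fset_set0 ?cardfs0//.
  by apply/seteqP; split => // t [/HI /andP[t0 _]] /=; rewrite leNgt t0.
have full (H : set R) : (forall t, H t -> 0 < t < 1) -> count_le H 1 = #|` fset_set H|.
  move=> HI; rewrite /count_le (_ : _ `&` _ = H)//.
  by apply/seteqP; split => [t []//|t Ht]; split=> //=; case/andP: (HI _ Ht) => _ /ltW.
have wg t : w t = g t.
  have g0 : g 0 = 0 by rewrite /g !empty.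
  have := locally_cst_cst D0 t 0; rewrite w00 g0 subr0.
  by move=> /intr_inj /eqP; rewrite subr_eq0 => /eqP.
have FG : #|` fset_set F| = #|` fset_set G|.
  have := wg 1; rewrite w10 /g !full// => /esym/eqP; rewrite subr_eq0.
  by move=> /eqP[].
have pU : is_jump_pair (F, G).
  split; [by []|by split => t []|exact: FG0|].
  have /finite_setP[n Fn] := fF; have /finite_setP[n' Gn] := fG.
  apply: (card_eq_trans Fn); rewrite card_eq_sym; apply: (card_eq_trans Gn).
  by rewrite -(card_fset_set Fn) FG (card_fset_set Gn).
exists (exist _ (F, G) (asboolT pU)) => //.
apply: skorokhod_eq => t; rewrite wg.
by [].
Unshelve. all: by end_near. Qed.

End range_of_jump_path.

(** * Pinned paths almost surely come from jump pairs *)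

Section null_complement.
Variable R : realType.
Variables a b : int -> R.
Hypothesis a0 : forall j, 0 < a j.
Hypothesis b0 : forall j, 0 < b j.
Variable P : probability (skorokhod R) R.
Hypothesis PG : has_generator a b P.
Local Notation T := (skorokhod R).
Local Notation pt := (@pt R).
Local Notation p A := (fine (P A)).
Local Notation K := (gen_bound a b).

Lemma p_le1 (A : set T) : measurable A -> p A <= 1.
Proof. by move=> mA; rewrite -lee_fin fineK ?fin_num_measure// probability_le1. Qed.

Lemma p_union (A B : set T) : measurable A -> measurable B ->
  p (A `|` B) <= p A + p B.
Proof.
move=> mA mB; have mnA := measurableC mA.
have -> : A `|` B = A `|` (B `&` ~` A).
  rewrite setUIr setUv setIT//.
rewrite p_add//; last 2 first.
- exact: measurableI.
- by rewrite setICA setICr setI0.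
by rewrite lerD2l p_le//; exact: measurableI.
Qed.

Lemma squeeze0 (x C : R) m0 : 0 <= x ->
  (forall m, (m0 <= m)%N -> x <= C / 2 ^+ m) -> x = 0.
Proof.
move=> x0 h; apply/eqP; rewrite eq_le x0 andbT leNgt; apply/negP => x1.
have C0 : 0 < C.
  by have := lt_le_trans x1 (h m0 (leqnn _)); rewrite pmulr_lgt0// invr_gt0 pow2_gt0.
have [m1 _ hm] := near_pow2 (divr_gt0 x1 C0).
have := hm (maxn m0 m1) (leq_maxr _ _).
have := h (maxn m0 m1) (leq_maxl _ _).
rewrite ltr_pdivlMr// mulrC => h1 h2.
by have := le_lt_trans h1 h2; rewrite ltxx.
Qed.

Definition crossing m (k j : int) : set T :=
  [set w | exists2 i, (i < 2 ^ m)%N & w (pt m i) = k /\ w (pt m i.+1) = j].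

Definition last_crossing m (k j : int) : set T :=
  [set w | w (pt m (2 ^ m).-1) = k /\ w 1 = j].

Lemma measurable_cross m i (k j : int) : (i < 2 ^ m)%N ->
  measurable ([set w : T | w (pt m i) = k] `&` [set w : T | w (pt m i.+1) = j]).
Proof.
by move=> im; apply: measurableI; apply: measurable_coord; rewrite pt_ge0 pt_le1// ltnW.
Qed.

Lemma crossing_bound m i (k j : int) : (i < 2 ^ m)%N -> k != j ->
  p ([set w : T | w (pt m i) = k] `&` [set w : T | w (pt m i.+1) = j]) <=
  (rate a b k j + 2 * K j * K k / 2 ^+ m) / 2 ^+ m.
Proof.
move=> im kj.
have hA : history (pt m i) [set w : T | w (pt m i) = k].
  by apply: history_coord; rewrite pt_ge0 lexx.
have /ler_normlP[_] := transition_bound a0 b0 PG j im hA (@subset_refl _ _).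
rewrite (negbTE kj) mulr0n -/(rate a b k j) add0r.
set h := (2 ^+ m)^-1; set A := [set w | _].
have h0 : 0 < h by rewrite invr_gt0 pow2_gt0.
have mA : measurable A by apply: measurable_coord; rewrite pt_ge0 pt_le1// ltnW.
have A1 := p_le1 mA; have A0 := p_ge0 P A.
rewrite lerBlDr -mulrDl => H; apply: (le_trans H).
have r0 : 0 <= rate a b k j * h + 2 * K j * K k * h * h.
  have := K_gt0 a0 b0 j; have := K_gt0 a0 b0 k => Kk Kj.
  rewrite addr_ge0//; last by nneg.
  rewrite mulr_ge0 ?(ltW h0)// /rate gen_indic (negbTE kj) mul0r subr0.
  by rewrite addr_ge0// mulr_ge0// ltW.
have : (2 * K j * K k * h * h + rate a b k j * h) * p A <=
   (2 * K j * K k * h * h + rate a b k j * h) * 1.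
  by rewrite ler_wpM2l// addrC.
lra.
Qed.

Lemma measurable_crossing m k j : measurable (crossing m k j).
Proof.
rewrite (_ : crossing m k j = \bigcup_(i in `I_(2 ^ m))
  ([set w : T | w (pt m i) = k] `&` [set w : T | w (pt m i.+1) = j])).
  by apply: countable_bigcup_measurable => i im; exact: measurable_cross.
by apply/seteqP; split=> w [i im h]; exists i.
Qed.

Lemma measurable_last_crossing m k j : measurable (last_crossing m k j).
Proof.
by apply: measurableI; apply: measurable_coord; rewrite ?pt_ge0 ?pt_le1 ?leq_pred ?ler01 ?lexx.
Qed.

(** A step of size other than 0, 1 and -1 has rate 0, so that each of the 2^m
cells contributes at order 4^-m only. *)
Lemma crossing_rate m k j : ~ unit_step k j ->
  p (crossing m k j) <= 2 * K j * K k / 2 ^+ m.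
Proof.
move=> nu.
have kj : k != j by apply/eqP => e; apply: nu; apply: Or31.
have r0 : rate a b k j = 0.
  rewrite /rate gen_indic (negbTE kj).
  have -> : k == j - 1 = false.
    by apply/negbTE/eqP => e; apply: nu; apply: Or32; rewrite e subrK.
  have -> : k == j + 1 = false.
    by apply/negbTE/eqP => e; apply: nu; apply: Or33; rewrite e addrK.
  by rewrite !mul0r addr0 subr0.
suff H n : (n <= 2 ^ m)%N -> p [set w : T | exists2 i, (i < n)%N &
    w (pt m i) = k /\ w (pt m i.+1) = j] <= n%:R * (2 * K j * K k / 2 ^+ m / 2 ^+ m)
    /\ measurable [set w : T | exists2 i, (i < n)%N &
    w (pt m i) = k /\ w (pt m i.+1) = j].
  have [+ _] := H _ (leqnn _); by rewrite natrX mulrC divfK ?lt0r_neq0 ?pow2_gt0.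
elim: n => [|n ih] nm.
  rewrite (_ : [set w | _] = set0); last by apply/seteqP; split => // w [].
  by rewrite measure0 mul0r.
have [h1 h2] := ih (ltnW nm).
rewrite (_ : [set w | _] = [set w : T | exists2 i, (i < n)%N &
    w (pt m i) = k /\ w (pt m i.+1) = j] `|`
    ([set w : T | w (pt m n) = k] `&` [set w : T | w (pt m n.+1) = j])); last first.
  apply/seteqP; split=> [w [i]|w [[i im h]|h]].
  - rewrite ltnS leq_eqVlt => /orP[/eqP->|im h]; first by right.
    by left; exists i.
  - by exists i => //; exact: leqW.
  - by exists n.
have mc := @measurable_cross m n k j nm.
split; last exact: measurableU.
apply: le_trans (p_union h2 mc) _; rewrite -natr1 mulrDl mul1r lerD//.
by have := crossing_bound nm kj; rewrite r0 add0r.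
Qed.

(** A pinned path outside the range either makes a jump of size at least 2 or
jumps at time 1. In both cases there is a pair of states between which it crosses
a cell (the last one in the second case) at all fine levels, and the probability
of this is of order 2^-m. *)
Lemma pinned_null : P (pinned R `\` @unit_range R) = 0%E.
Proof.
(* B1 sees a jump that is not a unit step, B2 a jump at time 1 *)
pose B1 (x : int * int * nat) := \bigcap_(m in [set m | (x.2 <= m)%N]) crossing m x.1.1 x.1.2.
pose B2 (x : int * int * nat) := \bigcap_(m in [set m | (x.2 <= m)%N]) last_crossing m x.1.1 x.1.2.
pose D1 := [set x : int * int * nat | ~ unit_step x.1.1 x.1.2].
pose D2 := [set x : int * int * nat | x.1.1 != x.1.2].
have mB1 x : measurable (B1 x).
  by apply: bigcap_measurable => [|m _]; [exists x.2 => /=|exact: measurable_crossing].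
have mB2 x : measurable (B2 x).
  by apply: bigcap_measurable => [|m _]; [exists x.2 => /=|exact: measurable_last_crossing].
have n1 : P (\bigcup_(x in D1) B1 x) = 0%E.
  apply: countable_bigcup_null => // -[[k j] m0] /= nu.
  rewrite -[P _]fineK ?fin_num_measure//; congr EFin.
  apply: (@squeeze0 _ (2 * K j * K k) m0); first exact: p_ge0.
  move=> m mm; apply: le_trans (crossing_rate m nu); apply: p_le => //.
    exact: measurable_crossing.
  by move=> w; exact.
have n2 : P (\bigcup_(x in D2) B2 x) = 0%E.
  apply: countable_bigcup_null => // -[[k j] m0] /= kj.
  rewrite -[P _]fineK ?fin_num_measure//; congr EFin.
  apply: (@squeeze0 _ (rate a b k j + 2 * K j * K k) m0); first exact: p_ge0.
  move=> m mm.
  have N0 : (0 < 2 ^ m)%N by rewrite expn_gt0.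
  have im : ((2 ^ m).-1 < 2 ^ m)%N by rewrite prednK.
  have := crossing_bound im kj; rewrite prednK// pt1 => H.
  apply: le_trans (le_trans H _).
    apply: p_le => //; first by have := @measurable_last_crossing m k j.
    by move=> w; apply.
  rewrite ler_wpM2r ?invr_ge0 ?(ltW (pow2_gt0 _ _))// lerD2l.
  have := K_gt0 a0 b0 j; have := K_gt0 a0 b0 k => Kk Kj.
  rewrite ler_pdivrMr ?pow2_gt0// ler_peMr//; first by nneg.
  by rewrite exprn_ege1// ler1n.
have mpr : measurable (pinned R `\` @unit_range R).
  by apply: measurableD; [exact: measurable_pinned|exact: measurable_unit_range].
have mU1 : measurable (\bigcup_(x in D1) B1 x) by exact: countable_bigcup_measurable.
have mU2 : measurable (\bigcup_(x in D2) B2 x) by exact: countable_bigcup_measurable.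
suff sub : pinned R `\` @unit_range R `<=` (\bigcup_(x in D1) B1 x) `|` (\bigcup_(x in D2) B2 x).
  have mU := measurableU _ _ mU1 mU2.
  suff U0 : P (\bigcup_(x in D1) B1 x `|` \bigcup_(x in D2) B2 x) = 0%E.
    exact: (subset_measure0 mpr mU sub U0).
  rewrite (pE P mU); congr EFin; apply/eqP; rewrite eq_le p_ge0 andbT; apply: le_trans (p_union mU1 mU2) _.
  by rewrite n1 n2 /= addr0.
move=> w [pw nr].
have [[t [t01 nu]]|] := pselect (exists t, 0 < t <= 1 /\ ~ unit_step (left_value w t) (w t)).
  left.
  have [/andP[t0 t1] t01'] : 0 < t <= 1 /\ 0 <= t <= 1.
    by case/andP: (t01) => t0 t1; rewrite t0 t1 ltW.
  have [d1 d10 h1] := left_value_near w t01.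
  have [d2 [k2 [d20 _ h2]]] := cadlag_local (path_cadlag w) t01'.
  have [m1 _ hm1] := near_pow2 d10; have [m2 _ hm2] := near_pow2 d20.
  exists (left_value w t, w t, maxn m1 m2) => //= m /=; rewrite geq_max => /andP[mm1 mm2].
  have [i im /andP[i1 i2]] := grid_cellP m t01.
  have := hm1 _ mm1; have := hm2 _ mm2 => g2 g1; rewrite ptS in i2.
  exists i => //; split; first by apply: h1; apply/andP; split; lra.
  by rewrite ptS; apply: h2; apply/andP; split; lra.
move=> /forallNP us; right.
have {}us t : 0 < t <= 1 -> unit_step (left_value w t) (w t).
  by move=> t01; apply: contrapT => nu; apply: (us t).
have t01 : 0 < (1 : R) <= 1 by rewrite ltr01 lexx.
have [d1 d10 h1] := left_value_near w t01.
have [m1 _ hm1] := near_pow2 d10.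
have last m : (m1 <= m)%N -> w (pt m (2 ^ m).-1) = left_value w 1.
  move=> mm1; rewrite pt_pred; apply: h1; have := hm1 _ mm1.
  have : 0 < (2 ^+ m)^-1 :> R by rewrite invr_gt0 pow2_gt0.
  by move=> *; apply/andP; split; lra.
have [e|ne] := eqVneq (left_value w 1) (w 1); last first.
  by exists (left_value w 1, w 1, m1) => //= m /= mm; split => //; exact: last.
exfalso; apply: nr; split=> //.
have [m2 _ hm2] := cadlag_single_jumps (path_cadlag w).
exists (maxn m1 m2) => m; rewrite geq_max => /andP[mm1 mm2].
split; last by rewrite last.
move=> i im; have [u ui [lu ru _]] := single_jumpP (hm2 m mm2 i im).
rewrite -lu -ru; apply: us; case/andP: ui => u1 u2.
by rewrite (le_lt_trans _ u1) ?pt_ge0//= (le_trans u2)// pt_le1.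
Qed.

End null_complement.

(** * The bridge as a measure on jump pairs, and uniqueness from boxes *)

Section bridge_mass.
Variable R : realType.
Local Notation T := (skorokhod R).
Local Notation J := (jump_pair R).

Lemma jump_path_inj : injective (@jump_path R).
Proof.
move=> U V UV; apply: val_inj.
have u : ups U = ups V by rewrite -!jump_times_up UV.
have d : downs U = downs V by rewrite -!jump_times_down UV.
by rewrite [LHS]surjective_pairing [RHS]surjective_pairing; congr pair.
Qed.

Lemma range_jump_path : range (@jump_path R) = @unit_range R.
Proof.
by apply/seteqP; split; [exact: range_unit_range|exact: unit_range_range].
Qed.

Lemma image_jump_path (B : set T) :
  pinned R `&` @jump_path R @` (@jump_path R @^-1` B) = B `&` @unit_range R.
Proof.
rewrite -range_jump_path; apply/seteqP; split => [_ [_ [U BU <-]]|w [Bw [U _ Uw]]].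
  by split => //; exists U.
split; last by exists U => //; rewrite /= Uw.
by rewrite -Uw; split; [exact: jump_path0|exact: jump_path1].
Qed.

Lemma measurable_jump_path : measurable_fun setT (@jump_path R).
Proof.
by move=> _ B mB; rewrite setTI; exists B => //; rewrite setTI.
Qed.

(** The sigma-algebra is transported by an injection with measurable range. *)
Lemma measurable_image_jump_path (A : set J) : measurable A ->
  measurable (pinned R `&` @jump_path R @` A).
Proof.
move=> [B mB <-]; rewrite setTI image_jump_path.
by apply: measurableI => //; exact: measurable_unit_range.
Qed.

Variable P : probability T R.

(** The bridge law before division by the probability of being pinned. *)
Definition bridge_mass (A : set J) : \bar R := P (pinned R `&` @jump_path R @` A).

Let bridge_mass0 : bridge_mass set0 = 0%E.
Proof. by rewrite /bridge_mass image_set0 setI0 measure0. Qed.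

Let bridge_mass_ge0 A : (0 <= bridge_mass A)%E.
Proof. exact: measure_ge0. Qed.

Let bridge_mass_sigma_additive : semi_sigma_additive bridge_mass.
Proof.
move=> F mF tF mUF; rewrite /bridge_mass image_bigcup setI_bigcupr.
apply: measure_semi_sigma_additive.
- by move=> n; exact: measurable_image_jump_path.
- apply/trivIsetP => /= i j _ _ ij; rewrite setIACA.
  rewrite (_ : (_ @` _) `&` _ = set0) ?setI0//.
  apply/seteqP; split => // _ [[U FU <-] [V FV /jump_path_inj VU]].
  move/trivIsetP : tF => /(_ i j I I ij); rewrite -subset0 => /(_ U); apply.
  by split=> //; rewrite -VU.
- by apply: bigcupT_measurable => n; exact: measurable_image_jump_path.
Qed.

HB.instance Definition _ := isMeasure.Build _ _ _ bridge_mass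
  bridge_mass0 bridge_mass_ge0 bridge_mass_sigma_additive.

Lemma bridge_mass_fin : fin_num_fun bridge_mass.
Proof.
by move=> A mA; apply: fin_num_measure; exact: measurable_image_jump_path.
Qed.

HB.instance Definition _ := Measure_isFinite.Build _ _ _ bridge_mass bridge_mass_fin.

End bridge_mass.

Section same_box.
Variable R : realType.
Local Notation T := (skorokhod R).
Local Notation J := (jump_pair R).
Local Notation pt := (@pt R).
Implicit Types (U V : J).

Definition skeleton (m : nat) U : seq int :=
  mkseq (fun i => jump_path U (pt m i)) (2 ^ m).+1.

(** Level m separates the jumps of U. *)
Definition good (m : nat) : set J := [set U | in_cells (jump_path U) m].

Definition jbox (m : nat) U : set J := [set V | good m V /\ skeleton m V = skeleton m U].

Lemma skeletonP m U V : skeleton m U = skeleton m V <->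
  forall i, (i <= 2 ^ m)%N -> jump_path U (pt m i) = jump_path V (pt m i).
Proof.
split=> [h i im|h].
  by have := congr1 (fun s => nth 0 s i) h; rewrite !nth_mkseq.
by apply/eq_in_map => i; rewrite mem_iota add0n ltnS => im; exact: h.
Qed.

Lemma jboxE m U : jbox m U = @jump_path R @^-1` (box m U).
Proof.
apply/seteqP; split=> V.
  by move=> [gV /skeletonP s]; split => // i im; exact: s.
by move=> [h gV]; split; [move=> i; exact: gV|apply/skeletonP].
Qed.

Lemma measurable_jbox m U : measurable (jbox m U).
Proof.
rewrite jboxE -[X in measurable X]setTI; apply: measurable_jump_path => //.
apply: history_measurable (lexx _) _ _; rewrite -(pt1 R m).
exact: box_upto_history.
Qed.

Lemma measurable_coordJ m i k : (i <= 2 ^ m)%N ->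
  measurable [set U : J | jump_path U (pt m i) = k].
Proof.
move=> im; rewrite -[X in measurable X]setTI.
apply: (measurable_jump_path measurableT (_ : measurable [set w : T | w (pt m i) = k])).
by apply: measurable_coord; rewrite pt_ge0 pt_le1.
Qed.

(** There are countably many skeletons, and the good pairs with a given skeleton
form a box. *)
Lemma measurable_good m : measurable (good m).
Proof.
rewrite (_ : good m = \bigcup_(s in [set s | exists2 U, good m U & skeleton m U = s])
   [set U | good m U /\ skeleton m U = s]).
  apply: countable_bigcup_measurable => s [U gU <-]; exact: measurable_jbox.
apply/seteqP; split=> [U gU|U [s _ []//]].
by exists (skeleton m U) => //; exists U.
Qed.

Lemma measurable_skeleton m (s : seq int) : measurable (good m `&` [set U | skeleton m U = s]).
Proof.
have [[U [gU <-]]|h] := pselect (exists U, good m U /\ skeleton m U = s).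
  exact: measurable_jbox.
rewrite (_ : _ `&` _ = set0)//; apply/seteqP; split => // U [gU sU].
by case: h; exists U.
Qed.

Lemma single_jump_sub (w : R -> int) (s t s' t' : R) : s <= s' -> s' < t' -> t' <= t ->
  single_jump w s t -> single_jump w s' t'.
Proof.
move=> ss st tt [u /andP[u1 u2] [h1 h2]].
have [us|su] := leP u s'.
  exists t'; first by rewrite st lexx.
  split=> r /andP[r1 r2]; last by congr w; apply/le_anti; rewrite r1 r2.
  by rewrite !h2//; apply/andP; split; lra.
have [ut|tu] := leP u t'.
  exists u; first by rewrite su.
  split=> r /andP[r1 r2]; first by rewrite !h1//; apply/andP; split; lra.
  by rewrite !h2//; apply/andP; split; lra.
exists t'; first by rewrite st lexx.
split=> r /andP[r1 r2]; last by congr w; apply/le_anti; rewrite r1 r2.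
by rewrite !h1//; apply/andP; split; lra.
Qed.

Lemma good_le m m' : (m <= m')%N -> good m `<=` good m'.
Proof.
move=> /subnK <-; elim: (m' - m)%N => // n ih U /ih gU i im.
rewrite addSn in im *.
have i2 : (i./2 < 2 ^ (n + m))%N by rewrite expnS in im; lia.
have e q : pt (n + m) q = pt (n + m).+1 (q * 2) by rewrite -[LHS](ptD R (n + m) 1) addn1 expn1.
apply: single_jump_sub (gU _ i2); rewrite ?e ?ler_pt ?ltr_pt//; lia.
Qed.

Lemma good_eventually U : exists m, good m U.
Proof.
by have [m _ h] := cadlag_single_jumps (path_cadlag (jump_path U)); exists m; exact: (h m (leqnn m)).
Qed.

Lemma jbox_npairs m U V : good m U -> jbox m U V -> npairs V = npairs U.
Proof.
move=> gU [gV /skeletonP s]; apply: double_inj.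
rewrite -(nb_jumps_npairs gU) -(nb_jumps_npairs gV).
by apply: eq_bigr => i _; rewrite !s// ltnW.
Qed.

(** A box is determined by its level and its skeleton, so there are countably
many of them. *)
Lemma box_open_measurable (O : set J) :
  (forall U, O U -> exists m, good m U /\ jbox m U `<=` O) -> measurable O.
Proof.
move=> h.
rewrite (_ : O = \bigcup_(ms in [set ms : nat * seq int |
     good ms.1 `&` [set U | skeleton ms.1 U = ms.2] `<=` O])
   (good ms.1 `&` [set U | skeleton ms.1 U = ms.2])).
  by apply: countable_bigcup_measurable => -[m s] _; exact: measurable_skeleton.
apply/seteqP; split => [U OU|U [ms msO]]; last exact: msO.
have [m [gU mO]] := h U OU.
by exists (m, skeleton m U) => //= V [gV sV]; exact: mO.
Qed.

Lemma measurable_npairs n : measurable [set U : J | npairs U = n].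
Proof.
apply: box_open_measurable => U <-; have [m gU] := good_eventually U.
by exists m; split => // V; exact: jbox_npairs.
Qed.

End same_box.

Section uniqueness.
Variable R : realType.
Local Notation T := (skorokhod R).
Local Notation J := (jump_pair R).
Local Notation pt := (@pt R).
Implicit Types (U V : J).

Lemma le_measure_partition d (S : measurableType d) (I : countType)
    (al be : {measure set S -> \bar R}) (h : S -> I) (c : R) (E : set S) :
  0 <= c -> (forall i, measurable (E `&` [set x | h x = i])) ->
  (forall i, (al (E `&` [set x | h x = i]) <= c%:E * be (E `&` [set x | h x = i]))%E) ->
  (al E <= c%:E * be E)%E.
Proof.
move=> c0 mE le.
(* the fibres of h, enumerated by the naturals *)
pose F n := E `&` [set x | choice.pickle (h x) = n].
have FE n : F n = set0 \/ exists i, F n = E `&` [set x | h x = i].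
  have [[x [Ex xn]]|nx] := pselect (exists x, E x /\ choice.pickle (h x) = n).
    right; exists (h x); apply/seteqP; split => y [Ey].
      by move=> /= yn; split => //=; apply: (pcan_inj (@choice.pickleK I)); rewrite yn xn.
    by move=> /= yx; split => //=; rewrite yx.
  left; apply/seteqP; split => // x [Ex xn]; apply: nx; by exists x.
have mF n : measurable (F n) by have [->//|[i ->]] := FE n.
have leF n : (al (F n) <= c%:E * be (F n))%E.
  by have [->|[i ->]//] := FE n; rewrite !measure0 mule0.
have tF : trivIset setT F.
  apply/trivIsetP => i j _ _ ij; apply/seteqP; split => // x [[_ /= xi] [_ /= xj]].
  by move/eqP: ij; rewrite -xi -xj.
have EF : E = \bigcup_n F n.
  by apply/seteqP; split => [x Ex|x [n _ []//]]; exists (choice.pickle (h x)).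
rewrite EF !measure_bigcup//=.
rewrite -nneseriesZl//.
apply: lee_nneseries; last by move=> n _; exact: leF.
by move=> n _ _; exact: measure_ge0.
Qed.

Lemma expR_limit_le (C : R) m0 (x y : \bar R) : (0 <= y)%E ->
  (forall m, (m0 <= m)%N -> (x <= (expR (C / 2 ^+ m))%:E * y)%E) -> (x <= y)%E.
Proof.
case: y => [y| |] // y0 h; last by rewrite leey.
case: x h => [x| |] h; last by rewrite leNye.
  rewrite lee_fin; rewrite lee_fin in y0.
  have cvg : (expR (C / 2 ^+ m) * y) @[m --> \oo] --> (expR 0 * y).
    apply: cvgMl; apply: continuous_cvg; first exact: continuous_expR.
    rewrite -(mulr0 C); apply: cvgMr.
    under eq_cvg do rewrite -exprVn.
    by apply: cvg_expr; rewrite ger0_norm; lra.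
  rewrite -[y]mul1r -expR0 -(cvg_lim _ cvg)//; apply: limr_ge.
    by apply/cvg_ex; eexists; exact: cvg.
  by exists m0 => // m /= mm; have := h m mm; rewrite -EFinM lee_fin.
by have := h m0 (leqnn _); rewrite -EFinM leye_eq.
Qed.

(** Sets that depend on the skeleton only, at all fine levels: a system stable
under intersection on which measures can be compared box by box. *)
Definition skeletal (A : set J) : Prop := measurable A /\
  exists m0, forall m U V, (m0 <= m)%N -> skeleton m U = skeleton m V -> A U -> A V.

Lemma skeletalI : setI_closed skeletal.
Proof.
move=> A B [mA [m1 h1]] [mB [m2 h2]]; split; first exact: measurableI.
exists (maxn m1 m2) => m U V; rewrite geq_max => /andP[mm1 mm2] UV [AU BU].
by split; [exact: h1 UV AU|exact: h2 UV BU].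
Qed.

Lemma skeletal_coord m i k : (i <= 2 ^ m)%N ->
  skeletal [set U | jump_path U (pt m i) = k].
Proof.
move=> im; split; first exact: measurable_coordJ.
exists m => m' U V /subnKC <- /skeletonP UV Uk.
have <- : jump_path U (pt m i) = k := Uk.
change (jump_path V (pt m i) = jump_path U (pt m i)).
by rewrite -(ptD R m (m' - m)) [RHS]UV// expnD leq_mul2r im orbT.
Qed.

(** By right-continuity the value at time r is the eventual value at the dyadic
times just after r. *)
Lemma measurable_skeletal : @measurable _ J = <<s skeletal >>.
Proof.
apply/seteqP; split; last first.
  by apply: smallest_sub; [exact: sigma_algebra_measurable|move=> A []].
move=> A [B mB <-]; rewrite setTI.
pose C : set (set T) := [set B | <<s skeletal >> (@jump_path R @^-1` B)].
suff : history 1 `<=` C by apply.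
apply: smallest_sub.
  split.
  - by rewrite /C /= preimage_set0; exact: sigma_algebra0.
  - move=> D; rewrite /C /= setTD preimage_setC; exact: sigma_algebraC.
  - by move=> F h; rewrite /C /= preimage_bigcup; exact: sigma_algebra_bigcup.
move=> _ [r [k [/andP[r0 r1] ->]]]; rewrite /C /=.
move: r1; rewrite le_eqVlt => /orP[/eqP->|r1].
  apply: sub_sigma_algebra; have := @skeletal_coord 0 1 k isT.
  by rewrite (pt1 R 0).
have /choice[f fP] : forall m, exists i, (i < 2 ^ m)%N /\ pt m i <= r < pt m i.+1.
  by move=> m; have [|i i1 i2] := @grid_cell_left R m r; [rewrite r0|exists i].
rewrite (_ : _ @^-1` _ = \bigcup_m0 \bigcap_(m in [set m | (m0 <= m)%N])
   [set U | jump_path U (pt m (f m).+1) = k]).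
  apply: (@bigcupT_measurable _ (g_sigma_algebraType skeletal)) => m0.
  apply: (@bigcap_measurable _ (g_sigma_algebraType skeletal)); first by exists m0 => /=.
  move=> m _; apply: sub_sigma_algebra; apply: skeletal_coord.
  by have [] := fP m.
have near_r U : exists m0, forall m, (m0 <= m)%N ->
    jump_path U (pt m (f m).+1) = jump_path U r.
  have [|d [_ [d0 _ hd]]] := @cadlag_local R (jump_path U) r (path_cadlag _).
    by rewrite r0 ltW.
  have [m0 _ hm] := near_pow2 d0; exists m0 => m mm; have [_ /andP[f1 f2]] := fP m.
  by apply: hd; have := hm _ mm; rewrite ptS in f2 *; move=> ?; apply/andP; split; lra.
apply/seteqP; split => U.
  move=> Ur; have [m0 h] := near_r U; exists m0 => // m mm.
  exact: etrans (h m mm) Ur.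
move=> [m1 _ h1]; have [m2 h2] := near_r U.
exact: etrans (esym (h2 (maxn m1 m2) (leq_maxr _ _))) (h1 _ (leq_maxl _ _)).
Qed.

(** At each fine level, the good pairs of A with n up-jumps form a countable
disjoint union of boxes, on which al is at most exp(C / 2^m) times be; these
subsets increase to all of A as m grows. *)
Lemma box_domination (al be : {measure set J -> \bar R}) (n : nat) (C : R) m0 :
  (forall m U, (m0 <= m)%N -> npairs U = n -> good m U ->
    (al (jbox m U) <= (expR (C / 2 ^+ m))%:E * be (jbox m U))%E) ->
  forall A, skeletal A -> (al (A `&` [set U | npairs U = n]) <=
                           be (A `&` [set U | npairs U = n]))%E.
Proof.
move=> H A [mA [m1 hA]]; set L := [set U | npairs U = n].
have mL : measurable L by exact: measurable_npairs.
have mAL : measurable (A `&` L) by exact: measurableI.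
pose E m := A `&` L `&` good m.
have mE m : measurable (E m) by apply: measurableI => //; exact: measurable_good.
have step m : (maxn m0 m1 <= m)%N ->
    (al (E m) <= (expR (C / 2 ^+ m))%:E * be (E m))%E.
  rewrite geq_max => /andP[mm0 mm1].
  have ES s : E m `&` [set x | skeleton m x = s] = set0 \/
      exists U, [/\ npairs U = n, good m U & E m `&` [set x | skeleton m x = s] = jbox m U].
    have [[U [[[AU LU] gU] sU]]|nx] := pselect (exists U, E m U /\ skeleton m U = s).
      right; exists U; split => //; apply/seteqP; split => V.
        by move=> [[_ gV] sV]; split => //; rewrite sU.
      move=> UV; have [gV sV] := UV; split; last by rewrite /= sV.
      split => //; split; first exact: hA mm1 (esym sV) AU.
      by rewrite /L /= (jbox_npairs gU UV).
    left; apply/seteqP; split => // x [Ex sx]; apply: nx; by exists x.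
  apply: (@le_measure_partition _ J _ al be (skeleton m)); first exact: expR_ge0.
    by move=> s; have [->//|[U [_ _ ->]]] := ES s; exact: measurable_jbox.
  by move=> s; have [->|[U [Un gU ->]]] := ES s; [rewrite !measure0 mule0|exact: H].
apply: (@expR_limit_le `|C| (maxn m0 m1)); first exact: measure_ge0.
move=> M MM.
have cvg : al (E m) @[m --> \oo] --> al (A `&` L).
  have -> : A `&` L = \bigcup_m E m.
    rewrite -setI_bigcupr; apply/esym/setIidl => U _.
    by have [m gU] := good_eventually U; exists m.
  apply: nondecreasing_cvg_mu => //; first exact: bigcupT_measurable.
  by move=> i j ij; apply/subsetPset; apply: setIS; exact: good_le.
apply: (cvge_le _ cvg); exists M => // m /= Mm.
apply: (le_trans (step m (leq_trans MM Mm))).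
apply: lee_pmul => //.
- rewrite lee_fin ler_expR; apply: (@le_trans _ _ (`|C| / 2 ^+ m)).
    by rewrite ler_wpM2r ?ler_norm// invr_ge0 ltW// pow2_gt0.
  rewrite ler_wpM2l// lef_pV2 ?posrE ?pow2_gt0//.
  by rewrite ler_eXn2l// ltr1n.
- by apply: le_measure; rewrite ?inE//; exact: subIsetl.
Qed.

(** A measure on jump pairs is determined by the leading behaviour of its values
on fine boxes, for each number of pairs separately. *)
Lemma box_unique (al be : {measure set J -> \bar R}) :
  (forall n, exists C : R, exists m0 : nat, forall m U, (m0 <= m)%N -> npairs U = n -> good m U ->
    (al (jbox m U) <= (expR (C / 2 ^+ m))%:E * be (jbox m U))%E /\
    (be (jbox m U) <= (expR (C / 2 ^+ m))%:E * al (jbox m U))%E) ->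
  (al setT < +oo)%E -> forall A, measurable A -> al A = be A.
Proof.
move=> H fin A mA.
have skT : skeletal setT by split=> //; exists 0%N.
apply: (@measure_unique _ R J skeletal (fun=> setT)) => //.
- exact: measurable_skeletal.
- exact: skeletalI.
- by rewrite bigcup_const.
move=> {mA} {}A sA; have mA := sA.1.
pose F n := A `&` [set U | npairs U = n].
have mF n : measurable (F n) by apply: measurableI => //; exact: measurable_npairs.
have tF : trivIset setT F.
  apply/trivIsetP => i j _ _ ij; apply/seteqP; split => // x [[_ /= xi] [_ /= xj]].
  by move/eqP: ij; rewrite -xi -xj.
have -> : A = \bigcup_n F n.
  by apply/seteqP; split => [x Ex|x [n _ []//]]; exists (npairs x).
rewrite !measure_bigcup//=; apply: eq_eseriesr => n _.
have [C [m0 h]] := H n.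
apply/le_anti/andP; split; apply: (@box_domination _ _ n C m0) => // m U mm Un gU;
  by have [] := h m U mm Un gU.
Qed.

End uniqueness.

(** * Densities and the Girsanov formula *)

Section density.
Local Open Scope ereal_scope.
Context d (T : measurableType d) (R : realType).
Variables (mu nu : {measure set T -> \bar R}) (rho : T -> R).
Hypothesis mrho : measurable_fun setT rho.
Hypothesis rho0 : forall x, (0 <= rho x)%R.
Hypothesis murho : forall A, measurable A -> mu A = \int[nu]_(x in A) (rho x)%:E.

Import HBNNSimple.

Lemma ge0_integral_density (f : T -> \bar R) : (forall x, 0 <= f x) ->
  measurable_fun setT f -> \int[mu]_x f x = \int[nu]_x (f x * (rho x)%:E).
Proof.
move=> f0 mf; pose h := nnsfun_approx measurableT mf.
have mrho' : measurable_fun setT (EFin \o rho) by exact/measurable_EFinP.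
have -> : \int[mu]_x f x = limn (fun n => \int[mu]_x (EFin \o h n) x).
  have fE x : f x = limn (fun n => (EFin \o h n) x).
    by apply/esym/cvg_lim => //; exact: cvg_nnsfun_approx.
  under eq_integral => x _ do rewrite fE.
  apply: monotone_convergence => //.
  - by move=> n; apply/measurable_EFinP; exact/measurable_funP.
  - by move=> n x _ /=; rewrite lee_fin.
  - by move=> x _ a b ab; rewrite lee_fin; exact/lefP/nd_nnsfun_approx.
have -> : \int[nu]_x (f x * (rho x)%:E) =
    limn (fun n => \int[nu]_x ((EFin \o h n) x * (rho x)%:E)).
  have fE x : f x * (rho x)%:E = limn (fun n => (EFin \o h n) x * (rho x)%:E).
    apply/esym/cvg_lim => //; apply: cvgeZr => //; exact: cvg_nnsfun_approx.
  under eq_integral => x _ do rewrite fE.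
  apply: monotone_convergence => //.
  - move=> n; apply: emeasurable_funM => //.
    by apply/measurable_EFinP; exact/measurable_funP.
  - by move=> n x _ /=; rewrite mule_ge0 ?lee_fin.
  - move=> x _ a b ab /=; rewrite lee_wpmul2r ?lee_fin//.
    exact/lefP/nd_nnsfun_approx.
congr (limn _); apply/funext => n.
have indich r : measurable_fun setT (fun x => (r * \1_(h n @^-1` [set r]) x)%:E).
  by apply: (measurable_comp measurableT) => //; exact: measurable_funM.
transitivity (\int[mu]_x
   (\sum_(y \in range (h n)) (y * \1_(h n @^-1` [set y]) x)%:E)).
  by apply: eq_integral => t _; rewrite /= fimfunE -fsumEFin.
rewrite ge0_integral_fsum//; last by move=> m y Ey; exact: nnfun_muleindic_ge0.
transitivity (\int[nu]_x (\sum_(y \in range (h n))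
    (y * \1_(h n @^-1` [set y]) x)%:E * (rho x)%:E)); last first.
  apply: eq_integral => x _.
  rewrite -ge0_mule_fsuml => [|y]; last exact: nnfun_muleindic_ge0.
  by rewrite fsumEFin // -(fimfunE _ x).
rewrite ge0_integral_fsum//; last 2 first.
  - by move=> y; apply: emeasurable_funM.
  - by move=> m y Ey; apply: mule_ge0; [exact: nnfun_muleindic_ge0|rewrite lee_fin].
apply: eq_fsbigr => r rhn.
under [LHS]eq_integral do rewrite EFinM.
rewrite integralZl_indic_nnsfun => //.
under [RHS]eq_integral do rewrite EFinM -muleA.
have mh : measurable (h n @^-1` [set r]) by exact: measurable_sfunP.
rewrite ge0_integralZl//.
- rewrite integral_indic// setIT murho// integral_mkcond; congr (_ * _).
  by apply: eq_integral => x _; rewrite epatch_indic muleC.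
- by apply: emeasurable_funM => //; exact/measurable_EFinP.
- by move=> t Et; rewrite mule_ge0 ?lee_fin.
- by move: rhn; rewrite inE => -[t _ <-]; rewrite lee_fin.
Qed.

End density.

Section weighted_measure.
Local Open Scope ereal_scope.
Context d (T : measurableType d) (R : realType).
Variables (nu : {measure set T -> \bar R}) (rho : T -> R).
Hypothesis mrho : measurable_fun setT rho.
Hypothesis rho0 : forall x, (0 <= rho x)%R.

Definition weighted of measurable_fun setT rho & (forall x, (0 <= rho x)%R) :=
  fun A : set T => \int[nu]_(x in A) (rho x)%:E.

Local Notation w := (weighted mrho rho0).

Let weighted0 : w set0 = 0. Proof. exact: integral_set0. Qed.

Let weighted_ge0 A : 0 <= w A.
Proof. by apply: integral_ge0 => x _; rewrite lee_fin. Qed.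

Let weighted_sigma_additive : semi_sigma_additive w.
Proof.
move=> F mF tF mUF; rewrite /weighted ge0_integral_bigcup//.
- apply: is_cvg_ereal_nneg_natsum_cond => n _ _; exact: weighted_ge0.
- by apply: measurable_funTS; exact/measurable_EFinP.
- by move=> x _; rewrite lee_fin.
Qed.

HB.instance Definition _ := isMeasure.Build _ _ _ w
  weighted0 weighted_ge0 weighted_sigma_additive.

End weighted_measure.

Section girsanov.
Variable R : realType.
Local Notation T := (skorokhod R).
Local Notation J := (jump_pair R).
Local Notation pt := (@pt R).
Local Notation MJ a b U := (M a b (jump_path U)).

Lemma M_gt0 (a b : int -> R) (w : T) : (forall j, 0 < a j) -> (forall j, 0 < b j) ->
  0 < M a b w.
Proof. by move=> a0 b0; rewrite /M !mulr_gt0 ?expR_gt0//; apply: prodr_gt0. Qed.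

Lemma M11 (w : T) : M (fun=> 1) (fun=> 1) w = expR (- 2) :> R.
Proof.
rewrite /M !fsbig1// !mulr1; congr (expR (- _)).
rewrite /Rintegral (integral_cst lebesgue_measure)//= lebesgue_measure_itv/= lte_fin ltr01.
by rewrite oppr0 adde0 mule1.
Qed.

Section one_walk.
Variables a b : int -> R.
Hypothesis a0 : forall j, 0 < a j.
Hypothesis b0 : forall j, 0 < b j.
Variable P : probability T R.
Hypothesis PG : has_generator a b P.
Local Notation p A := (fine (P A)).
Local Notation q := (fine (P [set w : T | w 0 = 0])).

Lemma box_sub_pinned m (U : J) : box m U `<=` pinned R.
Proof.
move=> w [h _]; split.
  by have := h 0%N (leq0n _); rewrite pt0 jump_path0.
by have := h _ (leqnn _); rewrite pt1 jump_path1.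
Qed.

Lemma measurable_box m (U : J) : measurable (box m U).
Proof.
apply: history_measurable (lexx _) _ _; rewrite -(pt1 R m).
exact: box_upto_history.
Qed.

Lemma bridge_mass_jbox m (U : J) : bridge_mass P (jbox m U) = (p (box m U))%:E.
Proof.
rewrite /bridge_mass jboxE image_jump_path.
have mB := measurable_box m U; have mr := @measurable_unit_range R.
rewrite (pE P (measurableI _ _ mB mr)); congr EFin.
have := p_setD P mB mr.
have -> : p (box m U `&` ~` @unit_range R) = 0.
  apply/eqP; rewrite eq_le p_ge0 andbT.
  have n0 := pinned_null a0 b0 PG.
  have <- : p (pinned R `\` @unit_range R) = 0 by rewrite n0.
  apply: p_le.
  - by apply: measurableI => //; exact: measurableC.
  - by apply: measurableD => //; exact: measurable_pinned.
  - by move=> w [/box_sub_pinned pw nw].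
by move=> /eqP; rewrite eq_sym subr_eq0 => /eqP.
Qed.

Lemma bridge_mass_total : bridge_mass P setT = P (pinned R).
Proof.
rewrite /bridge_mass -[setT](@preimage_setT _ _ (@jump_path R)) image_jump_path setTI.
have mr := @measurable_unit_range R; have mp := @measurable_pinned R.
rewrite (pE P mr) (pE P mp); congr EFin.
have := p_setD P mp mr; rewrite -setDE (pinned_null a0 b0 PG) /=.
rewrite (_ : pinned R `&` _ = @unit_range R); last by apply: setIidr => w [].
by move=> /eqP; rewrite eq_sym subr_eq0 => /eqP.
Qed.

Hypothesis q0 : 0 < q.

(** U and V have the same box, of which [key_estimate] gives the probability in
terms of either. *)
Lemma M_box n : exists C : R, exists m0 : nat, forall m U V, (m0 <= m)%N ->
  npairs U = n -> good m U -> jbox m U V ->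
  MJ a b V <= MJ a b U * expR (C / 2 ^+ m).
Proof.
have [C [m0 H]] := key_estimate a0 b0 PG n.
exists (C + C), m0 => m U V mm Un gU UV.
have Vn := jbox_npairs gU UV; have [gV sV] := UV.
have /andP[_ h2] := H m mm U Un gU.
have /andP[h1 _] := H m mm V (etrans Vn Un) gV.
have bUV : box m V = box m U.
  have kk i : (i <= 2 ^ m)%N -> jump_path U (pt m i) = jump_path V (pt m i).
    by move/skeletonP: sV => sV im; rewrite sV.
  by apply/seteqP; split=> w [e s]; split => // i im; rewrite e// kk.
rewrite bUV in h1; move: (le_trans h1 h2).
set X := (2 ^+ m)^-1 ^+ _; set e1 := expR _; set e2 := expR _.
have X0 : 0 < q * X by rewrite mulr_gt0// exprn_gt0// invr_gt0 pow2_gt0.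
move=> le; have {}le : q * X * (MJ a b V * e1) <= q * X * (MJ a b U * e2) by lra.
move: le; rewrite (ler_pM2l X0) => le.
have := ler_wpM2r (expR_ge0 (C / 2 ^+ m)) le.
by rewrite -[leLHS]mulrA -[leRHS]mulrA /e1 /e2 -!expRD addNr expR0 mulr1 -mulrDl.
Qed.

(** By [M_box], the inequality y < M persists on a small box. *)
Lemma measurable_M : measurable_fun setT (fun U => MJ a b U).
Proof.
apply: (measurability _ (RGenOInfty.measurableE R)).
move=> _ [_ [y ->] <-]; rewrite setTI.
apply: box_open_measurable => U /=; rewrite in_itv /= andbT => yU.
have [C [m0 H]] := M_box (npairs U).
have [m1 gU] := good_eventually U.
have M0 := M_gt0 (jump_path U) a0 b0.
have M0' V := M_gt0 (jump_path V) a0 b0.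
have cvg : (expR (`|C| / 2 ^+ m) * y) @[m --> \oo] --> (expR 0 * y).
  apply: cvgMl; apply: continuous_cvg; first exact: continuous_expR.
  rewrite -(mulr0 `|C|); apply: cvgMr.
  under eq_cvg do rewrite -exprVn.
  by apply: cvg_expr; rewrite ger0_norm; lra.
rewrite expR0 mul1r in cvg.
have [m2 _ h2] : \forall m \near \oo, expR (`|C| / 2 ^+ m) * y < MJ a b U.
  exact: cvgr_lt cvg _ yU.
pose m := maxn m0 (maxn m1 m2).
have [mm0 mm1 mm2] : [/\ m0 <= m, m1 <= m & m2 <= m]%N.
  by rewrite /m !leq_max !leqnn ?orbT; split.
exists m; split; first exact: good_le mm1 _ gU.
move=> V UV; have [gV sV] := UV; rewrite /= in_itv /= andbT.
have VU : jbox m V U by split; [exact: good_le mm1 _ gU|rewrite sV].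
have Vn := jbox_npairs (good_le mm1 gU) UV.
have := H m V U mm0 Vn gV VU; have := h2 m mm2 => l1 l2.
have l3 : MJ a b V * expR (C / 2 ^+ m) <= MJ a b V * expR (`|C| / 2 ^+ m).
  by rewrite ler_wpM2l ?(ltW (M0' V))// ler_expR ler_wpM2r ?ler_norm// invr_ge0 ltW// pow2_gt0.
have := lt_le_trans (lt_le_trans l1 l2) l3.
by rewrite mulrC ltr_pM2r// expR_gt0.
Qed.

End one_walk.

Section change_of_measure.
Variables a b : int -> R.
Hypothesis a0 : forall j, 0 < a j.
Hypothesis b0 : forall j, 0 < b j.
Variables P Q : probability T R.
Hypothesis PG : has_generator a b P.
Hypothesis QG : has_generator (fun=> 1) (fun=> 1) Q.
Local Notation p A := (fine (P A)).
Local Notation q A := (fine (Q A)).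
Local Notation p0 := (p [set w : T | w 0 = 0]).
Local Notation q0 := (q [set w : T | w 0 = 0]).
Hypothesis pp : 0 < p0.
Hypothesis qp : 0 < q0.

(* expR 2 is the inverse of the value of M for unit rates *)
Local Notation c := (p0 * expR 2 / q0).

Let c0 : 0 < c. Proof. by rewrite divr_gt0// mulr_gt0// expR_gt0. Qed.

Let cM0 U : 0 <= c * MJ a b U.
Proof. by rewrite mulr_ge0// ltW// M_gt0. Qed.

Lemma measurable_cM : measurable_fun setT (fun U : J => c * MJ a b U).
Proof.
apply: measurable_funM => //.
exact: (measurable_M a0 b0 PG pp).
Qed.

Local Notation wQ := (weighted (bridge_mass Q) measurable_cM cM0).

(** By [key_estimate] the box of U has mass proportional to M(U) h^(2 n) under P and
to h^(2 n) under Q, and M is nearly constant on the box. *)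
Lemma bridge_mass_density (A : set J) : measurable A ->
  bridge_mass P A = (\int[bridge_mass Q]_(U in A) (c * MJ a b U)%:E)%E.
Proof.
move=> mA; change (bridge_mass P A = wQ A); apply: box_unique => //; last first.
  by rewrite -ge0_fin_numE//; apply: bridge_mass_fin.
move=> n.
have [C1 [m1 H1]] := key_estimate a0 b0 PG n.
have [C2 [m2 H2]] := M_box a0 b0 PG pp n.
have l01 : forall j : int, 0 < (fun=> 1 : R) j by move=> j; exact: ltr01.
have [C3 [m3 H3]] := key_estimate l01 l01 QG n.
exists (C1 + C2 + C3), (maxn m1 (maxn m2 m3)) => m U mm Un gU.
have [mm1 mm2 mm3] : [/\ m1 <= m, m2 <= m & m3 <= m]%N.
  by move: mm; rewrite !geq_max => /and3P[].
have /andP[h1 h2] := H1 m mm1 U Un gU.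
have /andP[h3 h4] := H3 m mm3 U Un gU.
rewrite M11 in h3 h4.
have mj := measurable_jbox m U.
have le1 V : jbox m U V -> MJ a b V <= MJ a b U * expR (C2 / 2 ^+ m).
  exact: H2.
have le2 V : jbox m U V -> MJ a b U <= MJ a b V * expR (C2 / 2 ^+ m).
  move=> UV; have [gV sV] := UV.
  by apply: (H2 m V U) => //; rewrite (jbox_npairs gU UV).
have bQ : bridge_mass Q (jbox m U) = (q (box m U))%:E by exact: (bridge_mass_jbox l01 l01 QG).
have wup : (wQ (jbox m U) <= (c * (MJ a b U * expR (C2 / 2 ^+ m)) * q (box m U))%:E)%E.
  rewrite EFinM -bQ -(integral_cst (bridge_mass Q) mj).
  apply: le_integral_any => V UV; rewrite lee_fin ler_wpM2l ?(ltW c0)//; exact: le1.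
have wlo : ((c * (MJ a b U * expR (- (C2 / 2 ^+ m))) * q (box m U))%:E <= wQ (jbox m U))%E.
  rewrite EFinM -bQ -(integral_cst (bridge_mass Q) mj).
  apply: le_integral_any => V UV; rewrite lee_fin ler_wpM2l ?(ltW c0)//.
  have := ler_wpM2r (expR_ge0 (- (C2 / 2 ^+ m))) (le2 V UV).
  by rewrite -[leRHS]mulrA -expRD addrN expR0 mulr1.
have MU0 : 0 < MJ a b U by exact: M_gt0.
have ce : c * expR (- 2) * q0 = p0.
  have e2 : expR 2 * expR (- 2) = 1 :> R by rewrite -expRD addrN expR0.
  have qq : q0^-1 * q0 = 1 by rewrite mulVf// lt0r_neq0.
  have -> : c * expR (- 2) * q0 = p0 * (expR 2 * expR (- 2)) * (q0^-1 * q0) by ring.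
  by rewrite e2 qq !mulr1.
suff : (bridge_mass P (jbox m U) <=
       (expR ((C1 + C2 + C3) / 2 ^+ m))%:E * wQ (jbox m U))%E /\
     (wQ (jbox m U) <=
       (expR ((C1 + C2 + C3) / 2 ^+ m))%:E * bridge_mass P (jbox m U))%E by [].
rewrite (bridge_mass_jbox a0 b0 PG).
set X := (2 ^+ m)^-1 ^+ _ in h1 h2 h3 h4.
have X0 : 0 < X by rewrite exprn_gt0// invr_gt0 pow2_gt0.
rewrite 2!mulrDl !expRD.
split.
  apply: le_trans (lee_wpmul2l _ wlo); last by rewrite lee_fin !mulr_ge0 ?expR_ge0.
  rewrite -EFinM lee_fin; apply: (le_trans h2).
  have pos : 0 <= expR (C1 / 2 ^+ m) * expR (C2 / 2 ^+ m) * expR (C3 / 2 ^+ m)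
     * (c * (MJ a b U * expR (- (C2 / 2 ^+ m)))).
    by have c00 := c0; nneg.
  apply: le_trans (le_trans _ (ler_wpM2l pos h3)) _; last first.
    by rewrite le_eqVlt; apply/orP; left; apply/eqP; ring.
  have e2 : expR (C2 / 2 ^+ m) * expR (- (C2 / 2 ^+ m)) = 1 by rewrite -expRD addrN expR0.
  have e3 : expR (C3 / 2 ^+ m) * expR (- (C3 / 2 ^+ m)) = 1 by rewrite -expRD addrN expR0.
  rewrite le_eqVlt; apply/orP; left; apply/eqP.
  transitivity (c * expR (- 2) * q0 * (MJ a b U * X) * expR (C1 / 2 ^+ m) * 1 * 1).
    by rewrite ce !mulr1.
  rewrite -[in X in _ * X * _ = _]e2 -[X in _ * X = _]e3; ring.
apply: (le_trans wup); rewrite -EFinM lee_fin.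
have pos1 : 0 <= c * (MJ a b U * expR (C2 / 2 ^+ m)).
  by have c00 := c0; nneg.
apply: le_trans (ler_wpM2l pos1 h4) _.
have pos2 : 0 <= expR (C1 / 2 ^+ m) * expR (C2 / 2 ^+ m) * expR (C3 / 2 ^+ m).
  by rewrite !mulr_ge0 ?expR_ge0.
apply: le_trans _ (ler_wpM2l pos2 h1).
have e1 : expR (C1 / 2 ^+ m) * expR (- (C1 / 2 ^+ m)) = 1 by rewrite -expRD addrN expR0.
rewrite le_eqVlt; apply/orP; left; apply/eqP.
transitivity (c * expR (- 2) * q0 * (MJ a b U * X) * expR (C2 / 2 ^+ m) * expR (C3 / 2 ^+ m)
    * (expR (C1 / 2 ^+ m) * expR (- (C1 / 2 ^+ m)))).
  by rewrite e1 mulr1; ring.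
by rewrite ce; ring.
Qed.

End change_of_measure.
End girsanov.

(** * Insertion of a pair of jumps *)

Section insertion.
Variable R : realType.
Local Notation J := (jump_pair R).
Local Notation pt := (@pt R).
Implicit Types (U V : J) (r s t : R).

Definition jumps U t : Prop := ups U t \/ downs U t.

Definition vacant U : set R := [set r | 0 < r < 1 /\ ~ jumps U r].

Definition insertable : set (J * (R * R)) :=
  [set x | [/\ vacant x.1 x.2.1, vacant x.1 x.2.2 & x.2.1 <> x.2.2]].

Lemma card_eq_finite (F G : set R) : finite_set F -> finite_set G ->
  #|` fset_set F| = #|` fset_set G| -> (F #= G)%card.
Proof.
move=> /finite_setP[n Fn] /finite_setP[n' Gn] FG.
apply: (card_eq_trans Fn); rewrite card_eq_sym; apply: (card_eq_trans Gn).
by rewrite -(card_fset_set Fn) FG (card_fset_set Gn).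
Qed.

Lemma card_add (F : set R) r : finite_set F -> ~ F r ->
  #|` fset_set (F `|` [set r])| = #|` fset_set F|.+1.
Proof.
move=> fF Fr; rewrite setUC fset_setU1// cardfsU1 in_fset_set// memNset//.
Qed.

Lemma Psi_insert U r s : insertable (U, (r, s)) ->
  ups (Psi r s U) = ups U `|` [set r] /\ downs (Psi r s U) = downs U `|` [set s].
Proof.
move=> [/= [r01 nr] [s01 ns] rs].
have nur : ~ ups U r by move=> h; apply: nr; left.
have nds : ~ downs U s by move=> h; apply: ns; right.
have pU : is_jump_pair (ups U `|` [set r], downs U `|` [set s]).
  split=> /=.
  - by split; rewrite finite_setU; split => //; [exact: ups_finite|exact: downs_finite].
  - by split => t [|->//]; [exact: ups_in|exact: downs_in].
  - apply/seteqP; split => // t [[u|->] [d|e]].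
    + exact: (ups_downs u d).
    + by apply: ns; left; rewrite -e.
    + by apply: nr; right.
    + exact: rs.
  - apply: card_eq_finite.
    + by rewrite finite_setU; split => //; exact: ups_finite.
    + by rewrite finite_setU; split => //; exact: downs_finite.
    + rewrite !card_add// ?npairs_downs//; [exact: downs_finite|exact: ups_finite].
rewrite /Psi asboolT; last by split.
by rewrite /ups /downs insubdK//= /in_mem /= asboolT.
Qed.

(** Removing a pair is also a move of Psi, undone by inserting the pair again. *)
Lemma Psi_remove U r s : ups U r -> downs U s ->
  [/\ insertable (Psi r s U, (r, s)), Psi r s (Psi r s U) = U
    & npairs U = (npairs (Psi r s U)).+1].
Proof.
move=> ur ds.
have pU : is_jump_pair (ups U `\ r, downs U `\ s).
  split=> /=.
  - by split; apply: finite_setD; [exact: ups_finite|exact: downs_finite].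
  - by split => t [h _]; [exact: ups_in h|exact: downs_in h].
  - by apply/seteqP; split => // t [[u _] [d _]]; exact: (ups_downs u d).
  - apply: card_eq_finite.
    + by apply: finite_setD; exact: ups_finite.
    + by apply: finite_setD; exact: downs_finite.
    + rewrite !fset_setD1//; [|exact: downs_finite|exact: ups_finite].
      have := cardfsD1 r (fset_set (ups U)); have := cardfsD1 s (fset_set (downs U)).
      rewrite !in_fset_set ?mem_set//; [|exact: ups_finite|exact: downs_finite].
      rewrite npairs_downs -/(npairs U); lia.
have PE : ups (Psi r s U) = ups U `\ r /\ downs (Psi r s U) = downs U `\ s.
  rewrite /Psi asboolF; last by move=> [].
  rewrite asboolT//.
  by rewrite /ups /downs insubdK//= /in_mem /= asboolT.
have rs : r <> s by move=> rs; apply: (ups_downs ur); rewrite rs.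
have I : insertable (Psi r s U, (r, s)).
  split => //=; split.
  - exact: ups_in ur.
  - rewrite /jumps PE.1 PE.2 => -[[_]|[h _]]; first by apply.
    exact: (ups_downs ur h).
  - exact: downs_in ds.
  - rewrite /jumps PE.1 PE.2 => -[[h _]|[_]]; last by apply.
    exact: (ups_downs h ds).
have [e1 e2] := Psi_insert I.
split => //.
  apply: val_inj.
  have u : ups (Psi r s (Psi r s U)) = ups U.
    rewrite e1 PE.1; apply/seteqP; split => [t [[]//|->//]|t ut].
    by have [->|/eqP tr] := eqVneq t r; [right|left; split].
  have d : downs (Psi r s (Psi r s U)) = downs U.
    rewrite e2 PE.2; apply/seteqP; split => [t [[]//|->//]|t ut].
    by have [->|/eqP tr] := eqVneq t s; [right|left; split].
  by rewrite [LHS]surjective_pairing [RHS]surjective_pairing; congr pair.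
rewrite /npairs PE.1 fset_setD1; last exact: ups_finite.
have := cardfsD1 r (fset_set (ups U)).
by rewrite in_fset_set ?mem_set//; exact: ups_finite.
Qed.

(** Psi may also remove jumps, or do nothing; restricted to vacant times it only
inserts. *)
Definition ins (x : J * (R * R)) : J :=
  if `[< insertable x >] then Psi x.2.1 x.2.2 x.1 else x.1.

Lemma insE x : insertable x -> ins x = Psi x.2.1 x.2.2 x.1.
Proof. by move=> I; rewrite /ins asboolT. Qed.

Lemma count_le_add (F : set R) r t : finite_set F -> ~ F r ->
  count_le (F `|` [set r]) t = (count_le F t + (r <= t)%R)%N.
Proof.
move=> fF Fr; rewrite /count_le; have [rt|tr] := leP r t.
  rewrite addn1 -(@card_add _ r); last 2 first.
  - exact: finite_setIl.
  - by move=> [].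
  congr (#|` fset_set _|); rewrite setIUl; congr (_ `|` _).
  by apply/setIidl => _ ->.
rewrite addn0; congr (#|` fset_set _|); rewrite setIUl [X in _ `|` X](_ : _ = set0) ?setU0//.
by apply/seteqP; split => // _ [-> /=]; rewrite leNgt tr.
Qed.

Lemma ins_path x t : insertable x ->
  jump_path (ins x) t = jump_path x.1 t + (nat_of_bool (x.2.1 <= t)%R)%:Z - (nat_of_bool (x.2.2 <= t)%R)%:Z.
Proof.
move=> I; rewrite insE//; case: x I => U [r s] I.
have [/= u d] := Psi_insert I; have [/= [_ nr] [_ ns] _] := I.
rewrite /jump_path /= /jump_path_fun u d !count_le_add; first by rewrite !PoszD; lia.
- exact: downs_finite.
- by move=> h; apply: ns; right.
- exact: ups_finite.
- by move=> h; apply: nr; left.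
Qed.

Lemma ins_jumps x t : insertable x ->
  jumps (ins x) t <-> [\/ jumps x.1 t, t = x.2.1 | t = x.2.2].
Proof.
move=> I; rewrite insE//; case: x I => U [r s] I.
have [/= u d] := Psi_insert I; rewrite /jumps u d; split.
  by move=> [[h|->]|[h|->]]; [apply: Or31; left|apply: Or32|apply: Or31; right|apply: Or33].
by move=> [[h|h]|->|->]; [left; left|right; left|left; right|right; right].
Qed.

Lemma ins_npairs x : insertable x -> npairs (ins x) = (npairs x.1).+1.
Proof.
move=> I; rewrite insE//; case: x I => U [r s] I.
have [/= u d] := Psi_insert I; have [/= [_ nr] [_ ns] _] := I.
rewrite /npairs u card_add//; first exact: ups_finite.
by move=> h; apply: nr; left.
Qed.

Lemma no_jump_cst U s t : s <= t -> (forall r, s < r <= t -> ~ jumps U r) ->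
  jump_path U s = jump_path U t.
Proof.
move=> st nj; rewrite /jump_path /= /jump_path_fun.
have h (F : set R) : (forall r, F r -> jumps U r) -> count_le F s = count_le F t.
  move=> FJ; rewrite /count_le; congr (#|` fset_set _|).
  apply/seteqP; split => r [Fr] /= rs; split => //=; first exact: le_trans st.
  rewrite leNgt; apply/negP => sr; apply: (nj r); first by rewrite sr.
  exact: FJ.
by rewrite !h// => r ?; [right|left].
Qed.

Lemma jumps_left U t : jumps U t <-> left_value (jump_path U) t <> jump_path U t.
Proof.
rewrite [X in _ <> X]jump_path_jump; split.
  move=> [h|h].
    rewrite (asboolT h) asboolF ?subr0; last by move=> h'; case: (ups_downs h h').
    by move=> /eqP; rewrite eq_sym -subr_eq0 addrAC subrr add0r.
  rewrite (asboolT h) asboolF ?addr0; last by move=> h'; case: (ups_downs h' h).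
  by move=> /eqP; rewrite eq_sym -subr_eq0 addrAC subrr add0r.
move=> ne; apply: contrapT => nj; apply: ne.
by rewrite !asboolF ?subr0 ?addr0// => h; apply: nj; [right|left].
Qed.

Lemma goodP m U : good m U <-> forall i t t', (i < 2 ^ m)%N ->
  pt m i < t <= pt m i.+1 -> pt m i < t' <= pt m i.+1 ->
  jumps U t -> jumps U t' -> t = t'.
Proof.
split=> [gU i t t' im ti ti' j j'|h i im].
  have [u _ [_ _ hu]] := single_jumpP (gU i im).
  have e x : pt m i < x <= pt m i.+1 -> jumps U x -> x = u.
    move=> xi /jumps_left jx; apply/eqP/negPn/negP => /(hu x xi)[]//.
  by rewrite (e t)// (e t').
have pp : pt m i < pt m i.+1 by rewrite ltr_pt.
have [[u [ui ju]]|nj] := pselect (exists u, pt m i < u <= pt m i.+1 /\ jumps U u).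
  exists u => //; case/andP: (ui) => u1 u2; split=> r /andP[r1 r2].
    apply/esym; apply: no_jump_cst => // x /andP[x1 x2] jx.
    have xu : x = u.
      by apply: (h i) => //; rewrite x1 (le_trans x2)// (le_trans (ltW r2)).
    by move: (le_lt_trans x2 r2); rewrite xu ltxx.
  apply: no_jump_cst => // x /andP[x1 x2] jx.
  have xu : x = u.
    by apply: (h i) => //; rewrite x2 (lt_trans _ x1)// (lt_le_trans u1).
  by move: (le_lt_trans r1 x1); rewrite xu ltxx.
exists (pt m i.+1); first by rewrite pp lexx.
split=> r /andP[r1 r2].
  apply/esym; apply: no_jump_cst => // x /andP[x1 x2] jx; apply: nj.
  by exists x; rewrite x1 (le_trans x2)// ltW.
by congr (jump_path U _); apply/le_anti; rewrite r1 r2.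
Qed.

Lemma flatP m U i : good m U -> (i < 2 ^ m)%N ->
  jump_path U (pt m i) = jump_path U (pt m i.+1) <->
  (forall t, pt m i < t <= pt m i.+1 -> ~ jumps U t).
Proof.
move=> gU im; split=> [e t ti jt|nj].
  have [u _ [lu ru hu]] := single_jumpP (gU i im).
  have /jumps_left := jt.
  have [tu|/(hu t ti)[]//] := eqVneq t u.
  by rewrite tu lu ru.
apply: no_jump_cst => //; by rewrite ler_pt.
Qed.

End insertion.

(** * Measurability of the insertion *)

Section insertion_measurable.
Variable R : realType.
Local Notation J := (jump_pair R).
Local Notation pt := (@pt R).
Local Notation mR := (measurableTypeR R).
Implicit Types (U V : J) (r s t : R).

Lemma measurable_flat m i : (i < 2 ^ m)%N ->
  measurable [set U : J | jump_path U (pt m i) = jump_path U (pt m i.+1)].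
Proof.
move=> im; rewrite -[X in measurable X]setTI.
apply: (measurable_jump_path measurableT
  (_ : measurable [set w : skorokhod R | w (pt m i) = w (pt m i.+1)])).
apply: (@measurable_coord2 R _ _ eq); apply: pt_01 => //; exact: ltnW.
Qed.

(** A fine enough cell around a vacant time is free of jumps. *)
Lemma vacant_flat U r : vacant U r -> exists m i, [/\ (i < 2 ^ m)%N, good m U,
  pt m i < r <= pt m i.+1 & jump_path U (pt m i) = jump_path U (pt m i.+1)].
Proof.
move=> [r01 nj].
have [r0 r1] : 0 < r /\ r < 1 by case/andP: r01.
have r01' : 0 < r <= 1 by rewrite r0 ltW.
have [d1 d10 h1] := left_value_near (jump_path U) r01'.
have [|d2 [k2 [d20 _ h2]]] := @cadlag_local R (jump_path U) r (path_cadlag _).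
  by rewrite !ltW.
have [m1 gU] := good_eventually U.
have [m2 _ hm2] := near_pow2 d10; have [m3 _ hm3] := near_pow2 d20.
pose m := maxn m1 (maxn m2 m3).
have [mm1 mm2 mm3] : [/\ m1 <= m, m2 <= m & m3 <= m]%N.
  by rewrite /m !leq_max !leqnn ?orbT; split.
have [i im /andP[i1 i2]] := grid_cellP m r01'.
exists m, i; split => //; first exact: good_le mm1 _ gU.
  by rewrite i1.
have := hm2 _ mm2; have := hm3 _ mm3 => l3 l2; rewrite ptS in i2.
rewrite h1; last by apply/andP; split; lra.
rewrite h2; last by rewrite ptS; apply/andP; split; lra.
by apply: contrapT => ne; apply: nj; apply/jumps_left.
Qed.

Lemma measurable_vacant : measurable [set x : J * mR | vacant x.1 x.2].
Proof.
rewrite (_ : [set _ | _] = \bigcup_(mi in [set mi : nat * nat | (mi.2 < 2 ^ mi.1)%N])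
  ((good mi.1 `&` [set U : J | jump_path U (pt mi.1 mi.2) = jump_path U (pt mi.1 mi.2.+1)])
   `*` (`]pt mi.1 mi.2, pt mi.1 mi.2.+1]%classic `&` `]0, 1[%classic))).
  apply: countable_bigcup_measurable => -[m i] /= im; apply: measurableX.
    by apply: measurableI; [exact: measurable_good|exact: measurable_flat].
  by apply: measurableI; exact: measurable_itv.
apply/seteqP; split => [[U r] /= fr|[U r] [[m i] /= im [[gU fl] [ri r01]]]].
  have [m [i [im gU ri fl]]] := vacant_flat fr; exists (m, i) => //=.
  by split => //; split; rewrite /= in_itv /=; [exact: ri|exact: fr.1].
rewrite !in_itv /= in ri r01; split => //.
by have /(flatP gU im) := fl; apply.
Qed.

Lemma measurable_insertable : measurable (@insertable R : set (J * (mR * mR))).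
Proof.
pose f1 (x : J * (mR * mR)) : J * mR := (x.1, x.2.1).
pose f2 (x : J * (mR * mR)) : J * mR := (x.1, x.2.2).
have m1 : measurable_fun setT f1.
  by apply: measurable_fun_pair => //; exact: measurableT_comp.
have m2 : measurable_fun setT f2.
  by apply: measurable_fun_pair => //; exact: measurableT_comp.
pose F := [set x : J * mR | vacant x.1 x.2].
have md : measurable [set x : J * (mR * mR) | x.2.1 <> x.2.2].
  have -> : [set x : J * (mR * mR) | x.2.1 <> x.2.2] =
     [set: J] `*` ~` [set y : mR * mR | y.1 - y.2 = 0].
    apply/seteqP; split => [x /= ne|x [_ /= ne]]; last first.
      by move=> e; apply: ne; rewrite e subrr.
    by split => //= /eqP; rewrite subr_eq0 => /eqP.
  apply: measurableX => //; apply: measurableC.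
  have mf : measurable_fun setT (fun y : mR * mR => (y.1 - y.2 : mR)).
    by apply: measurable_funB.
  have := mf measurableT _ (measurable_set1 (0 : R)).
  by rewrite setTI.
rewrite (_ : @insertable R = (f1 @^-1` F) `&` (f2 @^-1` F) `&`
   [set x : J * (mR * mR) | x.2.1 <> x.2.2]).
  apply: measurableI => //; apply: measurableI; rewrite -[X in measurable X]setTI.
    by apply: m1 => //; exact: measurable_vacant.
  by apply: m2 => //; exact: measurable_vacant.
by apply/seteqP; split => [x []|x [[]]]; split.
Qed.

Lemma measurable_ins : measurable_fun setT (@ins R : J * (mR * mR) -> J).
Proof.
move=> _ A [B mB <-]; rewrite !setTI.
pose C : set (set (skorokhod R)) :=
  [set B | measurable ((@jump_path R \o @ins R) @^-1` B : set (J * (mR * mR)))].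
suff : history 1 `<=` C by move=> /(_ B mB).
apply: smallest_sub.
  split.
  - by rewrite /C /= preimage_set0.
  - by move=> D; rewrite /C /= setTD preimage_setC => /measurableC.
  - by move=> F h; rewrite /C /= preimage_bigcup; exact: bigcupT_measurable.
move=> _ [t [k [t01 ->]]]; rewrite /C /=.
have mG := measurable_insertable.
have mX j : measurable [set x : J * (mR * mR) | jump_path x.1 t = j].
  have -> : [set x : J * (mR * mR) | jump_path x.1 t = j] =
     [set U : J | jump_path U t = j] `*` [set: mR * mR].
    by apply/seteqP; split => [x|x []].
  apply: measurableX => //; rewrite -[X in measurable X]setTI.
  exact: (measurable_jump_path measurableT (measurable_coord j t01)).
have mr (b : bool) : measurable [set x : J * (mR * mR) | (x.2.1 <= t) = b].
  have -> : [set x : J * (mR * mR) | (x.2.1 <= t) = b] =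
     [set: J] `*` ((if b then `]-oo, t]%classic else `]t, +oo[%classic) `*` [set: mR]).
    apply/seteqP; split => [x /= e|x [_ [/= + _]]].
      split => //; split => //=; case: b e => e; rewrite /= in_itv /= ?andbT//.
      by rewrite ltNge e.
    by case: b => /=; rewrite in_itv /= ?andbT// => h; rewrite leNgt h.
  by apply: measurableX => //; apply: measurableX => //; case: b.
have ms (b : bool) : measurable [set x : J * (mR * mR) | (x.2.2 <= t) = b].
  have -> : [set x : J * (mR * mR) | (x.2.2 <= t) = b] =
     [set: J] `*` ([set: mR] `*` (if b then `]-oo, t]%classic else `]t, +oo[%classic)).
    apply/seteqP; split => [x /= e|x [_ [/= _ +]]].
      split => //; split => //=; case: b e => e; rewrite /= in_itv /= ?andbT//.
      by rewrite ltNge e.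
    by case: b => /=; rewrite in_itv /= ?andbT// => h; rewrite leNgt h.
  by apply: measurableX => //; apply: measurableX => //; case: b.
rewrite (_ : _ @^-1` _ = (~` (@insertable R) `&` [set x | jump_path x.1 t = k]) `|`
  (@insertable R `&` \bigcup_(b in [set: bool * bool])
     ([set x | (x.2.1 <= t) = b.1] `&` [set x | (x.2.2 <= t) = b.2] `&`
      [set x | jump_path x.1 t = k - (nat_of_bool b.1)%:Z + (nat_of_bool b.2)%:Z]))).
  apply: measurableU; apply: measurableI => //; first exact: measurableC.
  apply: countable_bigcup_measurable => -[b1 b2] _ /=.
  by apply: measurableI => //; apply: measurableI.
apply/seteqP; split => x.
  move=> xk; have [I|nI] := pselect (insertable x).
    right; split => //; exists (x.2.1 <= t, x.2.2 <= t) => //; split => //=.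
    have : jump_path (ins x) t = k := xk.
    rewrite ins_path// => <-; rewrite /mkset; ring.
  left; split => //; have : jump_path (ins x) t = k := xk.
  by rewrite /ins asboolF.
move=> [[nI xk]|[I [[b1 b2] _ [[/= e1 e2] e3]]]].
  by change (jump_path (ins x) t = k); rewrite /ins asboolF.
change (jump_path (ins x) t = k); rewrite ins_path// e1 e2.
have -> : jump_path x.1 t = k - (nat_of_bool b1)%:Z + (nat_of_bool b2)%:Z := e3.
ring.
Qed.

End insertion_measurable.

(** * Boxes under insertion *)

Section insertion_boxes.
Variable R : realType.
Local Notation J := (jump_pair R).
Local Notation pt := (@pt R).
Local Notation mR := (measurableTypeR R).
Implicit Types (U V : J) (r s t : R).

Lemma le_pt_cell m i l r : pt m i < r <= pt m i.+1 -> (r <= pt m l) = (i < l)%N.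
Proof.
move=> /andP[r1 r2]; apply/idP/idP => h.
  by rewrite -(ltr_pt R m) (lt_le_trans r1).
by rewrite (le_trans r2)// ler_pt.
Qed.

Lemma ins_skeleton m i j l (x : J * (R * R)) : insertable x ->
  pt m i < x.2.1 <= pt m i.+1 -> pt m j < x.2.2 <= pt m j.+1 ->
  jump_path (ins x) (pt m l) =
  jump_path x.1 (pt m l) + (nat_of_bool (i < l)%N)%:Z - (nat_of_bool (j < l)%N)%:Z.
Proof. by move=> I xi xj; rewrite ins_path// (le_pt_cell l xi) (le_pt_cell l xj). Qed.

Lemma ins_good m i j (x : J * (R * R)) : insertable x -> (i < 2 ^ m)%N -> (j < 2 ^ m)%N ->
  pt m i < x.2.1 <= pt m i.+1 -> pt m j < x.2.2 <= pt m j.+1 ->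
  good m (ins x) <-> [/\ good m x.1, i != j,
    forall t, pt m i < t <= pt m i.+1 -> ~ jumps x.1 t &
    forall t, pt m j < t <= pt m j.+1 -> ~ jumps x.1 t].
Proof.
move=> I im jm xi xj; have [[_ nr] [_ ns] rs] := I.
have jr : jumps (ins x) x.2.1 by apply/(ins_jumps _ I); apply: Or32.
have js : jumps (ins x) x.2.2 by apply/(ins_jumps _ I); apply: Or33.
have jx t : jumps x.1 t -> jumps (ins x) t by move=> h; apply/(ins_jumps _ I); apply: Or31.
split=> [/goodP g|[/goodP g ij ni nj]].
  split.
  - by apply/goodP => l t t' lm tl tl' jt jt'; exact: (g l t t' lm tl tl' (jx _ jt) (jx _ jt')).
  - apply/eqP => ij; apply: rs; rewrite -ij in xj.
    exact: (g i _ _ im xi xj jr js).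
  - move=> t ti jt; apply: nr.
    by rewrite -(g i _ _ im ti xi (jx _ jt) jr).
  - move=> t tj jt; apply: ns.
    by rewrite -(g j _ _ jm tj xj (jx _ jt) js).
have cell k l t : pt m k < t <= pt m k.+1 -> pt m l < t <= pt m l.+1 -> k = l.
  move=> /andP[k1 k2] /andP[l1 l2].
  have : (k < l.+1)%N by rewrite -(ltr_pt R m) (lt_le_trans k1).
  have : (l < k.+1)%N by rewrite -(ltr_pt R m) (lt_le_trans l1).
  by rewrite !ltnS => lk kl; apply/eqP; rewrite eqn_leq lk kl.
apply/goodP => l t t' lm tl tl' /(ins_jumps _ I) jt /(ins_jumps _ I) jt'.
case: jt => [jt|tr|ts]; case: jt' => [jt'|tr'|ts'].
- exact: (g l t t' lm tl tl' jt jt').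
- by rewrite tr' in tl'; rewrite -(cell _ _ _ xi tl') in tl; case: (ni t tl).
- by rewrite ts' in tl'; rewrite -(cell _ _ _ xj tl') in tl; case: (nj t tl).
- by rewrite tr in tl; rewrite -(cell _ _ _ xi tl) in tl'; case: (ni t' tl').
- by rewrite tr tr'.
- rewrite tr in tl; rewrite ts' in tl'; move/eqP: ij.
  by rewrite (cell _ _ _ xi tl) (cell _ _ _ xj tl').
- by rewrite ts in tl; rewrite -(cell _ _ _ xj tl) in tl'; case: (nj t' tl').
- rewrite ts in tl; rewrite tr' in tl'; move/eqP: ij.
  by rewrite (cell _ _ _ xj tl) (cell _ _ _ xi tl').
- by rewrite ts ts'.
Qed.

Definition up_step m U i := jump_path U (pt m i.+1) == jump_path U (pt m i) + 1.
Definition down_step m U i := jump_path U (pt m i.+1) == jump_path U (pt m i) - 1.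

(** The box of the jump pair obtained from U by removing an up-jump in the cell i
and a down-jump in the cell j. *)
Definition less_box m U i j : set J := [set V | good m V /\ forall l, (l <= 2 ^ m)%N ->
  jump_path V (pt m l) =
  jump_path U (pt m l) - (nat_of_bool (i < l)%N)%:Z + (nat_of_bool (j < l)%N)%:Z].

Definition icell m i : set mR := `]pt m i, pt m i.+1]%classic `&` `]0, 1[%classic.

Lemma less_box_in m U i j (x : J * (R * R)) : insertable x -> (i < 2 ^ m)%N -> (j < 2 ^ m)%N ->
  pt m i < x.2.1 <= pt m i.+1 -> pt m j < x.2.2 <= pt m j.+1 ->
  jbox m U (ins x) -> [/\ up_step m U i, down_step m U j & less_box m U i j x.1].
Proof.
move=> I im jm xi xj [g /skeletonP s].
have [gx ij ni nj] := (ins_good I im jm xi xj).1 g.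
have K l : (l <= 2 ^ m)%N -> jump_path U (pt m l) =
   jump_path x.1 (pt m l) + (nat_of_bool (i < l)%N)%:Z - (nat_of_bool (j < l)%N)%:Z.
  by move=> lm; rewrite -s// (ins_skeleton l I xi xj).
have fi := (flatP gx im).2 ni; have fj := (flatP gx jm).2 nj.
split.
- rewrite /up_step (K i.+1)// (K i (ltnW im)) -fi !ltnS ltnn leqnn.
  have -> : (j <= i)%N = (j < i)%N by rewrite leq_eqVlt eq_sym (negbTE ij).
  by apply/eqP; lia.
- rewrite /down_step (K j.+1)// (K j (ltnW jm)) -fj !ltnS ltnn leqnn.
  have -> : (i <= j)%N = (i < j)%N by rewrite leq_eqVlt (negbTE ij).
  by apply/eqP; lia.
by split => // l lm; rewrite K//; lia.
Qed.

Lemma less_box_out m U i j (x : J * (R * R)) : (i < 2 ^ m)%N -> (j < 2 ^ m)%N ->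
  icell m i x.2.1 -> icell m j x.2.2 -> up_step m U i -> down_step m U j ->
  less_box m U i j x.1 -> insertable x /\ jbox m U (ins x).
Proof.
move=> im jm [xi x1] [xj x2] /eqP ui /eqP dj [gx K].
rewrite /= !in_itv /= in xi x1 xj x2.
have ij : i != j.
  apply/eqP => ij; move: dj; rewrite -ij ui => /addrI; by [].
have fi : jump_path x.1 (pt m i) = jump_path x.1 (pt m i.+1).
  rewrite !K// ?(ltnW im)// ui !ltnS ltnn leqnn.
  have -> : (j <= i)%N = (j < i)%N by rewrite leq_eqVlt eq_sym (negbTE ij).
  by lia.
have fj : jump_path x.1 (pt m j) = jump_path x.1 (pt m j.+1).
  rewrite !K// ?(ltnW jm)// dj !ltnS ltnn leqnn.
  have -> : (i <= j)%N = (i < j)%N by rewrite leq_eqVlt (negbTE ij).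
  by lia.
have ni := (flatP gx im).1 fi; have nj := (flatP gx jm).1 fj.
have I : insertable x.
  split; [split => //; exact: ni|split => //; exact: nj|].
  move=> e; rewrite e in xi; move/eqP: ij; apply.
  case/andP: xi => i1 i2; case/andP: xj => j1 j2.
  have : (i < j.+1)%N by rewrite -(ltr_pt R m) (lt_le_trans i1).
  have : (j < i.+1)%N by rewrite -(ltr_pt R m) (lt_le_trans j1).
  by rewrite !ltnS => ji i'j; apply/eqP; rewrite eqn_leq ji i'j.
split => //; split; first exact: (ins_good I im jm xi xj).2.
apply/skeletonP => l lm; rewrite (ins_skeleton l I xi xj) K//; lia.
Qed.

(** An insertion leads to the box of U exactly when the inserted times provide
the up-jump of a cell i and the down-jump of a cell j, the rest being in the box
with those two removed. *)
Lemma insertion_decomposition m U :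
  @insertable R `&` @ins R @^-1` (jbox m U) =
  \big[setU/set0]_(i < 2 ^ m | up_step m U i) \big[setU/set0]_(j < 2 ^ m | down_step m U j)
     (less_box m U i j `*` (icell m i `*` icell m j)).
Proof.
apply/seteqP; split => x.
  move=> [I jx]; have [[r01 _] [s01 _] _] := I.
  have cell t : 0 < t < 1 -> exists2 i, (i < 2 ^ m)%N & icell m i t.
    move=> /andP[t0 t1]; have [|i im it] := @grid_cellP R m t; first by rewrite t0 ltW.
    by exists i => //; split; rewrite /= in_itv/= ?t0.
  have [i im xi] := cell _ r01; have [j jm xj] := cell _ s01.
  have xi' : pt m i < x.2.1 <= pt m i.+1 by case: xi; rewrite /= !in_itv /=.
  have xj' : pt m j < x.2.2 <= pt m j.+1 by case: xj; rewrite /= !in_itv /=.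
  have [ui dj lx] := less_box_in I im jm xi' xj' jx.
  rewrite -bigcup_seq_cond; exists (Ordinal im); first by rewrite /= mem_index_enum.
  rewrite -bigcup_seq_cond; exists (Ordinal jm); first by rewrite /= mem_index_enum.
  by split.
rewrite -bigcup_seq_cond => -[i /andP[_ ui]].
rewrite -bigcup_seq_cond => -[j /andP[_ dj] [lx [xi xj]]].
exact: less_box_out lx.
Qed.

End insertion_boxes.

Section uniform_law.
Variable R : realType.
Local Notation pt := (@pt R).
Local Notation mR := (measurableTypeR R).
Local Notation leb := (@lebesgue_measure R).

Lemma measurable_01 : measurable (`]0%R, 1%R[%classic : set mR).
Proof. exact: measurable_itv. Qed.

Definition unif := mrestr leb measurable_01.

HB.instance Definition _ := Measure.on unif.

Let unif_setT : unif setT = 1%E.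
Proof.
rewrite /unif /mrestr setTI lebesgue_measure_itv /= lte_fin ltr01.
by rewrite oppr0 adde0.
Qed.

HB.instance Definition _ := Measure_isProbability.Build _ _ _ unif unif_setT.

Lemma measurable_icell m i : measurable (@icell R m i).
Proof. by apply: measurableI; exact: measurable_itv. Qed.

Lemma unif_icell m i : (i < 2 ^ m)%N -> unif (@icell R m i) = ((2 ^+ m)^-1)%:E.
Proof.
move=> im; rewrite /unif /mrestr /icell -setIA setIid.
have step : pt m i.+1 - pt m i = (2 ^+ m)^-1 by exact: pt_step.
have lt : pt m i < pt m i.+1 by rewrite ltr_pt.
move: im; rewrite leq_eqVlt => /orP[/eqP iN|iN].
  rewrite (_ : _ `&` _ = `]pt m i, pt m i.+1[%classic).
    by rewrite lebesgue_measure_itv /= lte_fin lt -EFinB step.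
  have e1 : pt m i.+1 = 1 by rewrite iN pt1.
  rewrite e1; apply/seteqP; split => x /=; rewrite !in_itv /=.
    by move=> [/andP[-> _] /andP[_ ->]].
  by move=> /andP[x1 x2]; rewrite x1 x2 ltW// (le_lt_trans _ x1)// pt_ge0.
rewrite setIidl.
  by rewrite lebesgue_measure_itv /= lte_fin lt -EFinB step.
move=> x /=; rewrite !in_itv /= => /andP[x1 x2].
by rewrite (le_lt_trans _ x1) ?pt_ge0//= (le_lt_trans x2)// -(pt1 R m) ltr_pt.
Qed.

End uniform_law.
Arguments unif R : clear implicits.

(** The law of a uniform pair of times; its declared type is what gives products
with it their structure of measure. *)
Definition unif2 (R : realType) :
    probability (measurableTypeR R * measurableTypeR R)%type R :=
  (unif R \x unif R)%E.
Arguments unif2 R : clear implicits.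

Lemma unif2X (R : realType) (A B : set (measurableTypeR R)) :
  measurable A -> measurable B ->
  unif2 R (A `*` B) = (unif R A * unif R B)%E.
Proof. by move=> mA mB; rewrite [LHS]product_measure1E. Qed.

Section mecke.
Variable R : realType.
Local Notation T := (skorokhod R).
Local Notation J := (jump_pair R).
Local Notation pt := (@pt R).
Local Notation mR := (measurableTypeR R).
Implicit Types (U V : J).
Variable Q : probability T R.
Hypothesis QG : has_generator (fun=> 1) (fun=> 1) Q.
Local Notation nu := (bridge_mass Q).
Local Notation q A := (fine (Q A)).
Local Notation q0 := (q [set w : T | w 0 = 0]).

Local Notation prod := (nu \x unif2 R)%E.

Definition inserted (A : set J) : \bar R := prod (@insertable R `&` @ins R @^-1` A).

Let measurable_inserted (A : set J) : measurable A ->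
  measurable (@insertable R `&` @ins R @^-1` A : set (J * (mR * mR))).
Proof.
move=> mA; apply: measurableI; first exact: measurable_insertable.
by rewrite -[X in measurable X]setTI; exact: measurable_ins.
Qed.

Let inserted0 : inserted set0 = 0%E.
Proof.
by rewrite /inserted preimage_set0 setI0 measure0.
Qed.

Let inserted_ge0 A : (0 <= inserted A)%E.
Proof. exact: measure_ge0. Qed.

Let inserted_sigma_additive : semi_sigma_additive inserted.
Proof.
move=> F mF tF mUF; rewrite /inserted preimage_bigcup setI_bigcupr.
apply: measure_semi_sigma_additive.
- by move=> n; exact: measurable_inserted.
- apply/trivIsetP => /= i j _ _ ij; rewrite setIACA -preimage_setI.
  by move/trivIsetP : tF => /(_ _ _ I I ij) ->; rewrite preimage_set0 setI0.
- by apply: bigcupT_measurable => n; exact: measurable_inserted.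
Qed.

HB.instance Definition _ := isMeasure.Build _ _ _ inserted
  inserted0 inserted_ge0 inserted_sigma_additive.

Lemma inserted_total : (inserted setT <= nu setT)%E.
Proof.
rewrite /inserted preimage_setT setIT.
have mG := @measurable_insertable R.
apply: (@le_trans _ _ (prod setT)); first by apply: le_measure; rewrite ?inE.
rewrite -setXTT product_measure1E// -[X in (_ <= X)%E]mule1.
by rewrite [X in (_ * X)%E]probability_setT.
Qed.

Lemma measurable_npairs_fun (g : nat -> R) :
  measurable_fun setT (fun U : J => g (npairs U)).
Proof.
move=> _ B mB; rewrite setTI.
rewrite (_ : _ @^-1` B = \bigcup_(n in [set n | B (g n)]) [set U | npairs U = n]).
  by apply: bigcup_measurable => n _; exact: measurable_npairs.
apply/seteqP; split => [U BU|U [n Bn /= Un]]; first by exists (npairs U).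
by rewrite /preimage /= Un.
Qed.

(** The pair V is U without the up-jump of the cell i and the down-jump of the
cell j. *)
Lemma less_boxE m U i j : good m U -> (i < 2 ^ m)%N -> (j < 2 ^ m)%N ->
  up_step m U i -> down_step m U j ->
  exists V, [/\ npairs U = (npairs V).+1, good m V & less_box m U i j = jbox m V].
Proof.
move=> gU im jm /eqP ui /eqP dj.
have [t ti [tl tr _]] := single_jumpP (gU i im).
have [s si [sl sr _]] := single_jumpP (gU j jm).
have ut : ups U t.
  have := jump_path_jump U t; rewrite tl tr ui.
  case: (asboolP (ups U t)) => // _; case: (asboolP (downs U t)) => _ /=; lia.
have ds : downs U s.
  have := jump_path_jump U s; rewrite sl sr dj.
  case: (asboolP (downs U s)) => // _; case: (asboolP (ups U s)) => _ /=; lia.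
have [I e n] := Psi_remove ut ds.
have iE : ins (Psi t s U, (t, s)) = U by rewrite insE.
exists (Psi t s U).
have [] := @less_box_in R m U i j _ I im jm ti si; first by rewrite iE; split.
move=> _ _ [gV K]; split => //.
apply/seteqP; split => W [gW KW]; split => //.
  by apply/skeletonP => l lm; rewrite KW// -K.
by move=> l lm; move/skeletonP: KW => ->//; exact: K.
Qed.

Lemma icell_trivIset m (P : pred 'I_(2 ^ m)) :
  trivIset [set i | P i] (fun i : 'I_(2 ^ m) => @icell R m i).
Proof.
move=> i j _ _ [x [[/= + _] [/= + _]]]; rewrite !in_itv /= => /andP[i1 i2] /andP[j1 j2].
apply/val_inj => /=.
have : (i < j.+1)%N by rewrite -(ltr_pt R m) (lt_le_trans i1).
have : (j < i.+1)%N by rewrite -(ltr_pt R m) (lt_le_trans j1).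
by rewrite !ltnS => ji i'j; apply/eqP; rewrite eqn_leq ji i'j.
Qed.

Lemma measurable_less_box m U i j : good m U -> (i < 2 ^ m)%N -> (j < 2 ^ m)%N ->
  up_step m U i -> down_step m U j -> measurable (less_box m U i j).
Proof.
move=> gU im jm ui dj; have [V [_ _ ->]] := less_boxE gU im jm ui dj.
exact: measurable_jbox.
Qed.

Lemma inserted_jbox m U : good m U ->
  inserted (jbox m U) = (\sum_(i < 2 ^ m | up_step m U i)
     \sum_(j < 2 ^ m | down_step m U j)
        nu (less_box m U i j) * (((2 ^+ m)^-1 * (2 ^+ m)^-1)%:E))%E.
Proof.
move=> gU; rewrite /inserted insertion_decomposition.
have mL (i j : 'I_(2 ^ m)) : up_step m U i -> down_step m U j ->
    measurable (less_box m U i j `*` (@icell R m i `*` @icell R m j) : set (J * (mR * mR))).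
  move=> ui dj; apply: measurableX; first exact: measurable_less_box.
  by apply: measurableX; exact: measurable_icell.
rewrite measure_bigsetU_ord_cond; last 2 first.
- move=> i ui; apply: bigsetU_measurable => j dj; exact: mL.
- move=> i i' ui ui' [x []]; rewrite -!bigcup_seq_cond.
  move=> [j _ [_ [xi _]]] [j' _ [_ [xi' _]]].
  by apply: (@icell_trivIset m xpredT) => //; exists x.2.1.
apply: eq_bigr => i ui; rewrite measure_bigsetU_ord_cond; last 2 first.
- by move=> j dj; exact: mL.
- move=> j j' dj dj' [x [[_ [_ xj]] [_ [_ xj']]]].
  by apply: (@icell_trivIset m xpredT) => //; exists x.2.2.
apply: eq_bigr => j dj.
have mc k := @measurable_icell R m k.
have mlb := measurable_less_box gU (ltn_ord i) (ltn_ord j) ui dj.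
transitivity (nu (less_box m U i j) * unif2 R (@icell R m i `*` @icell R m j))%E.
  by apply: product_measure1E => //; exact: measurableX.
by congr (_ * _)%E; rewrite unif2X// !unif_icell.
Qed.

End mecke.

(** * The Mecke formula *)

Lemma sum_cond_const (R : realType) N (P : pred 'I_N) (c : R) :
  \sum_(i < N | P i) c = (\sum_(i < N | P i) 1)%N%:R * c.
Proof. by rewrite natr_sum mulr_suml; apply: eq_bigr => i _; rewrite mul1r. Qed.

Section mecke.
Variable R : realType.
Local Notation T := (skorokhod R).
Local Notation J := (jump_pair R).
Local Notation pt := (@pt R).
Local Notation mR := (measurableTypeR R).
Implicit Types (U V : J).
Variable Q : probability T R.
Hypothesis QG : has_generator (fun=> 1) (fun=> 1) Q.
Local Notation nu := (bridge_mass Q).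
Local Notation q A := (fine (Q A)).
Local Notation q0 := (q [set w : T | w 0 = 0]).

Let l01 : forall j : int, 0 < (fun=> 1 : R) j. Proof. by move=> j; exact: ltr01. Qed.

Lemma up_steps m U : good m U -> (\sum_(i < 2 ^ m | up_step m U i) 1)%N = npairs U.
Proof.
move=> gU; rewrite /npairs (@npairs_steps R U m 1 (ups U))//; first exact: jump_times_up.
exact: ups_finite.
Qed.

Lemma down_steps m U : good m U -> (\sum_(i < 2 ^ m | down_step m U i) 1)%N = npairs U.
Proof.
move=> gU; rewrite -npairs_downs (@npairs_steps R U m (-1) (downs U))//; first exact: jump_times_down.
exact: downs_finite.
Qed.

Local Notation sq U := ((npairs U)%:R ^+ 2 : R).

Let msq : measurable_fun setT (fun U : J => sq U).
Proof. exact: (measurable_npairs_fun (fun n => n%:R ^+ 2)). Qed.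

Let sq0 (U : J) : 0 <= sq U. Proof. exact: exprn_ge0. Qed.

Local Notation W := (weighted nu msq sq0).

Lemma weighted_jbox m U : good m U ->
  W (jbox m U) = (sq U * q (box m U))%:E.
Proof.
move=> gU; rewrite /weighted (eq_integral (fun=> (sq U)%:E)); last first.
  by move=> V; rewrite inE => UV; rewrite (jbox_npairs gU UV).
have mj := @measurable_jbox R m U.
have bQ : nu (jbox m U) = (q (box m U))%:E by exact: (bridge_mass_jbox l01 l01 QG).
transitivity ((sq U)%:E * nu (jbox m U))%E; first exact: integral_cst.
by rewrite bQ.
Qed.

Lemma inserted_jbox_bounds n : exists C : R, exists m0 : nat, forall m U, (m0 <= m)%N ->
  npairs U = n -> good m U -> exists x : R, [/\ inserted Q (jbox m U) = x%:E,
    n%:R ^+ 2 * (q0 * (expR (- 2) * (2 ^+ m)^-1 ^+ n.*2)) * expR (- (C / 2 ^+ m)) <= x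
    & x <= n%:R ^+ 2 * (q0 * (expR (- 2) * (2 ^+ m)^-1 ^+ n.*2)) * expR (C / 2 ^+ m)].
Proof.
have [C [m0 H]] := key_estimate l01 l01 QG n.-1.
exists C, m0 => m U mm Un gU.
pose h : R := (2 ^+ m)^-1.
have h0 : 0 <= h by rewrite invr_ge0 exprn_ge0.
pose x i j := fine (nu (less_box m U i j)) * (h * h).
exists (\sum_(i < 2 ^ m | up_step m U i) \sum_(j < 2 ^ m | down_step m U j) x i j).
have L (i j : 'I_(2 ^ m)) : up_step m U i -> down_step m U j ->
  [/\ nu (less_box m U i j) = (fine (nu (less_box m U i j)))%:E,
      (q0 * (expR (- 2) * h ^+ n.*2)) * expR (- (C / 2 ^+ m)) <= x i j
    & x i j <= (q0 * (expR (- 2) * h ^+ n.*2)) * expR (C / 2 ^+ m)].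
  move=> ui dj; have [V [nV gV e]] := less_boxE gU (ltn_ord i) (ltn_ord j) ui dj.
  have bV := bridge_mass_jbox l01 l01 QG m V.
  have Vn : npairs V = n.-1 by rewrite -Un nV.
  have := H m mm V Vn gV; rewrite M11 -/h => /andP[h1 h2].
  have hh : 0 <= h * h by rewrite mulr_ge0.
  have nS : n = n.-1.+1 by rewrite -Un nV.
  have E c : q0 * (expR (- 2) * h ^+ n.*2) * c =
      q0 * (expR (- 2) * h ^+ n.-1.*2) * c * (h * h).
    by rewrite [in LHS]nS doubleS !exprSr; ring.
  rewrite !E /x e bV /=; split => //; exact: ler_wpM2r.
have S (c : R) : n%:R ^+ 2 * c = \sum_(i < 2 ^ m | up_step m U i) \sum_(j < 2 ^ m | down_step m U j) c.
  have D : \sum_(j < 2 ^ m | down_step m U j) c = n%:R * c.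
    by rewrite -Un -(down_steps gU); exact: sum_cond_const.
  rewrite (eq_bigr (fun=> n%:R * c)) => [|i _]; last exact: D.
  rewrite expr2 -mulrA -[X in X%:R * _]Un -(up_steps gU).
  by apply/esym; exact: sum_cond_const.
split.
- rewrite (inserted_jbox Q gU) -/h -sumEFin; apply: eq_bigr => i ui.
  rewrite -sumEFin; apply: eq_bigr => j dj.
  by have [-> _ _] := L i j ui dj; rewrite -EFinM.
- rewrite -mulrA S; apply: ler_sum => i ui; apply: ler_sum => j dj.
  by have [_ + _] := L i j ui dj.
- rewrite -mulrA S; apply: ler_sum => i ui; apply: ler_sum => j dj.
  by have [_ _] := L i j ui dj.
Qed.

(** The n^2 boxes obtained by removing a pair of jumps from the box of U have mass
larger by the factor 1 / h^2, to leading order, and h^2 is the probability that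
inserting a uniform pair of times leads back to the box of U. *)
Lemma mecke_set (A : set J) : measurable A ->
  inserted Q A = (\int[nu]_(U in A) (sq U)%:E)%E.
Proof.
move=> mA; change (inserted Q A = W A); apply: box_unique => //; last first.
  apply: (le_lt_trans (inserted_total Q)).
  by rewrite -ge0_fin_numE//; apply: bridge_mass_fin.
move=> n.
have [C1 [m1 H1]] := inserted_jbox_bounds n.
have [C2 [m2 H2]] := key_estimate l01 l01 QG n.
exists (C1 + C2), (maxn m1 m2) => m U mm Un gU.
have [mm1 mm2] : (m1 <= m)%N /\ (m2 <= m)%N by move: mm; rewrite geq_max => /andP[].
have [x [xE x1 x2]] := H1 m U mm1 Un gU.
have := H2 m mm2 U Un gU; rewrite M11 => /andP[q1 q2].
suff : (inserted Q (jbox m U) <=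
       (expR ((C1 + C2) / 2 ^+ m))%:E * W (jbox m U))%E /\
     (W (jbox m U) <=
       (expR ((C1 + C2) / 2 ^+ m))%:E * inserted Q (jbox m U))%E by [].
rewrite (weighted_jbox gU) xE -!EFinM !lee_fin mulrDl expRD Un.
set X := q0 * _ in x1 x2 q1 q2.
set e1 := expR (C1 / _) in x2 *; set e2 := expR (C2 / _) in q2 *.
have n0 : 0 <= n%:R ^+ 2 :> R by rewrite exprn_ge0.
have e10 : 0 <= e1 by exact: expR_ge0.
have e20 : 0 <= e2 by exact: expR_ge0.
have E1 : expR (- (C1 / 2 ^+ m)) * e1 = 1 by rewrite -expRD addNr expR0.
have E2 : expR (- (C2 / 2 ^+ m)) * e2 = 1 by rewrite -expRD addNr expR0.
split.
  apply: (le_trans x2).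
  have := ler_wpM2l (mulr_ge0 (mulr_ge0 n0 e10) e20) q1.
  congr (_ <= _); last by ring.
  transitivity (n%:R ^+ 2 * X * e1 * (expR (- (C2 / 2 ^+ m)) * e2)); first by ring.
  by rewrite E2 mulr1.
apply: (le_trans (ler_wpM2l n0 q2)).
have := ler_wpM2l (mulr_ge0 e10 e20) x1.
congr (_ <= _).
transitivity (n%:R ^+ 2 * X * e2 * (expR (- (C1 / 2 ^+ m)) * e1)); first by ring.
by rewrite E1 mulr1; ring.
Qed.

Local Notation G := (@insertable R : set (J * (mR * mR))).

Let mG : measurable_fun setT (\1_G : J * (mR * mR) -> R).
Proof. by apply: measurable_indic; exact: measurable_insertable. Qed.

Let G0 x : 0 <= (\1_G x : R).
Proof. by rewrite indicE. Qed.

Let mins : measurable_fun setT (@ins R : J * (mR * mR) -> J) := @measurable_ins R.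

(** Integrates [mecke_set]: [inserted] is the image, under insertion, of a
restriction of the product measure. *)
Lemma mecke (F : J -> \bar R) : (forall U, 0 <= F U)%E -> measurable_fun setT F ->
  (\int[nu]_U (F U * (sq U)%:E) =
   \int[nu]_V \int[unif2 R]_rs (F (ins (V, rs)) * (\1_G (V, rs))%:E))%E.
Proof.
move=> F0 mF.
rewrite -(ge0_integral_density (mu := inserted Q) msq sq0 mecke_set F0 mF).
pose prod := (nu \x unif2 R)%E.
rewrite (eq_measure_integral (pushforward (weighted prod mG G0) (@ins R))); last first.
  move=> A mA _.
  transitivity (\int[prod]_(x in @ins R @^-1` A) (\1_G x)%:E)%E => //.
  have mA' : measurable (@ins R @^-1` A : set (J * (mR * mR))).
    by rewrite -[X in measurable X]setTI; exact: mins.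
  by rewrite (integral_indic prod mA' (@measurable_insertable R)).
rewrite ge0_integral_pushforward//.
rewrite preimage_setT.
rewrite (ge0_integral_density (nu := prod) mG G0)//; last 2 first.
- by move=> x /=.
- exact: measurableT_comp.
rewrite fubini_tonelli1//.
  by apply: emeasurable_funM; [exact: measurableT_comp|exact/measurable_EFinP].
by move=> x /=; apply: mule_ge0 => //; rewrite lee_fin; exact: G0.
Qed.

End mecke.

(** * Comparison of the two laws *)

Section lipschitz.
Variable R : realType.
Local Notation J := (jump_pair R).
Implicit Types U V : J.

Lemma npairs_point : npairs (point : J) = 0%N.
Proof. by rewrite /npairs /ups /= fset_set0 cardfs0. Qed.

Lemma npairs_eq0 U : npairs U = 0%N -> U = point.
Proof.
move=> U0.
have u0 : ups U = set0.
  apply: (fset_set_set0 (@ups_finite _ U)).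
  by apply/cardfs0_eq.
have d0 : downs U = set0.
  apply: (fset_set_set0 (@downs_finite _ U)).
  by apply/cardfs0_eq; rewrite npairs_downs.
apply: val_inj; rewrite [LHS]surjective_pairing.
by change ((ups U, downs U) = (set0, set0)); rewrite u0 d0.
Qed.

Lemma insertable_off_diagonal U (rs : R * R) : insertable (U, rs) -> off_diagonal R rs.
Proof. by move=> [/= [r01 _] [s01 _] ne]; split. Qed.

Lemma neighbours_remove U n : npairs U = n.+1 ->
  exists2 V, neighbours U V & npairs V = n.
Proof.
move=> Un.
have [u0|/set0P[r ur]] := eqVneq (ups U) set0; first by move: Un; rewrite /npairs u0 fset_set0 cardfs0.
have [d0|/set0P[s ds]] := eqVneq (downs U) set0.
  by move: Un; rewrite -npairs_downs d0 fset_set0 cardfs0.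
have [I e nU] := Psi_remove ur ds.
exists (Psi r s U); last by apply/eq_add_S; rewrite -nU.
split; first by move=> h; move: nU; rewrite -h; lia.
by exists (r, s) => //; exact: insertable_off_diagonal I.
Qed.

Lemma graph_dist_neighbours U V : neighbours U V -> (graph_dist U V <= 1)%E.
Proof.
move=> UV; apply: ereal_inf_lbound => /=; exists 1%N => //.
by exists (fun i => if i is 0 then U else V); split => // -[].
Qed.

(** Removing the pairs one by one leads from U to the pair of empty sets along
edges of the graph. *)
Lemma Lip1_le_npairs (f : J -> R) : Lip1 f -> forall U, `|f U - f point| <= (npairs U)%:R.
Proof.
move=> [_ Lf] U; move: {2}(npairs U) (erefl (npairs U)) => n.
elim: n U => [|n IH] U Un; first by rewrite (npairs_eq0 Un) subrr normr0.
have [V UV Vn] := neighbours_remove Un.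
have h1 : `|f U - f V| <= 1.
  by rewrite -lee_fin; exact: le_trans (Lf U V) (graph_dist_neighbours UV).
have := IH V Vn; rewrite Vn Un => h2.
have -> : f U - f point = (f U - f V) + (f V - f point) by ring.
apply: (le_trans (ler_normD _ _)); rewrite -addn1 natrD; lra.
Qed.

End lipschitz.

Section signed_density.
Local Open Scope ereal_scope.
Context d (T : measurableType d) (R : realType).
Variables (mu nu : {measure set T -> \bar R}) (rho : T -> R).
Hypothesis mrho : measurable_fun setT rho.
Hypothesis rho0 : forall x, (0 <= rho x)%R.
Hypothesis murho : forall A, measurable A -> mu A = \int[nu]_(x in A) (rho x)%:E.

Lemma integral_density (f : T -> R) : mu.-integrable setT (EFin \o f) ->
  nu.-integrable setT (fun x => (f x * rho x)%:E) /\
  \int[mu]_x (f x)%:E = \int[nu]_x (f x * rho x)%:E.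
Proof.
move=> /integrableP[mf fi].
have mf' : measurable_fun setT f by exact/measurable_EFinP.
have mfr : measurable_fun setT (fun x => (f x * rho x)%:E).
  by apply/measurable_EFinP; exact: measurable_funM.
split.
  apply/integrableP; split => //.
  move: fi; rewrite (ge0_integral_density mrho rho0 murho)//; last first.
    exact: measurableT_comp.
  congr (_ < _); apply: eq_integral => x _ /=.
  by rewrite -EFinM normrM (ger0_norm (rho0 x)).
have mxr (g : T -> R) x : (fun x => (g x * rho x)%:E)^\+ x = (EFin \o g)^\+ x * (rho x)%:E.
  by rewrite !funeposE /= -!EFin_max -EFinM maxr_pMl// mul0r.
have mnr (g : T -> R) x : (fun x => (g x * rho x)%:E)^\- x = (EFin \o g)^\- x * (rho x)%:E.
  by rewrite !funenegE /= -!EFin_max -EFinM maxr_pMl// mul0r mulNr.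
rewrite [LHS]integralE [RHS]integralE; congr (_ - _).
  rewrite (ge0_integral_density mrho rho0 murho)//; last exact: measurable_funepos.
  by apply: eq_integral => x _; rewrite mxr.
rewrite (ge0_integral_density mrho rho0 murho)//; last exact: measurable_funeneg.
by apply: eq_integral => x _; rewrite mnr.
Qed.

End signed_density.

Section comparison.
Local Open Scope ereal_scope.
Variable R : realType.
Local Notation J := (jump_pair R).
Local Notation mR := (measurableTypeR R).
Implicit Types U V : J.
Variables (pi mu : {measure set J -> \bar R}) (rho : J -> R).
Local Notation G := (@insertable R : set (J * (mR * mR))).
Hypothesis pi1 : pi setT = 1.
Hypothesis mu1 : mu setT = 1.
Hypothesis mrho : measurable_fun setT rho.
Hypothesis rho_gt0 : forall U, (0 < rho U)%R.
Hypothesis murho : forall A, measurable A -> mu A = \int[pi]_(U in A) (rho U)%:E.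
Hypothesis pi_mecke : forall F : J -> \bar R, (forall U, 0 <= F U) -> measurable_fun setT F ->
  \int[pi]_U (F U * ((npairs U)%:R ^+ 2 : R)%:E) =
  \int[pi]_V \int[unif2 R]_rs (F (ins (V, rs)) * (\1_G (V, rs))%:E).

Let rho_ge0 U : (0 <= rho U)%R. Proof. exact: ltW. Qed.

Local Notation rho_o := (rho point).
Let u U : R := `|rho U - rho_o|%R.
Let n U : R := (npairs U)%:R.

Let mn : measurable_fun setT n.
Proof. exact: (measurable_npairs_fun (fun n => n%:R)). Qed.

Let mgap : measurable_fun setT u.
Proof. by apply: measurableT_comp => //; exact: measurable_funB. Qed.

Let u0 U : (0 <= u U)%R. Proof. exact: normr_ge0. Qed.
Let n0 U : (0 <= n U)%R. Proof. exact: ler0n. Qed.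

Let rho_total : \int[pi]_U (rho U)%:E = 1.
Proof. by rewrite -mu1 murho. Qed.

Let rho_int : pi.-integrable setT (EFin \o rho).
Proof.
apply/integrableP; split; first exact/measurable_EFinP.
under eq_integral => U _ do rewrite /= ger0_norm//.
by rewrite rho_total ltry.
Qed.

Let cst_int (c : R) : pi.-integrable setT (fun=> c%:E).
Proof.
apply/integrableP; split => //.
rewrite integral_cst//.
by rewrite [X in _ * X]pi1 mule1 ltry.
Qed.

(** Mecke's formula for the constant function 1, together with n <= n^2. *)
Lemma mean_npairs_le1 : \int[pi]_U (n U)%:E <= 1.
Proof.
apply: (@le_trans _ _ (\int[pi]_U (1 * ((npairs U)%:R ^+ 2 : R)%:E))).
  apply: le_integral_any => U _; rewrite mul1e lee_fin /n -natrX ler_nat.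
  by case: (npairs U) => // k; rewrite expnS expn1 leq_pmulr.
rewrite (pi_mecke (F := fun=> 1))//.
apply: (@le_trans _ _ (\int[pi]_V 1)); last by rewrite integral_cst// mul1e; rewrite [X in X <= _]pi1.
apply: le_integral_any => V _.
apply: (@le_trans _ _ (\int[unif2 R]_rs 1)).
  by apply: le_integral_any => rs _; rewrite mul1e lee_fin indicE lern1 leq_b1.
rewrite integral_cst// mul1e.
by rewrite [X in X <= _]probability_setT.
Qed.

(** The density has mean 1. *)
Lemma empty_density_le : `|rho_o - 1|%:E <= \int[pi]_U (u U)%:E.
Proof.
have e : (rho_o - 1)%:E = \int[pi]_U (rho_o - rho U)%:E.
  under eq_integral => U _ do rewrite EFinB.
  rewrite integralB//.
  rewrite rho_total integral_cst// [X in _ * X - _]pi1 mule1 EFinB//.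
rewrite -abse_EFin e; apply: (le_trans (le_abse_integral _ _ _)) => //.
  by apply/measurable_EFinP; exact: measurable_funB.
by apply: le_integral_any => U _; rewrite lee_fin distrC.
Qed.

(** Since both laws have mass 1, f may be replaced by f - f(o); then the
difference is the integral of this function times rho - 1, which is split as
(rho - rho_o) + (rho_o - 1). *)
Lemma lipschitz_gap (f : J -> R) : measurable_fun setT f ->
  (forall U, `|f U - f point| <= n U)%R ->
  pi.-integrable setT (EFin \o f) -> mu.-integrable setT (EFin \o f) ->
  `| \int[mu]_U (f U)%:E - \int[pi]_U (f U)%:E | <= \int[pi]_U ((n U + 1) * u U)%:E.
Proof.
move=> mf Lf fpi fmu.
have [fr ->] := integral_density mrho rho_ge0 murho fmu.
have e : \int[pi]_U (f U * rho U)%:E - \int[pi]_U (f U)%:E =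
    \int[pi]_U ((f U - f point) * (rho U - 1))%:E.
  have iZ := integrableZl measurableT (f point) rho_int.
  have := integralB measurableT (integrableB measurableT fr fpi)
                                (integrableB measurableT iZ (cst_int (f point))).
  rewrite (integralB measurableT fr fpi) (integralB measurableT iZ (cst_int (f point))).
  rewrite (integralZl measurableT rho_int) rho_total integral_cst//.
  rewrite [X in _ * 1 - _ * X]pi1 subee ?mule1// sube0 => <-.
  apply: eq_integral => U _; rewrite /=; congr EFin; ring.
rewrite e; apply: (le_trans (le_abse_integral _ _ _)) => //.
  by apply/measurable_EFinP; apply: measurable_funM; exact: measurable_funB.
have mnu : measurable_fun setT (fun U => (n U * u U)%:E).
  by apply/measurable_EFinP; exact: measurable_funM.
apply: (@le_trans _ _ (\int[pi]_U ((n U * u U)%:E + `|rho_o - 1|%:E * (n U)%:E))).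
  apply: le_integral_any => U _; rewrite -EFinM -EFinD lee_fin normrM.
  have : (`|rho U - 1| <= u U + `|rho_o - 1|)%R.
    have -> : (rho U - 1 = (rho U - rho_o) + (rho_o - 1))%R by ring.
    exact: ler_normD.
  move=> /(ler_pM (normr_ge0 _) (normr_ge0 _) (Lf U)) /le_trans -> //.
  by rewrite mulrDr [X in (_ + X)%R]mulrC.
have mnE : measurable_fun setT (EFin \o n) by exact/measurable_EFinP.
have muE : measurable_fun setT (EFin \o u) by exact/measurable_EFinP.
rewrite ge0_integralD//; last 3 first.
- by move=> U _; rewrite lee_fin mulr_ge0.
- by move=> U _; rewrite mule_ge0 ?lee_fin.
- exact: measurable_funeM.
rewrite ge0_integralZl//; last by move=> U _; rewrite lee_fin.
under [leRHS]eq_integral => U _ do rewrite mulrDl mul1r EFinD.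
rewrite ge0_integralD//; last 2 first.
- by move=> U _; rewrite lee_fin mulr_ge0.
- by move=> U _; rewrite lee_fin.
apply: leeD => //; apply: le_trans empty_density_le.
by rewrite -[leRHS]mule1; apply: lee_wpmul2l => //; exact: mean_npairs_le1.
Qed.

Let d V (rs : mR * mR) : R := (`|rho (ins (V, rs)) - rho V| * \1_G (V, rs))%R.

Let mins : measurable_fun setT (@ins R : J * (mR * mR) -> J) := @measurable_ins R.

Let mG : measurable_fun setT (\1_G : J * (mR * mR) -> R).
Proof. by apply: measurable_indic; exact: measurable_insertable. Qed.

Let d0 V rs : (0 <= d V rs)%R.
Proof. by rewrite /d mulr_ge0// indicE ler0n. Qed.

Let md : measurable_fun setT (fun x : J * (mR * mR) => (d x.1 x.2)%:E).
Proof.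
apply/measurable_EFinP; apply: measurable_funM.
  apply: measurableT_comp => //; apply: measurable_funB.
    rewrite (_ : (fun x => _) = rho \o (@ins R : J * (mR * mR) -> J)).
      exact: measurableT_comp.
    by apply/funext => -[].
  exact: measurableT_comp.
by rewrite (_ : (fun x => _) = (\1_G : J * (mR * mR) -> R)).
Qed.

(** Mean variation of the density under the insertion of a uniform pair. *)
Definition insertion_variation V : \bar R := \int[unif2 R]_rs (d V rs)%:E.

Lemma measurable_insertion_variation : measurable_fun setT insertion_variation.
Proof.
apply: (@measurable_fun_fubini_tonelli_F _ _ _ _ _ (unif2 R) _ md).
by move=> x; rewrite lee_fin.
Qed.

Let insertion_variation_ge0 V : 0 <= insertion_variation V.
Proof. by apply: integral_ge0 => rs _; rewrite lee_fin. Qed.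

Let trunc N V : R := ((n V + 1) * (npairs V <= N)%N%:R * u V)%R.

Let trunc0 N V : (0 <= trunc N V)%R.
Proof. by rewrite /trunc !mulr_ge0// addr_ge0. Qed.

Let mtrunc N : measurable_fun setT (trunc N).
Proof.
apply: measurable_funM => //.
exact: (measurable_npairs_fun (fun n => (n%:R + 1) * (n <= N)%N%:R)%R).
Qed.

Lemma trunc_fin N : \int[pi]_U (trunc N U)%:E < +oo.
Proof.
apply: (@le_lt_trans _ _ (\int[pi]_U ((N%:R + 1)%:E * ((rho U)%:E + rho_o%:E)))).
  apply: le_integral_any => U _; rewrite -EFinD -EFinM lee_fin /trunc.
  apply: ler_pM => //; first by rewrite mulr_ge0// addr_ge0.
    have [nN|_] := leqP (npairs U) N; last by rewrite mulr0 addr_ge0.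
    by rewrite mulr1 lerD2r /n ler_nat.
  by apply: (le_trans (ler_normB _ _)); rewrite !ger0_norm.
have mr : measurable_fun setT (EFin \o rho) by exact/measurable_EFinP.
rewrite ge0_integralZl//; last 2 first.
- exact: emeasurable_funD.
- by move=> U _; rewrite adde_ge0 ?lee_fin.
rewrite ge0_integralD//; last 2 first.
- by move=> U _; rewrite lee_fin.
- by move=> U _; rewrite lee_fin.
by rewrite rho_total integral_cst// [X in _ * (_ + _ * X)]pi1 mule1 -EFinD -EFinM ltry.
Qed.

(** The truncation at N makes the integral finite, so that it can be subtracted
from both sides of the inequality given by Mecke's formula. *)
Lemma trunc_le N : \int[pi]_U (trunc N U)%:E <= 4%:E * \int[pi]_V insertion_variation V.
Proof.
(* phi n * n^2 = 2 (n + 1) up to the level N; at n = 0 both sides are killed by u *)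
pose phi k : R := (2 * (k%:R + 1) / k%:R ^+ 2 * (k <= N)%N%:R)%R.
have phi0 k : (0 <= phi k)%R by rewrite /phi !mulr_ge0// ?addr_ge0// invr_ge0 exprn_ge0.
have mF : measurable_fun setT (fun U => (phi (npairs U) * u U)%:E).
  by apply/measurable_EFinP; apply: measurable_funM => //; exact: measurable_npairs_fun.
have F0 U : 0 <= (phi (npairs U) * u U)%:E by rewrite lee_fin mulr_ge0.
have mt : measurable_fun setT (EFin \o trunc N) by exact/measurable_EFinP.
have mv := measurable_insertion_variation.
have key : 2%:E * \int[pi]_U (trunc N U)%:E <=
    \int[pi]_U (trunc N U)%:E + 4%:E * \int[pi]_V insertion_variation V.
  rewrite -ge0_integralZl//; last by move=> U _; rewrite lee_fin.
  have -> : \int[pi]_U (2%:E * (trunc N U)%:E) =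
      \int[pi]_U ((phi (npairs U) * u U)%:E * ((npairs U)%:R ^+ 2 : R)%:E).
    apply: eq_integral => U _; rewrite -!EFinM; congr EFin.
    rewrite /trunc /phi; case E : (npairs U) => [|k].
      by rewrite (npairs_eq0 E) /u subrr normr0 !(mulr0, mul0r).
    rewrite /n E; have : (k.+1%:R : R)%R != 0%R by rewrite pnatr_eq0.
    by move: (k.+1%:R : R)%R => x x0; field.
  rewrite (pi_mecke F0 mF).
  rewrite -ge0_integralZl// -ge0_integralD//; last 3 first.
  - by move=> U _; rewrite lee_fin.
  - by move=> U _; rewrite mule_ge0.
  - exact: measurable_funeM.
  apply: le_integral_any => V _.
  apply: (@le_trans _ _ (\int[unif2 R]_rs ((trunc N V)%:E + 4%:E * (d V rs)%:E))).
    apply: le_integral_any => rs _.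
    rewrite -!EFinM -EFinD lee_fin /d indicE.
    case: (boolP ((V, rs) \in G)) => [|_]; last first.
      by rewrite !mulr0 addr0.
    (* 2 (k + 2) / (k + 1)^2 is at most 4, and at most k + 1 if k > 0 *)
    rewrite inE => I; rewrite !mulr1 (ins_npairs I).
    set k := npairs V; set w := (`|_ - _|)%R.
    have w0 : (0 <= w)%R by exact: normr_ge0.
    have ui : (u (ins (V, rs)) <= u V + w)%R.
      rewrite /u /w; have -> : (rho (ins (V, rs)) - rho_o =
        (rho V - rho_o) + (rho (ins (V, rs)) - rho V))%R by ring.
      exact: ler_normD.
    apply: (le_trans (ler_wpM2l (phi0 k.+1) ui)); rewrite mulrDr; apply: lerD.
      rewrite /trunc; have [V0|kpos] := posnP k.
        by rewrite (npairs_eq0 V0) /u subrr normr0 !mulr0.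
      apply: ler_wpM2r => //; rewrite /phi /n -/k.
      have [kN|_] := leqP k.+1 N; last by rewrite mulr0 mulr_ge0// addr_ge0.
      rewrite (ltnW kN) !mulr1 ler_pdivrMr; last by rewrite exprn_gt0// ltr0n.
      have : (1 <= k%:R :> R)%R by rewrite ler1n.
      rewrite -[k.+1]addn1 natrD => k1; have : (0 <= k%:R * (k%:R - 1) :> R)%R.
        by rewrite mulr_ge0// subr_ge0.
      nra.
    apply: ler_wpM2r => //; rewrite /phi.
    apply: (@le_trans _ _ (2 * (k.+1%:R + 1) / k.+1%:R ^+ 2)%R).
      rewrite -[leRHS]mulr1; apply: ler_wpM2l; last by case: (_ <= _)%N.
      by rewrite mulr_ge0// ?invr_ge0 ?exprn_ge0// mulr_ge0// addr_ge0.
    rewrite ler_pdivrMr; last by rewrite exprn_gt0// ltr0n.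
    have : (1 <= k.+1%:R :> R)%R by rewrite ler1n.
    by nra.
  have mdV : measurable_fun setT (fun rs : mR * mR => (d V rs)%:E).
    exact: (measurableT_comp md (pair1_measurable V)).
  rewrite ge0_integralD//; last 3 first.
  - by move=> rs _; rewrite lee_fin.
  - by move=> rs _; rewrite mule_ge0 ?lee_fin.
  - exact: measurable_funeM.
  rewrite ge0_integralZl//; last by move=> rs _; rewrite lee_fin.
  rewrite integral_cst// [X in _ * X + _]probability_setT mule1.
  by [].
have fa : \int[pi]_U (trunc N U)%:E \is a fin_num.
  by rewrite ge0_fin_numE ?trunc_fin//; apply: integral_ge0 => U _; rewrite lee_fin.
have e2 : 2%:E * \int[pi]_U (trunc N U)%:E =
    \int[pi]_U (trunc N U)%:E + \int[pi]_U (trunc N U)%:E.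
  by rewrite -(fineK fa) -EFinM -EFinD; congr EFin; ring.
by move: key; rewrite e2 leeD2lE.
Qed.

Lemma weighted_gap_le :
  \int[pi]_U ((n U + 1) * u U)%:E <= 4%:E * \int[pi]_V insertion_variation V.
Proof.
have nd U : {homo (fun N => (trunc N U)%:E) : N N' / (N <= N')%N >-> N <= N'}.
  move=> N N' NN; rewrite lee_fin /trunc ler_wpM2r// ler_wpM2l ?addr_ge0//.
  by have [UN|//] := leqP (npairs U) N; rewrite (leq_trans UN).
have limE U : ((n U + 1) * u U)%:E = limn (fun N => (trunc N U)%:E).
  apply/esym/lim_near_cst => //; exists (npairs U) => // N /= UN.
  by rewrite /trunc UN mulr1.
under eq_integral => U _ do rewrite limE.
rewrite (monotone_convergence pi measurableT); first last.
- by move=> U _; exact: nd.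
- by move=> N U _; rewrite lee_fin.
- by move=> N; exact/measurable_EFinP.
apply: lime_le; last by near=> N; exact: trunc_le.
apply: ereal_nondecreasing_is_cvgn => N N' NN.
by apply: le_integral_any => U _; exact: nd.
Unshelve. all: by end_near. Qed.

(** As mu has density rho, integrating under pi is integrating under mu after
division by rho. *)
Lemma insertion_variation_le (D : J -> \bar R) : (forall U, 0 <= D U) ->
  (forall U rs, insertable (U, rs) ->
     (`|rho (ins (U, rs)) - rho U| / rho U)%:E <= D U) ->
  \int[pi]_V insertion_variation V <= \int[mu]_V D V.
Proof.
move=> D0 HD.
have minv : measurable_fun setT (fun V => (rho V)^-1%:E).
  apply/measurable_EFinP.
  rewrite (_ : (fun V => _) = (fun V => expR (- ln (rho V)))).
    apply: measurableT_comp => //; apply: measurableT_comp => //.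
    exact: measurableT_comp (@measurable_ln R) mrho.
  by apply/funext => V; rewrite expRN lnK ?posrE.
have -> : \int[pi]_V insertion_variation V =
    \int[pi]_V (insertion_variation V * (rho V)^-1%:E * (rho V)%:E).
  apply: eq_integral => V _.
  by rewrite -muleA -EFinM mulVf ?mule1// lt0r_neq0.
rewrite -(ge0_integral_density mrho rho_ge0 murho); last 2 first.
- by move=> V; rewrite mule_ge0// lee_fin invr_ge0.
- by apply: emeasurable_funM => //; exact: measurable_insertion_variation.
apply: le_integral_any => V _.
have mdV : measurable_fun setT (fun rs : mR * mR => (d V rs)%:E).
  exact: (measurableT_comp md (pair1_measurable V)).
rewrite /insertion_variation -ge0_integralZr//; last 2 first.
- by move=> rs _; rewrite lee_fin.
- by rewrite lee_fin invr_ge0.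
have := HD V; have := D0 V; case: (D V) => [c c0 hc|_ _|//]; last exact: leey.
apply: (@le_trans _ _ (\int[unif2 R]_rs c%:E)).
  apply: le_integral_any => rs _; rewrite -EFinM lee_fin /d indicE.
  case: (boolP ((V, rs) \in G)) => [|_]; last by rewrite mulr0 mul0r.
  by rewrite inE mulr1 => I; rewrite -lee_fin; exact: hc.
by rewrite integral_cst// [X in _ * X]probability_setT mule1.
Qed.

End comparison.

(** * Normalisation and conclusion *)

Section normalisation.
Variable R : realType.
Local Notation T := (skorokhod R).
Local Notation J := (jump_pair R).
Variables a b : int -> R.
Hypothesis a0 : forall j, 0 < a j.
Hypothesis b0 : forall j, 0 < b j.
Variable P : probability T R.
Hypothesis PG : has_generator a b P.

Lemma start_gt0 : (0 < P [set w : T | w 0%R = 0%R])%E -> 0 < fine (P [set w : T | w 0 = 0]).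
Proof.
move=> h; rewrite fine_gt0// h /=; apply: (le_lt_trans (probability_le1 _ _)); last exact: ltry.
by apply: (@measurable_coord R 0 0); rewrite lexx ler01.
Qed.

Lemma pinned_gt0 : 0 < fine (P [set w : T | w 0 = 0]) -> 0 < fine (P (pinned R)).
Proof.
move=> q0; have [C [m0 H]] := key_estimate a0 b0 PG 0.
have [m1 g] := good_eventually (point : J).
have gm := good_le (leq_maxr m0 m1) g.
have /andP[h _] := H _ (leq_maxl m0 m1) point (npairs_point R) gm.
have : fine (P (box (maxn m0 m1) (point : J))) <= fine (P (pinned R)).
  apply: p_le; [exact: measurable_box|exact: measurable_pinned|exact: box_sub_pinned].
apply: lt_le_trans; apply: (lt_le_trans _ h).
rewrite double0 expr0 mulr1; apply: mulr_gt0; last exact: expR_gt0.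
by apply: mulr_gt0 => //; exact: M_gt0.
Qed.

Lemma inv_pinned_ge0 : 0 <= (fine (P (pinned R)))^-1.
Proof. by rewrite invr_ge0 p_ge0. Qed.

Definition normalised := mscale (NngNum inv_pinned_ge0) (bridge_mass P).

Lemma bridge_lawE : bridge_law P = normalised.
Proof. by apply/funext => A; rewrite /bridge_law muleC. Qed.

Lemma normalised_total : 0 < fine (P (pinned R)) -> normalised setT = 1%E.
Proof.
move=> z0; rewrite /normalised /mscale /= (bridge_mass_total a0 b0 PG).
rewrite (pE P (@measurable_pinned R)) -EFinM mulVf// lt0r_neq0//.
Qed.

End normalisation.

Section bridges.
Variable R : realType.
Local Notation T := (skorokhod R).
Local Notation J := (jump_pair R).
Variables a b : int -> R.
Hypothesis a0 : forall j, 0 < a j.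
Hypothesis b0 : forall j, 0 < b j.
Variables P Q : probability T R.
Hypothesis PG : has_generator a b P.
Hypothesis QG : has_generator (fun=> 1) (fun=> 1) Q.
Hypothesis p0 : 0 < fine (P [set w : T | w 0 = 0]).
Hypothesis q0 : 0 < fine (Q [set w : T | w 0 = 0]).

Lemma normalised_density : exists2 k : R, 0 < k & forall A : set J, measurable A ->
  normalised P A = (\int[normalised Q]_(U in A) (k * M a b (jump_path U))%:E)%E.
Proof.
have zP := pinned_gt0 a0 b0 PG p0.
have l01 : forall j : int, 0 < (fun=> 1 : R) j by move=> j; exact: ltr01.
have zQ := pinned_gt0 l01 l01 QG q0.
pose c := fine (P [set w : T | w 0 = 0]) * expR 2 / fine (Q [set w : T | w 0 = 0]).
have c0 : 0 < c by rewrite divr_gt0// mulr_gt0// expR_gt0.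
pose k := (fine (P (pinned R)))^-1 * fine (Q (pinned R)) * c.
have k0 : 0 < k by rewrite !mulr_gt0// invr_gt0.
exists k => // A mA.
have mM : measurable_fun A (fun U => (M a b (jump_path U))%:E).
  apply: measurable_funTS; apply/measurable_EFinP.
  exact: (measurable_M a0 b0 PG p0).
have M0 U : A U -> (0 <= (M a b (jump_path U))%:E)%E.
  by move=> _; rewrite lee_fin; apply/ltW/M_gt0.
have scale (r : R) : 0 <= r -> (\int[bridge_mass Q]_(U in A) (r * M a b (jump_path U))%:E =
    r%:E * \int[bridge_mass Q]_(U in A) (M a b (jump_path U))%:E)%E.
  move=> r0; under eq_integral => U _ do rewrite EFinM.
  by rewrite ge0_integralZl.
rewrite ge0_integral_mscale//; last 2 first.
- by under eq_fun => U do rewrite EFinM; exact: measurable_funeM.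
- by move=> U AU; rewrite EFinM mule_ge0 ?lee_fin ?(ltW k0)//; exact: M0.
rewrite (scale k (ltW k0)) {1}/normalised {1}/mscale /=.
rewrite (bridge_mass_density a0 b0 PG QG p0 q0 mA) (scale c (ltW c0)).
rewrite !muleA -!EFinM; congr ((_)%:E * _)%E.
by rewrite /k; field; rewrite !lt0r_neq0.
Qed.

Lemma normalised_mecke (F : J -> \bar R) : (forall U, 0 <= F U)%E -> measurable_fun setT F ->
  (\int[normalised Q]_U (F U * ((npairs U)%:R ^+ 2 : R)%:E) =
   \int[normalised Q]_V \int[unif2 R]_rs
     (F (ins (V, rs)) * (\1_(@insertable R : set (J * (measurableTypeR R * measurableTypeR R))) (V, rs))%:E))%E.
Proof.
move=> F0 mF.
have mi := @measurable_insertable R; have mins := @measurable_ins R.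
have mFi : measurable_fun setT (fun x : J * (measurableTypeR R * measurableTypeR R) =>
    (F (ins x) * (\1_(@insertable R) x)%:E)%E).
  apply: emeasurable_funM; first exact: measurableT_comp.
  by apply/measurable_EFinP; exact: measurable_indic.
have Fi0 x : (0 <= F (ins x) * (\1_(@insertable R) x)%:E)%E.
  by apply: mule_ge0 => //; rewrite lee_fin indicE.
rewrite !ge0_integral_mscale//.
- by rewrite (mecke QG).
- exact: (@measurable_fun_fubini_tonelli_F _ _ _ _ _ (unif2 R) _ mFi Fi0).
- by move=> V _; apply: integral_ge0 => rs _; exact: Fi0.
- apply: emeasurable_funM => //; apply/measurable_EFinP.
  exact: (measurable_npairs_fun (fun n => n%:R ^+ 2)).
- by move=> U _; apply: mule_ge0 => //; rewrite lee_fin exprn_ge0.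
Qed.

End bridges.

Lemma off_diagonal_thirds (R : realType) : off_diagonal R (1 / 3, 2 / 3).
Proof.
split => /=; [lra|lra|].
by move=> h; have : (1 / 3 : R) < 2 / 3; [lra|rewrite h ltxx].
Qed.

Theorem corollary3p24 (R : realType) (a b : int -> R)
    (a_gt0 : forall j, 0 < a j) (b_gt0 : forall j, 0 < b j)
    (Pab P11 : probability (skorokhod R) R)
    (Pab_walk : has_generator a b Pab)
    (P11_walk : has_generator (fun=> 1) (fun=> 1) P11)
    (Pab_start : (0 < Pab [set w : skorokhod R | w 0%R = 0%R])%E)
    (P11_start : (0 < P11 [set w : skorokhod R | w 0%R = 0%R])%E) :
  (dW1 (bridge_law Pab) (bridge_law P11) <=
   9%:E * \int[bridge_law Pab]_U
            ereal_sup [set `|grad_log_M a b uv.1 uv.2 U|%:E | uv in off_diagonal R])%E.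
Proof.
have l01 : forall j : int, 0 < (fun=> 1 : R) j by move=> j; exact: ltr01.
have p0 := start_gt0 Pab_start; have q0 := start_gt0 P11_start.
have zP := pinned_gt0 a_gt0 b_gt0 Pab_walk p0.
have zQ := pinned_gt0 l01 l01 P11_walk q0.
rewrite !bridge_lawE.
set mu := normalised Pab; set pi := normalised P11.
have mu1 : mu setT = 1%E by rewrite /mu (normalised_total a_gt0 b_gt0 Pab_walk zP).
have pi1 : pi setT = 1%E by rewrite /pi (normalised_total l01 l01 P11_walk zQ).
have [k k0 murho] := normalised_density a_gt0 b_gt0 Pab_walk P11_walk p0 q0.
pose MJ (U : jump_pair R) := M a b (jump_path U).
pose rho (U : jump_pair R) := k * MJ U.
have MJ0 U : 0 < MJ U by exact: M_gt0.
have rho_gt0 U : 0 < rho U by rewrite mulr_gt0.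
have mMJ : measurable_fun setT MJ by exact: (measurable_M a_gt0 b_gt0 Pab_walk p0).
have mrho : measurable_fun setT rho by exact: measurable_funM.
have pi_mecke := normalised_mecke P11_walk.
pose D (U : jump_pair R) := ereal_sup [set `|grad_log_M a b uv.1 uv.2 U|%:E | uv in off_diagonal R].
have D0 U : (0 <= D U)%E.
  apply: (@le_trans _ _ `|grad_log_M a b (1/3) (2/3) U|%:E); first by rewrite lee_fin.
  apply: ereal_sup_ubound; exists (1/3, 2/3) => //.
  exact: off_diagonal_thirds.
have D_ge U rs : insertable (U, rs) -> ((`|rho (ins (U, rs)) - rho U| / rho U)%:E <= D U)%E.
  move=> I; apply: ereal_sup_ubound; exists rs; first exact: insertable_off_diagonal I.
  rewrite /grad_log_M (insE I) /=; congr EFin.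
  rewrite normrM normfV (gtr0_norm (MJ0 U)) /rho -mulrBr normrM (gtr0_norm k0).
  by rewrite -mulf_div divff ?mul1r// lt0r_neq0.
have bound : (4%:E * \int[pi]_V insertion_variation rho V <= 9%:E * \int[mu]_U D U)%E.
  apply: (@le_trans _ _ (4%:E * \int[mu]_U D U)%E).
    by apply: lee_wpmul2l => //; exact: insertion_variation_le.
  by apply: lee_wpmul2r; [exact: integral_ge0|rewrite lee_fin ler_nat].
apply: ge_ereal_sup => _ [f [[mf Lf] fmu fpi] <-].
apply: le_trans bound.
apply: le_trans (weighted_gap_le pi1 mu1 mrho rho_gt0 murho pi_mecke).
apply: (lipschitz_gap pi1 mu1 mrho rho_gt0 murho pi_mecke) => //.
exact: Lip1_le_npairs.
Qed.
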